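(* The following decision problem is NP-hard: given as input a graph $F$ with $n$ vertices, decide whether $\operatorname{wsat}(F, K_3) = n-1$.
   Context: Graphs are finite and simple; $K_3$ denotes the complete graph on three vertices, and $E(\cdot)$ denotes the edge set of a graph. Let $F$ and $H$ be graphs and let $G$ be a spanning subgraph of $F$. We say that $G$ is weakly $H$-saturated in $F$ if the edges of $E(F)\setminus E(G)$ can be ordered into a sequence $e_1,\dots,e_m$ in such a way that for every $i\in\{1,\dots,m\}$ the graph obtained from $G$ by adding the edges $e_1,\dots,e_i$ contains a copy of $H$ which contains $e_i$. The weak saturation number $\operatorname{wsat}(F,H)$ is the minimum number of edges of a graph which is weakly $H$-saturated in $F$. *)

(* Defs.v *)
From HB Require Import structures.
From mathcomp Require Import all_boot all_order all_algebra.

Set Implicit Arguments.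
Unset Strict Implicit.
Unset Printing Implicit Defensive.

(** * Graphs and weak saturation *)

Record graph (V : finType) := Graph {
  edges : {set {set V}};
  edgesP : [forall e in edges, #|e| == 2]
}.

HB.instance Definition _ (V : finType) := [isSub for @edges V].
HB.instance Definition _ (V : finType) := [Finite of graph V by <:].

Lemma complete_edgesP (V : finType) :
  [forall e in [set e : {set V} | #|e| == 2], #|e| == 2].
Proof. by apply/forall_inP=> e; rewrite inE. Qed.

Definition complete (V : finType) : graph V := Graph (complete_edgesP V).

Definition K3 : graph 'I_3 := complete 'I_3.

(* The graph with edge set [E] contains a (not necessarily induced) copy of
   [H], and [e] is one of the edges of this copy. *)
Definition copy_through (W V : finType) (H : graph W) (E : {set {set V}})
    (e : {set V}) : bool :=
  [exists f : {ffun W -> V},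
    [&& injectiveb f,
        [forall d in edges H, f @: d \in E]
      & [exists d in edges H, f @: d == e]]].

(* [s] is the ordering e_1, ..., e_m of the missing edges; [tnth s i] is
   e_(i+1), so that [take i.+1 s] is e_1, ..., e_(i+1). *)
Definition weakly_saturated (W V : finType) (H : graph W) (F G : graph V)
    : bool :=
  (edges G \subset edges F) &&
  [exists s : #|edges F :\: edges G|.-tuple {set V},
    perm_eq s (enum (edges F :\: edges G)) &&
    [forall i : 'I_#|edges F :\: edges G|,
      copy_through H (edges G :|: [set:: take i.+1 s]) (tnth s i)]].

Lemma weakly_saturated_refl (W V : finType) (H : graph W) (F : graph V) :
  weakly_saturated H F F.
Proof.
rewrite /weakly_saturated subxx /= setDv.
have sz0 : #|@set0 {set V}| = 0 by rewrite cards0.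
apply/existsP; exists (tcast (esym sz0) [tuple]).
rewrite val_tcast enum_set0 perm_refl /=.
by apply/forallP => -[i lt_i]; exfalso; rewrite sz0 in lt_i.
Qed.

(* By [weakly_saturated_refl] the minimum is over a nonempty set. *)
Definition wsat (V W : finType) (F : graph V) (H : graph W) : nat :=
  #|edges [arg min_(G < F | weakly_saturated H F G) #|edges G|]|.

(** * Deterministic multitape Turing machines over binary input *)

(* [None] is the blank; the machine may use further symbols from [W]. *)
Definition symbol (W : finType) := option (bool + W).

Inductive move := MoveLeft | Stay | MoveRight.

(* A two-way infinite tape (l, r): [r] is read from the head rightwards, [l]
   from the cell left of the head leftwards; all other cells are blank. *)
Definition tape (W : finType) := (seq (symbol W) * seq (symbol W))%type.

Definition read (W : finType) (t : tape W) : symbol W := head None t.2.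

Definition write (W : finType) (a : symbol W) (t : tape W) : tape W :=
  (t.1, a :: behead t.2).

Definition shift (W : finType) (m : move) (t : tape W) : tape W :=
  match m with
  | MoveLeft => (behead t.1, head None t.1 :: t.2)
  | Stay => t
  | MoveRight => (head None t.2 :: t.1, behead t.2)
  end.

Record machine := Machine {
  state : finType;
  work : finType;
  ntapes : nat; (* the number of tapes minus one *)
  start : state;
  halting : pred state;
  delta : state -> {ffun 'I_ntapes.+1 -> symbol work} ->
          state * ('I_ntapes.+1 -> symbol work * move)
}.

Definition config (M : machine) :=
  (state M * {ffun 'I_(ntapes M).+1 -> tape (work M)})%type.

(* Halting configurations are fixed, hence "halted after t steps" below means
   "halted within t steps". *)
Definition step (M : machine) (c : config M) : config M :=
  if halting c.1 then c else
  let: (q, act) := delta c.1 [ffun i => read (c.2 i)] in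
  (q, [ffun i => shift (act i).2 (write (act i).1 (c.2 i))]).

Definition init (M : machine) (x : seq bool) : config M :=
  (start M,
   [ffun i => if i == ord0 then ([::], [seq Some (inl b) | b <- x])
              else ([::], [::])]).

Fixpoint leading_bits (W : finType) (s : seq (symbol W)) : seq bool :=
  if s is Some (inl b) :: s' then b :: leading_bits s' else [::].

(* The output starts under the head of the first tape and extends to the
   right up to the first symbol that is not a bit. *)
Definition output (M : machine) (c : config M) : seq bool :=
  leading_bits (c.2 ord0).2.

Definition polytime (f : seq bool -> seq bool) : Prop :=
  exists (M : machine) (p : {poly nat}), forall x : seq bool,
    let c := iter (p.[size x])%R (@step M) (init M x) in
    halting c.1 /\ output c = f x.

(** * NP-hardness under polynomial-time many-one reductions *)

Definition language := seq bool -> Prop.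

(* Self-delimiting encoding of pairs of binary strings. *)
Definition encode_pair (x y : seq bool) : seq bool :=
  flatten [seq [:: true; b] | b <- x] ++ false :: y.

Definition NP (A : language) : Prop :=
  exists (V : seq bool -> bool) (p : {poly nat}),
    polytime (fun z => [:: V z]) /\
    forall x, A x <->
      exists y : seq bool, size y <= (p.[size x])%R /\ V (encode_pair x y).

Definition reduces (A B : language) : Prop :=
  exists f : seq bool -> seq bool, polytime f /\ forall x, A x <-> B (f x).

Definition NP_hard (B : language) : Prop :=
  forall A : language, NP A -> reduces A B.

(** * The decision problem *)

(* The adjacency matrix, row by row. *)
Definition encode_graph (n : nat) (F : graph 'I_n) : seq bool :=
  [seq [set i; j] \in edges F | i <- enum 'I_n, j <- enum 'I_n].

(* The equation wsat(F, K_3) = n - 1 is written without truncated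
   subtraction, so the graph without vertices is a negative instance. *)
Definition wsat_K3_minimal : language := fun x =>
  exists (n : nat) (F : graph 'I_n),
    x = encode_graph F /\ (wsat F K3).+1 = n.

(* Main.v *)
(* A CNF whose clauses have five literals is turned into a graph F on n vertices
   whose clique complex is glued from a 2-sphere for each variable and a cyclic
   chain of 25 gates for each clause. If wsat(F, K_3) = n - 1, then every added
   edge is created by its own triangle, and an Euler characteristic count leaves
   as many unused triangles as there are variables. A nonempty set of used
   triangles cannot be closed, i.e. have each edge of a member in another member:
   the last edge created by a member would be in no other member. Hence every
   sphere has exactly one unused triangle, and the hemisphere containing it is
   the truth value of the variable. The gates of a false clause and the other
   hemispheres would form a closed set of used triangles; conversely a true
   literal frees one gate, and the gates collapse one after another.

   The CNF describes an accepting computation of the NP verifier on tapes closed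
   up to a ring. Vertices are named by four numbers, adjacency of names is a
   quantifier-free condition with linear inequalities and input bits, and a
   Turing machine prints the adjacency matrix by eight nested loops. *)

(* Weak saturation that uses one triangle per added edge, read backwards, collapses the complex of
   used triangles; the value n - 1 is the least possible one for a connected graph. The obstacle is
   to let a clause depend on a single one of its literals. A gate has two entrances, the edges 01
   and 12; freeing either of them removes all its triangles and so frees the other one. In the ring
   of a clause the entrance 01 of each gate also lies in a triangle of the preceding gate. One
   released literal therefore opens the whole ring, and with it the boundaries of the hemispheres,
   while a ring without a released literal stays shut. The transition rule has four premises and one
   conclusion, hence five literals. Each literal takes five gates, one at its own edge and four
   along the boundary of the hemispheres, hence 25. The clauses only force the letters of a
   computation to be true; a cell may carry further true letters without harm, so no clause demands
   uniqueness. *)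
From HB Require Import structures.
Require Import Defs.
From mathcomp Require Import all_boot all_order all_algebra.
From mathcomp Require Import zify.

Set Implicit Arguments.
Unset Strict Implicit.
Unset Printing Implicit Defensive.

(** * Weak saturation for triangles: closure, creation order and used triangles *)

Section WeakTriangleSaturation.

Variable V : finType.
Implicit Types (F G : graph V) (E : {set {set V}}) (u v w : V).

Definition adj F u v := [set u; v] \in edges F.

Lemma adjC F u v : adj F u v = adj F v u.
Proof. by rewrite /adj setUC. Qed.

Lemma card_edge F e : e \in edges F -> #|e| = 2.
Proof. by move=> eF; apply/eqP; move/forall_inP: (edgesP F); apply. Qed.

Lemma adj_neq F u v : adj F u v -> u != v.
Proof. by move/card_edge; rewrite cards2; case: (u != v). Qed.

Lemma copy_throughK3 E e :
  copy_through K3 E e <->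
  exists a b c, [/\ a != b, a != c & b != c] /\
    [/\ e = [set a; b], [set a; b] \in E, [set a; c] \in E & [set b; c] \in E].
Proof.
split.
  case/existsP=> f /and3P[/injectiveP f_inj /forall_inP fE].
  case/exists_inP=> d; rewrite inE => /cards2P[i [j [ij ->]]] /eqP<-.
  have [k] : exists k : 'I_3, k \notin [set i; j].
    have : 0 < #|~: [set i; j]| by rewrite cardsCs setCK card_ord cards2 ij.
    by case/card_gt0P => k; rewrite inE; exists k.
  rewrite !inE negb_or => /andP[ki kj].
  exists (f i), (f j), (f k).
  have fE' x y : x != y -> [set f x; f y] \in E.
    by move=> xy; have := fE [set x; y]; rewrite inE cards2 xy imsetU1 imset_set1; apply.
  rewrite !(inj_eq f_inj) ij eq_sym ki eq_sym kj !fE' // 1?eq_sym //.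
  by rewrite imsetU1 imset_set1.
case=> a [b [c [[ab ac bc] [-> abE acE bcE]]]].
pose f := [ffun i : 'I_3 => nth a [:: a; b; c] i].
have f_inj : injective f.
  move=> i j; rewrite !ffunE => /eqP; rewrite nth_uniq //= ?inE; first by move/eqP/val_inj.
  by rewrite negb_or ab ac bc.
apply/existsP; exists f; apply/and3P; split; first exact/injectiveP.
- apply/forall_inP=> d; rewrite inE => /cards2P[i [j [ij ->]]].
  rewrite imsetU1 imset_set1 !ffunE.
  case: i j ij => [[|[|[|i]]] Hi] [[|[|[|j]]] Hj] //= _;
    by rewrite // setUC.
- apply/exists_inP; exists [set inord 0; inord 1].
    by rewrite inE cards2 -val_eqE /= !inordK.
  by rewrite imsetU1 imset_set1 !ffunE !inordK.
Qed.

(** The process without its order: the closure of the edges of [G] under completing triangles along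
    edges of [F]. Since added edges never hurt, the order of additions does not influence what can
    be reached. *)
Inductive active F G : V -> V -> Prop :=
| ActiveEdge u v : adj G u v -> active F G u v
| ActiveTriangle u v w :
    adj F u v -> active F G u w -> active F G w v -> active F G u v.

Lemma active_sym F G u v : active F G u v -> active F G v u.
Proof.
elim=> {u v} [u v uv|u v w uv _ uw _ wv]; first by apply: ActiveEdge; rewrite adjC.
by apply: (ActiveTriangle (w := w)) => //; rewrite adjC.
Qed.

Lemma active_adj F G u v :
  edges G \subset edges F -> active F G u v -> adj F u v.
Proof. by move=> /subsetP GF; case=> // {}u {}v; apply: GF. Qed.

(** [E] holds the edges present so far. If no missing edge closed a triangle over [E], induction on
    [active] would put every active pair into [E], hence all of [F]. So a greedy choice never gets
    stuck. *)
Lemma saturating_sequence F G n E :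
    (forall u v, adj F u v -> active F G u v) ->
    edges G \subset E -> E \subset edges F -> #|edges F :\: E| = n ->
  exists2 s, perm_eq s (enum (edges F :\: E)) &
    forall i, i < n ->
      copy_through K3 (E :|: [set:: take i.+1 s]) (nth set0 s i).
Proof.
move=> act; elim: n E => [|n IHn] E GE EF cE.
  exists [::] => //; have /eqP -> : edges F :\: E == set0 by rewrite -cards_eq0 cE.
  by rewrite enum_set0.
have GF := subset_trans GE EF.
have [e eFE eE] : exists2 e, e \in edges F :\: E & copy_through K3 (e |: E) e.
  have [/exists_inP //|/exists_inPn noe] :=
    boolP [exists e in edges F :\: E, copy_through K3 (e |: E) e].
  suff : edges F \subset E by rewrite -setD_eq0 => /eqP E0; move: cE; rewrite E0 cards0.
  have actE u v : active F G u v -> [set u; v] \in E.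
    elim=> {u v} [u v|u v w uv auw uwE awv wvE]; first exact: (subsetP GE).
    apply: contraT => uvE; have := noe [set u; v].
    rewrite inE uvE -/(adj F u v) uv => /(_ isT)/negP[].
    apply/copy_throughK3; exists u, v, w; split; split.
    - exact: adj_neq uv.
    - by have /adj_neq := active_adj GF auw.
    - by rewrite eq_sym; have /adj_neq := active_adj GF awv.
    - by [].
    - by rewrite !inE eqxx.
    - by rewrite !inE uwE orbT.
    - by rewrite setUC !inE wvE orbT.
  apply/subsetP=> e eF; have /eqP/cards2P[u [v [_ def_e]]] := card_edge eF.
  by rewrite def_e; apply/actE/act; rewrite /adj -def_e.
have [eF eNE] := setDP eFE.
have [|||s s_perm sE] := IHn (e |: E).
- exact: subset_trans GE (subsetUr _ _).
- by rewrite subUset sub1set eF.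
- move: cE; rewrite [#|edges F :\: E|](cardsD1 e) eFE add1n => -[<-].
  by congr #|pred_of_set _|; rewrite setDDl setUC.
exists (e :: s).
  rewrite -perm_rcons; apply: uniq_perm.
  - rewrite rcons_uniq (perm_uniq s_perm) enum_uniq andbT (perm_mem s_perm).
    by rewrite mem_enum !inE eqxx.
  - exact: enum_uniq.
  move=> d; rewrite mem_rcons inE (perm_mem s_perm) !mem_enum !inE.
  by case: eqP => [->|//]; rewrite eNE eF.
case=> [_|i /= ltin]; first by rewrite /= take0 set_cons [[set:: [::]]](_ : _ = set0)
    ?setU0 1?setUC //; apply/setP=> x; rewrite !inE.
by rewrite set_cons setUCA setUA -setUA; move: (sE i ltin); rewrite setUA.
Qed.

Lemma active_saturated F G :
  edges G \subset edges F -> (forall u v, adj F u v -> active F G u v) ->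
  weakly_saturated K3 F G.
Proof.
move=> GF act; rewrite /weakly_saturated GF /=.
have [s s_perm sE] := saturating_sequence act (subxx _) GF erefl.
have sz_s : size s == #|edges F :\: edges G| by rewrite (perm_size s_perm) cardE.
apply/existsP; exists (Tuple sz_s); rewrite s_perm; apply/forallP=> i /=.
by rewrite (tnth_nth set0) /=; apply: sE.
Qed.

Definition triangles F : {set {set V}} :=
  [set t : {set V} | (#|t| == 3) && [forall e : {set V}, (e \subset t) && (#|e| == 2) ==> (e \in edges F)]].

Lemma mem_triangles F u v w :
  u != v -> u != w -> v != w ->
  ([set u; v; w] \in triangles F) = [&& adj F u v, adj F u w & adj F v w].
Proof.
move=> uv uw vw; rewrite inE setUC cardsU1 cards2 !inE negb_or.
rewrite ![w == _]eq_sym uw vw uv /=.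
rewrite setUC; apply/forall_inP/and3P => [FE|[Fuv Fuw Fvw] e /andP[e_sub /cards2P[a [b [ab def_e]]]]].
  split; apply: FE; rewrite cards2 ?uv ?uw ?vw andbT subUset !sub1set !inE !eqxx ?orbT //.
move: e_sub; rewrite def_e subUset !sub1set !inE -!orbA => /andP[].
case/or3P=> /eqP def_a; case/or3P=> /eqP def_b; subst a b;
  rewrite ?eqxx // in ab *; by rewrite -/(adj F _ _) // adjC.
Qed.

Lemma trianglesP F t : t \in triangles F ->
  exists u v w, t = [set u; v; w] /\ [/\ adj F u v, adj F u w & adj F v w].
Proof.
rewrite inE => /andP[/eqP t3 /forall_inP tE].
have /card_gt0P[u ut] : 0 < #|t| by rewrite t3.
have : #|t :\ u| == 2 by move: t3; rewrite (cardsD1 u) ut add1n => -[->].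
case/cards2P=> v [w [vw def_t]].
have [vt wt] : v \in t :\ u /\ w \in t :\ u by rewrite def_t !inE !eqxx orbT.
move: vt wt; rewrite !inE => /andP[vu vt] /andP[wu wt].
exists u, v, w; split; first by rewrite -setUA -def_t setD1K.
by rewrite eq_sym in vu; rewrite eq_sym in wu;
  split; apply: tE; rewrite subUset !sub1set cards2 ?ut ?vt ?wt ?vw ?vu ?wu.
Qed.

Lemma cards3_le (T : finType) (x y z : T) : #|[set x; y; z]| <= 3.
Proof. by rewrite setUC cardsU1 cards2; do 2 case: (~~ _). Qed.

(** The rank is the position in the saturating sequence and [tr e] the triangle that creates [e]. In
    this form the sequence supports induction on the rank as well as counting triangles. *)
Lemma saturated_rank F G :
    weakly_saturated K3 F G ->
  exists (rk : {set V} -> nat) (tr : {set V} -> {set V}),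
  forall e : {set V}, e \in edges F :\: edges G ->
    [/\ tr e \in triangles F, e \subset tr e
      & forall e' : {set V}, e' \subset tr e -> #|e'| = 2 -> e' != e ->
          e' \in edges G \/ e' \in edges F :\: edges G /\ rk e' < rk e].
Proof.
case/andP=> GF /existsP[s /andP[s_perm /forallP sE]].
have mem_s e : (e \in s) = (e \in edges F :\: edges G) by rewrite (perm_mem s_perm) mem_enum.
have uniq_s : uniq s by rewrite (perm_uniq s_perm) enum_uniq.
pose rk e := index e s.
have trP (e : {set V}) : e \in edges F :\: edges G -> exists t : {set V}, [/\ t \in triangles F, e \subset t
      & forall e' : {set V}, e' \subset t -> #|e'| = 2 -> e' != e ->
          e' \in edges G \/ e' \in edges F :\: edges G /\ rk e' < rk e].
  rewrite -mem_s => es; have lt_e : rk e < #|edges F :\: edges G|.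
    by rewrite -[X in _ < X](size_tuple s) index_mem.
  have := sE (Ordinal lt_e); rewrite (tnth_nth set0) /= nth_index //.
  case/copy_throughK3=> a [b [c [[ab ac bc] [def_e abE acE bcE]]]].
  have inP d : d \in edges G :|: [set:: take (rk e).+1 s] -> d != e ->
      d \in edges G \/ d \in edges F :\: edges G /\ rk d < rk e.
    rewrite inE => /orP[->|]; [by left|rewrite inE => ds de; right].
    have ds' := mem_take ds; rewrite -mem_s; split=> //.
    have : rk d < (rk e).+1 by apply: index_ltn.
    rewrite ltnS leq_eqVlt => /orP[/eqP eq_rk|//].
    by case/eqP: de; rewrite -(nth_index set0 ds') -(nth_index set0 es) -/(rk d) eq_rk.
  have inF d : d \in edges G :|: [set:: take (rk e).+1 s] -> d \in edges F.
    rewrite inE => /orP[/(subsetP GF)//|]; rewrite inE => /mem_take.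
    by rewrite mem_s inE => /andP[].
  exists [set a; b; c]; split.
  - by rewrite mem_triangles // /adj !inF.
  - by rewrite def_e subsetUl.
  move=> e' e'_sub /eqP/cards2P[x [y [xy def_e']]] ne.
  apply: inP => //; move: e'_sub.
  rewrite def_e' subUset !sub1set => /andP[xin yin].
  rewrite !inE -!orbA in xin yin.
  by case/or3P: xin => /eqP ?; case/or3P: yin => /eqP ?; subst x y;
    try (by rewrite eqxx in xy); rewrite // [[set _; _]]setUC.
have /fin_all_exists[tr trE] : forall e : {set V}, exists t : {set V},
    e \in edges F :\: edges G -> [/\ t \in triangles F, e \subset t
      & forall e' : {set V}, e' \subset t -> #|e'| = 2 -> e' != e ->
          e' \in edges G \/ e' \in edges F :\: edges G /\ rk e' < rk e].
  move=> e; have [/trP[t tP]|_] := boolP (e \in edges F :\: edges G); first by exists t.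
  by exists set0.
by exists rk, tr.
Qed.

Lemma saturated_active F G u v :
  weakly_saturated K3 F G -> adj F u v -> active F G u v.
Proof.
move=> satG; have [rk [tr trP]] := saturated_rank satG.
move: {2}(rk [set u; v]).+1 (ltnSn (rk [set u; v])) => n.
elim: n u v => // n IHn u v le_n Fuv.
have [Guv|NGuv] := boolP ([set u; v] \in edges G); first exact: ActiveEdge.
have euv : [set u; v] \in edges F :\: edges G by rewrite inE NGuv.
have [tF uv_sub lt_rk] := trP _ euv.
have uv := adj_neq Fuv.
have [w [w_t wu wv]] : exists w, [/\ w \in tr [set u; v], w != u & w != v].
  have : 0 < #|tr [set u; v] :\: [set u; v]|.
    move: tF; rewrite inE => /andP[/eqP t3 _].
    by rewrite cardsD (setIidPr uv_sub) t3 cards2 uv.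
  by case/card_gt0P=> w; rewrite !inE negb_or => /andP[/andP[wu wv] wt]; exists w.
have act x : x \in [set u; v] -> active F G x w.
  move=> xuv; have xw : x != w by move: xuv; rewrite !inE => /pred2P[]->; rewrite eq_sym.
  have xw_sub : [set x; w] \subset tr [set u; v].
    by rewrite subUset !sub1set (subsetP uv_sub) ?w_t.
  case: (lt_rk _ xw_sub); rewrite ?cards2 ?xw //.
  - apply: contraNneq wu => eq_e; have : w \in [set u; v] by rewrite -eq_e !inE eqxx orbT.
    by rewrite !inE (negPf wv) orbF.
  - exact: ActiveEdge.
  case=> xwF lt_xw; apply: IHn; first exact: leq_trans lt_xw _.
  by case/setDP: xwF.
apply: (ActiveTriangle (w := w)) => //; first by apply: act; rewrite !inE eqxx.
by apply/active_sym/act; rewrite !inE eqxx orbT.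
Qed.

Definition closed_triangles (S : {set {set V}}) :=
  forall t e : {set V}, t \in S -> e \subset t -> #|e| = 2 ->
  exists2 t', t' \in S & (t' != t) && (e \subset t').

(** For a triangle abc, the absence of [c] guarantees that the member of [S] found on the edge ab is
    a different triangle. *)
Definition cofacet (S : {set {set V}}) a b c :=
  exists2 t, t \in S & [&& a \in t, b \in t & c \notin t].

Lemma closed_trianglesI (S : {set {set V}}) :
    (forall t, t \in S -> exists a b c, t = [set a; b; c] /\
       [/\ cofacet S a b c, cofacet S a c b & cofacet S b c a]) ->
  closed_triangles S.
Proof.
move=> SP t e /SP[a [b [c [-> [ab ac bc]]]]] e_sub /eqP/cards2P[x [y [xy def_e]]].
have cof x' y' z : e = [set x'; y'] \/ e = [set y'; x'] -> z \in [set a; b; c] ->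
    cofacet S x' y' z -> exists2 t', t' \in S & (t' != [set a; b; c]) && (e \subset t').
  move=> def_e' zt [t' t'S /and3P[xt' yt' zt']]; exists t' => //.
  rewrite (contraNneq _ zt') => [|->//].
  by case: def_e' => ->; rewrite subUset !sub1set xt' yt'.
move: (e_sub); rewrite def_e subUset !sub1set -def_e => /andP[xin yin].
rewrite !inE -!orbA in xin yin.
case/or3P: xin => /eqP ?; case/or3P: yin => /eqP ?; subst x y; try by rewrite eqxx in xy.
- by apply: (cof a b c); [left | rewrite !inE eqxx !orbT |].
- by apply: (cof a c b); [left | rewrite !inE eqxx !orbT |].
- by apply: (cof a b c); [right | rewrite !inE eqxx !orbT |].
- by apply: (cof b c a); [left | rewrite !inE eqxx |].
- by apply: (cof a c b); [right | rewrite !inE eqxx !orbT |].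
- by apply: (cof b c a); [right | rewrite !inE eqxx |].
Qed.

(** [U] collects the creating triangles. They are pairwise distinct: a triangle that created two
    edges would make each of them older than the other, and this gives the exact count. *)
Lemma saturated_used F G :
    weakly_saturated K3 F G ->
  exists U : {set {set V}}, [/\ U \subset triangles F, #|U| + #|edges G| = #|edges F|
    & forall S : {set {set V}}, S \subset U -> closed_triangles S -> S = set0].
Proof.
move=> satG; have [rk [tr trP]] := saturated_rank satG.
have GF : edges G \subset edges F by case/andP: satG.
have c2 e : e \in edges F :\: edges G -> #|e| = 2 by case/setDP=> /card_edge.
exists (tr @: (edges F :\: edges G)); split.
- by apply/subsetP=> _ /imsetP[e /trP[tF _ _] ->].
- rewrite card_in_imset ?cardsD ?(setIidPr GF) ?subnK ?subset_leq_card //.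
  move=> e e' eD e'D eq_tr; apply/eqP; apply: contraT => ne.
  have [_ e_sub lt_e] := trP _ eD; have [_ e'_sub lt_e'] := trP _ e'D.
  have := lt_e e'; rewrite eq_tr eq_sym ne c2 // => /(_ e'_sub erefl isT).
  have := lt_e' e; rewrite -eq_tr ne c2 // => /(_ e_sub erefl isT).
  have /setDP[_ /negPf->] := eD; have /setDP[_ /negPf->] := e'D.
  by case=> // -[_ lt1] [] // -[_] /(ltn_trans lt1); rewrite ltnn.
move=> S SU closedS; apply/eqP; rewrite -subset0; apply/subsetP=> t tS; exfalso.
have [e0 e0D tE] := imsetP (subsetP SU _ tS).
have e0P : (e0 \in edges F :\: edges G) && (tr e0 \in S) by rewrite e0D -tE.
pose e := [arg max_(e > e0 | (e \in edges F :\: edges G) && (tr e \in S)) rk e].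
have [eD eS max_e] : [/\ e \in edges F :\: edges G, tr e \in S &
    forall d, d \in edges F :\: edges G -> tr d \in S -> rk d <= rk e].
  rewrite /e; case: arg_maxnP => // d /andP[dD dS] dmax.
  by split=> // d' d'D d'S; apply: dmax; rewrite d'D.
have [_ e_sub _] := trP _ eD.
have [t' t'S /andP[ne e_sub']] := closedS _ _ eS e_sub (c2 _ eD).
have [d dD t'E] := imsetP (subsetP SU _ t'S); rewrite t'E in t'S ne e_sub'.
have ed : e != d by apply: contraNneq ne => ->.
have [_ _ /(_ _ e_sub' (c2 _ eD) ed)] := trP _ dD.
have /setDP[_ /negPf->] := eD; case=> // -[_]; rewrite ltnNge => /negP[].
exact: max_e.
Qed.

(** A set [S] grows from [o] along [E]. Each new vertex brings an edge of [A] that was not inside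
    [S] before, which keeps [#|S|] at most one more than the number of edges inside. *)
Lemma connected_edges (E : rel V) (A : {set {set V}}) o :
    (forall u v, E u v -> [set u; v] \in A) ->
    (forall v, connect E o v) ->
  #|V| <= #|A|.+1.
Proof.
move=> EA conn.
have [S] : exists2 S : {set V}, o \in S & #|S| <= #|[set e in A | e \subset S]|.+1.
  by exists [set o]; rewrite ?set11 // cards1.
move: {2}#|~: S| (erefl #|~: S|) => n.
elim: n S => [|n IHn] S cS oS leS.
  have -> : #|V| = #|S| by rewrite -(cardsC S) cS addn0.
  apply: leq_trans leS _; rewrite ltnS.
  by apply: subset_leq_card; apply/subsetP=> e; rewrite inE => /andP[].
have [v vS] : exists v, v \notin S.
  have : 0 < #|~: S| by rewrite cS.
  by case/card_gt0P=> v; rewrite inE; exists v.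
have [x [y [xS yS xy]]] : exists x y, [/\ x \in S, y \notin S & E x y].
  have /connectP[p] := conn v.
  have key q : forall x, x \in S -> path E x q -> v = last x q ->
      exists x y, [/\ x \in S, y \notin S & E x y].
    elim: q => [|z q IHq] x xS /= => [_ eq_v|/andP[xz zq] eq_v].
      by rewrite eq_v xS in vS.
    by have [zS|zS] := boolP (z \in S); [exact: IHq eq_v | exists x, z].
  exact: key.
apply: (IHn (y |: S)).
- move: cS; rewrite (cardsD1 y) inE yS add1n => -[<-].
  by rewrite setCU setDE setIC.
- by rewrite inE oS orbT.
rewrite cardsU1 yS add1n ltnS; apply: (leq_trans leS).
apply: proper_card; apply/properP; split.
  apply/subsetP=> e; rewrite !inE => /andP[-> e_sub] /=.
  exact: subset_trans e_sub (subsetUr _ _).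
exists [set x; y]; rewrite inE EA //= subUset !sub1set ?(negPf yS) ?andbF //.
by rewrite !inE xS eqxx orbT.
Qed.

Lemma wsatP F k :
  reflect ((exists2 G : graph V, weakly_saturated K3 F G & #|edges G| = k) /\
           forall G : graph V, weakly_saturated K3 F G -> k <= #|edges G|)
          (wsat F K3 == k).
Proof.
rewrite /wsat; case: arg_minnP => [|G satG minG]; first exact: weakly_saturated_refl.
apply: (iffP eqP) => [<-|[[G' satG' <-] minG']]; first by split=> //; exists G.
by apply/eqP; rewrite eqn_leq minG // minG'.
Qed.

Lemma active_connect F G u v : active F G u v -> connect (adj G) u v.
Proof.
elim=> {u v} [u v|u v w _ _ uw _]; first exact: connect1.
exact: connect_trans.
Qed.

(** Completing a triangle only joins vertices that already have a common neighbour, so [G] is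
    connected as soon as [F] is. *)
Lemma saturated_edges F G o :
    (forall v, connect (adj F) o v) -> weakly_saturated K3 F G ->
  #|V| <= #|edges G|.+1.
Proof.
move=> connF satG; apply: (@connected_edges (adj G) _ o) => // v.
apply: connect_sub (connF v) => x y Fxy.
exact: active_connect (saturated_active satG Fxy).
Qed.

(* A parent function [par] has at most [#|V| - 1] edges, so no acyclicity is
   needed to bound the number of edges of [G]. *)
Lemma wsat_parent F G o (par : V -> V) :
    (forall v, connect (adj F) o v) -> edges G \subset edges F ->
    edges G \subset [set [set v; par v] | v in [set~ o]] ->
    (forall u v, adj F u v -> active F G u v) ->
  (wsat F K3).+1 = #|V|.
Proof.
move=> connF GF Gpar act; have satG := active_saturated GF act.
have leG : #|edges G|.+1 <= #|V|.
  have V0 : 0 < #|V| by apply/card_gt0P; exists o.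
  rewrite -(prednK V0) ltnS (leq_trans (subset_leq_card Gpar)) //.
  by rewrite (leq_trans (leq_imset_card _ _)) // cardsC1.
have eqG : #|edges G|.+1 = #|V|.
  by apply/eqP; rewrite eqn_leq leG (saturated_edges connF satG).
rewrite -eqG; congr _.+1; apply/eqP/wsatP; split; first by exists G.
by move=> G' satG'; rewrite -ltnS eqG (saturated_edges connF satG').
Qed.

Lemma wsat_used F :
    (wsat F K3).+1 = #|V| ->
  exists U : {set {set V}}, [/\ U \subset triangles F, #|U| + #|V| = #|edges F|.+1
    & forall S : {set {set V}}, S \subset U -> closed_triangles S -> S = set0].
Proof.
move=> wF; have /eqP/wsatP[[G satG cG] _] : wsat F K3 = wsat F K3 by [].
have [U [UF cU closedU]] := saturated_used satG.
by exists U; split=> //; rewrite -wF -cU cG addnS.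
Qed.

End WeakTriangleSaturation.

(** * Invariance under relabelling of the vertices *)

Section Relabel.

Variables (V V' : finType) (f : V -> V') (g : V' -> V).
Hypotheses (fK : cancel f g) (gK : cancel g f).

Lemma relabel_edgesP (G : graph V) :
  [forall e in [set f @: (e : {set V}) | e in edges G], #|e| == 2].
Proof.
apply/forall_inP=> _ /imsetP[e eG ->].
by rewrite (card_imset _ (can_inj fK)) (card_edge eG).
Qed.

Definition relabel G : graph V' := Graph (relabel_edgesP G).

Lemma adj_relabel G u v : adj (relabel G) (f u) (f v) = adj G u v.
Proof.
have def_uv : [set f u; f v] = f @: [set u; v] by rewrite imsetU1 imset_set1.
by rewrite /adj def_uv /= mem_imset //; apply/imset_inj/(can_inj fK).
Qed.

Lemma wsat_relabel_le (F : graph V) (F' : graph V') :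
  (forall u v, adj F' (f u) (f v) = adj F u v) -> wsat F' K3 <= wsat F K3.
Proof.
move=> adjF; have /eqP/wsatP[[G satG <-] _] : wsat F K3 = wsat F K3 by [].
have /eqP/wsatP[_ minF'] : wsat F' K3 = wsat F' K3 by [].
rewrite -(card_imset (edges G) (imset_inj (can_inj fK))).
apply: (minF' (relabel G)); have GF : edges G \subset edges F by case/andP: satG.
have act u v : active F G u v -> active F' (relabel G) (f u) (f v).
  elim=> {u v} [u v Guv|u v w Fuv _ uw _ wv].
    by apply: ActiveEdge; rewrite adj_relabel.
  by apply: (ActiveTriangle (w := f w)); rewrite ?adjF.
apply: active_saturated => [|u v].
  apply/subsetP=> _ /imsetP[e eG ->]; have /eqP/cards2P[x [y [_ def_e]]] := card_edge eG.
  rewrite def_e imsetU1 imset_set1 -/(adj F' _ _) adjF /adj -def_e.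
  exact: (subsetP GF).
rewrite -[u]gK -[v]gK adjF => Fuv.
exact/act/saturated_active.
Qed.

End Relabel.

Lemma wsat_relabel (V V' : finType) (f : V -> V') (g : V' -> V)
    (F : graph V) (F' : graph V') :
    cancel f g -> cancel g f ->
    (forall u v, adj F' (f u) (f v) = adj F u v) ->
  wsat F' K3 = wsat F K3.
Proof.
move=> fK gK adjF; apply/eqP; rewrite eqn_leq (wsat_relabel_le fK gK adjF) /=.
by apply: (wsat_relabel_le gK fK) => u v; rewrite -adjF !gK.
Qed.

(** * Graphs presented by an orientation, and the gate *)

Section OrientedGraph.

Variables (V : finType) (d : rel V).
Hypothesis d_asym : forall u v, d u v -> ~~ d v u.

Lemma oriented_neq u v : d u v -> u != v.
Proof.
by apply: contraTneq => ->; apply/negP=> vv; have := d_asym vv; rewrite vv.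
Qed.

Lemma oriented_edgesP :
  [forall e in [set [set p.1; p.2] | p : V * V in [pred p | d p.1 p.2]], #|e| == 2].
Proof.
by apply/forall_inP=> _ /imsetP[p /oriented_neq p12 ->]; rewrite cards2 p12.
Qed.

(** An asymmetric relation contains each edge in one direction only, so edges can be counted as
    related pairs. *)
Definition oriented_graph : graph V := Graph oriented_edgesP.

Lemma set2_eq (u v x y : V) :
  [set u; v] = [set x; y] -> (u, v) = (x, y) \/ (u, v) = (y, x).
Proof.
move=> eq_uv; have [uxy vxy] : u \in [set x; y] /\ v \in [set x; y].
  by rewrite -eq_uv !inE !eqxx orbT.
have [xuv yuv] : x \in [set u; v] /\ y \in [set u; v].
  by rewrite eq_uv !inE !eqxx orbT.
move: uxy vxy xuv yuv; rewrite !inE.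
case/pred2P=> ->; case/pred2P=> ->; [|by left|by right|].
  by rewrite !orbb => _ /eqP->; left.
by rewrite !orbb => /eqP-> _; left.
Qed.

Lemma adj_oriented u v : adj oriented_graph u v = d u v || d v u.
Proof.
apply/imsetP/orP => [[[x y] /= dxy /set2_eq[] [-> ->]]|]; [by left|by right|].
by case=> duv; [exists (u, v) | exists (v, u)]; rewrite //= setUC.
Qed.

Lemma card_oriented : #|edges oriented_graph| = #|[pred p : V * V | d p.1 p.2]|.
Proof.
apply: card_in_imset => -[u v] [x y] /= duv dxy /set2_eq[] // [? ?]; subst.
by have /negP[] := d_asym duv.
Qed.

End OrientedGraph.

(* The gate: a graph on thirteen vertices glued to a path 0 - 1 - 2 of the rest
   of the graph. Its clique complex consists of four discs, with apices
   9, ..., 12, whose boundaries are 6-cycles 0 - * - 2 - * - 4 - * - 0; every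
   edge but 01 and 12 is in two triangles, and the complex collapses as soon as
   one of these two edges becomes free. *)
Definition gate_arcs : seq (nat * nat) :=
  [:: (3, 0); (3, 2); (5, 2); (6, 2); (5, 4); (6, 4); (7, 4); (8, 4); (7, 0); (8, 0);
      (9, 0); (9, 1); (9, 2); (9, 5); (9, 4); (9, 7);
      (10, 0); (10, 3); (10, 2); (10, 5); (10, 4); (10, 8);
      (11, 0); (11, 3); (11, 2); (11, 6); (11, 4); (11, 7);
      (12, 0); (12, 3); (12, 2); (12, 6); (12, 4); (12, 8)].

Definition gate_edges := (0, 1) :: (1, 2) :: gate_arcs.

Definition gate_adj a b := ((a, b) \in gate_edges) || ((b, a) \in gate_edges).

(** The entries increase, so the last one is the apex of the disc. There are 24 triangles, against
    34 arcs and the 10 vertices 3, ..., 12. *)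
Definition gate_triangles : seq (nat * nat * nat) :=
  [:: (0, 1, 9); (0, 3, 10); (0, 3, 11); (0, 3, 12); (0, 7, 9); (0, 7, 11);
      (0, 8, 10); (0, 8, 12); (1, 2, 9); (2, 3, 10); (2, 3, 11); (2, 3, 12);
      (2, 5, 9); (2, 5, 10); (2, 6, 11); (2, 6, 12); (4, 5, 9); (4, 5, 10);
      (4, 6, 11); (4, 6, 12); (4, 7, 9); (4, 7, 11); (4, 8, 10); (4, 8, 12)].

Definition in_triple (a : nat) (t : nat * nat * nat) := a \in [:: t.1.1; t.1.2; t.2].

Lemma gate_adj_triangle a b c : a < 13 -> b < 13 -> c < 13 ->
    gate_adj a b -> gate_adj a c -> gate_adj b c ->
  exists2 t, t \in gate_triangles & [&& in_triple a t, in_triple b t & in_triple c t].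
Proof.
move=> a13 b13 c13 ab ac bc; apply/hasP; move: a b c a13 b13 c13 ab ac bc.
suff /allP allG : all (fun a => all (fun b => all (fun c =>
    [==> gate_adj a b, gate_adj a c, gate_adj b c =>
      has (fun t => [&& in_triple a t, in_triple b t & in_triple c t]) gate_triangles])
    (iota 0 13)) (iota 0 13)) (iota 0 13).
  move=> a b c a13 b13 c13 ab ac bc.
  have in13 n : n < 13 -> n \in iota 0 13 by rewrite mem_iota.
  have /allP allGa := allG a (in13 a a13).
  have /allP allGb := allGa b (in13 b b13).
  by have := allGb c (in13 c c13); rewrite ab ac bc.
by vm_compute.
Qed.

Definition gate_cofacet a b c :=
  has (fun t => [&& in_triple a t, in_triple b t & ~~ in_triple c t]) gate_triangles.

(** The two exceptions are the triangles at the entrances 01 and 12. In the increasing order these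
    edges are formed by the first two entries, so only the last [gate_cofacet] can fail. *)
Lemma gate_closed t : t \in gate_triangles ->
  [/\ [&& t.1.1 < t.1.2, t.1.2 < t.2 & t.2 < 13],
      gate_cofacet t.1.2 t.2 t.1.1, gate_cofacet t.1.1 t.2 t.1.2
    & t = (0, 1, 9) \/ t = (1, 2, 9) \/ gate_cofacet t.1.1 t.1.2 t.2].
Proof.
suff /allP allG : all (fun t => [&& [&& t.1.1 < t.1.2, t.1.2 < t.2 & t.2 < 13],
      gate_cofacet t.1.2 t.2 t.1.1, gate_cofacet t.1.1 t.2 t.1.2
    & [|| t == (0, 1, 9), t == (1, 2, 9) | gate_cofacet t.1.1 t.1.2 t.2]]) gate_triangles.
  move/allG=> /and4P[-> -> -> /or3P tP]; split=> //.
  by case: tP => [/eqP->|/eqP->|->]; [left|right; left|right; right].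
by vm_compute.
Qed.

Definition has_edge (s : seq (nat * nat)) a b := ((a, b) \in s) || ((b, a) \in s).

Definition gate_grow (s : seq (nat * nat)) :=
  [seq e <- gate_edges |
    has_edge s e.1 e.2 || has (fun c => has_edge s e.1 c && has_edge s c e.2) (iota 0 13)].

Definition covers_gate s := all (fun e => has_edge s e.1 e.2) gate_edges.

(** Twenty parallel rounds are enough for the two trees below, as the computations confirm. *)
Definition gate_percolates s := covers_gate (iter 20 gate_grow s).

Lemma gate_percolatesP s e : gate_percolates s -> e \in gate_edges ->
  has_edge (iter 20 gate_grow s) e.1 e.2.
Proof. by rewrite /gate_percolates; move: (iter _ _ _) => s' /allP gs /gs. Qed.

(* [(a, b)] means that [b] is the parent of [a]. The first tree is used when
   the gate collapses through the edge 01, the second one when it collapses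
   through the edge 12. *)
Definition gate_tree01 : seq (nat * nat) :=
  [:: (0, 12); (3, 0); (4, 9); (5, 9); (6, 2); (7, 0); (8, 0); (10, 8); (11, 2); (12, 2)].

Definition gate_tree12 : seq (nat * nat) :=
  [:: (2, 12); (3, 11); (4, 9); (5, 10); (6, 4); (7, 4); (8, 4); (10, 0); (11, 4); (12, 4)].

(** The edge 12 is an edge of the rest that is active beforehand; the edge from [x] to 9 is the
    entrance 01 of the next gate, whose first vertex is the vertex 1 or 2 of this one. The entrance
    01 is among the edges produced. *)
Lemma gate_tree01_percolates x : x \in [:: 1; 2] ->
  gate_percolates [:: (1, 2), (x, 9) & gate_tree01].
Proof. by rewrite !inE => /pred2P[] ->; vm_compute. Qed.

(** The gate at the selected literal: the entrance 01 is now given and the edge 12 is produced. The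
    next gate shares the vertex 1. *)
Lemma gate_tree12_percolates : gate_percolates [:: (0, 1), (1, 9) & gate_tree12].
Proof. by vm_compute. Qed.

Inductive vert (X J Z : Type) (M : nat) : Type :=
| VO | VB of X | VX of X & 'I_M | VP of J & 'I_25 & 'I_10 | VZ of Z.

Arguments VO {X J Z M}.
Arguments VB {X J Z M}.
Arguments VX {X J Z M}.
Arguments VP {X J Z M}.
Arguments VZ {X J Z M}.

Section VertFinType.

Variables (X J Z : Type) (M : nat).

Definition vert_sum (u : vert X J Z M) : unit + X + X * 'I_M + J * 'I_25 * 'I_10 + Z :=
  match u with
  | VO => inl (inl (inl (inl tt)))
  | VB v => inl (inl (inl (inr v)))
  | VX v i => inl (inl (inr (v, i)))
  | VP j c a => inl (inr (j, c, a))
  | VZ z => inr z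
  end.

Definition sum_vert (s : unit + X + X * 'I_M + J * 'I_25 * 'I_10 + Z) : vert X J Z M :=
  match s with
  | inl (inl (inl (inl _))) => VO
  | inl (inl (inl (inr v))) => VB v
  | inl (inl (inr (v, i))) => VX v i
  | inl (inr (j, c, a)) => VP j c a
  | inr z => VZ z
  end.

Lemma vert_sumK : cancel vert_sum sum_vert.
Proof. by case. Qed.

Lemma sum_vertK : cancel sum_vert vert_sum.
Proof. by case=> [[[[[]|]|[]]|[[]]]|]. Qed.

End VertFinType.

HB.instance Definition _ (X J Z : finType) (M : nat) :=
  Finite.copy (vert X J Z M) (can_type (@vert_sumK X J Z M)).

Lemma card_vert (X J Z : finType) M :
  #|{: vert X J Z M}| = (1 + #|X| + #|X| * M + #|J| * 25 * 10 + #|Z|)%N.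
Proof.
rewrite (bij_eq_card (Bijective (@vert_sumK X J Z M) (@sum_vertK X J Z M))).
by rewrite !card_sum !card_prod !card_ord card_unit.
Qed.

Section SatGraph.

Variables (X J Z : finType) (h : nat).
Hypothesis h_gt1 : 1 < h.
Variables (var : J -> 'I_5 -> X) (pos : J -> 'I_5 -> 'I_h.*2).

Local Notation V := (vert X J Z h.*2).

Lemma lt0M : 0 < h.*2. Proof. lia. Qed.
Lemma lthM : h < h.*2. Proof. lia. Qed.

Definition x0 : 'I_h.*2 := Ordinal lt0M.
Definition xh : 'I_h.*2 := Ordinal lthM.

Lemma slot_proof (c : 'I_25) : c %/ 5 < 5.
Proof. by case: c => c /= ltc; lia. Qed.

Definition slot c : 'I_5 := Ordinal (slot_proof c).

(* The gates of a clause are glued along a closed walk, five edges per literal: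
   an inner edge of the hemisphere that makes the literal true, then the common
   boundary of the two hemispheres. *)
Definition fstv (j : J) (c : 'I_25) : V :=
  match c %% 5 with
  | 0 | 1 => VO
  | 2 => VX (var j (slot c)) x0
  | 3 => VB (var j (slot c))
  | _ => VX (var j (slot c)) xh
  end.

Definition sndv (j : J) (c : 'I_25) : V :=
  match c %% 5 with
  | 0 => VX (var j (slot c)) (pos j (slot c))
  | 1 => VX (var j (slot c)) x0
  | 2 => VB (var j (slot c))
  | 3 => VX (var j (slot c)) xh
  | _ => VO
  end.

(* Every variable [w] gives a 2-sphere, the suspension of the cycle [VX w _] with
   apices [VO] and [VB w]. In local numbering, the vertices 0, 1, 2 of gate [c]
   of clause [j] are vertex 9 of gate [ord_pred c], [fstv j c] and [sndv j c],
   and its vertices 3, ..., 12 are the [VP j c _]. *)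
Definition arc (u v : V) : bool :=
  match u, v with
  | VO, VX _ _ => true
  | VO, VZ _ => true
  | VB w, VX w' _ => w == w'
  | VX w i, VX w' i' => (w == w') && (i' == ordS i)
  | VP j c a, VP j' c' a' => (j == j') &&
      ((c == c') && ((a + 3, a' + 3) \in gate_arcs) ||
       [&& c' == ord_pred c, a' == 6 :> nat & (a + 3, 0) \in gate_arcs])
  | VP j c a, _ => (v == fstv j c) && ((a + 3, 1) \in gate_arcs) ||
                   (v == sndv j c) && ((a + 3, 2) \in gate_arcs)
  | _, _ => false
  end.

Lemma ordS_neq (c : 'I_25) : [/\ ordS c != c, ordS (ordS c) != c & ordS (ordS (ordS c)) != c].
Proof. by rewrite -!val_eqE /=; case: c => c /= ltc; split; lia. Qed.

Lemma ord_pred_neq (c : 'I_25) : ord_pred c != c.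
Proof. by rewrite -(can_eq (@ordSK _)) eq_sym; have [] := ordS_neq c; rewrite ord_predK. Qed.

Lemma ord_predS_neq (c : 'I_25) : ord_pred c != ordS c.
Proof.
rewrite -(can_eq (@ordSK _)) ord_predK eq_sym.
by have [] := ordS_neq c.
Qed.

Lemma gate_arcs_adj a b : (a, b) \in gate_arcs -> gate_adj a b.
Proof.
by move=> ab; rewrite /gate_adj (@mem_behead _ gate_edges) ?(@mem_behead _ (behead gate_edges)).
Qed.

Lemma gate_arcs_lt a b : (a, b) \in gate_arcs -> b < a.
Proof.
suff /allP allG : all (fun e => e.2 < e.1) gate_arcs by move/allG.
by vm_compute.
Qed.

Lemma val_ordS (i : 'I_h.*2) : ordS i = (if i.+1 == h.*2 then 0 else i.+1) :> nat.
Proof.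
rewrite /=; case: eqP => [->|]; first by rewrite modnn.
by have := ltn_ord i => *; rewrite modn_small //; lia.
Qed.

Lemma arc_asym u v : arc u v -> ~~ arc v u.
Proof.
case: u => [|w|w i|j c a|z]; case: v => [|w'|w' i'|j' c' a'|z'] //=.
  case/andP=> _ /eqP->; apply/negP=> /andP[_ /eqP/(congr1 (@nat_of_ord _))].
  by rewrite !val_ordS; have := ltn_ord i; do 2 case: eqP => //; lia.
case/andP=> /eqP<-; rewrite eqxx /= => ucv; apply/negP.
case/orP: ucv => [/andP[/eqP<- /gate_arcs_lt lt_a]|/and3P[/eqP-> /eqP a6 _]].
  case/orP=> [/andP[_ /gate_arcs_lt]|/and3P[/eqP eqc]]; first by lia.
  by have := ord_pred_neq c; rewrite -eqc eqxx.
case/orP=> [/andP[/eqP eqc]|/and3P[/eqP eqc]].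
  by have := ord_pred_neq c; rewrite eqc eqxx.
by have := ord_predS_neq (ord_pred c); rewrite ord_predK -eqc eqxx.
Qed.

Definition sat_graph : graph V := oriented_graph arc_asym.

Lemma adj_sat u v : adj sat_graph u v = arc u v || arc v u.
Proof. exact: adj_oriented. Qed.

(** A private vertex has its index plus 3 as local number, so the index 6 stands for the apex 9. *)
Definition gv (j : J) (c : 'I_25) (n : nat) : V :=
  match n with
  | 0 => VP j (ord_pred c) (inord 6)
  | 1 => fstv j c
  | 2 => sndv j c
  | n'.+3 => VP j c (inord n')
  end.

(** The edge of a literal must lie in the interior of a hemisphere: on the common boundary it would
    not tell the two truth values apart. *)
Hypothesis pos_neq : forall j k, pos j k != x0 /\ pos j k != xh.

Lemma ord_pred_slot (c : 'I_25) :
  [/\ c %% 5 = 0 & ord_pred c %% 5 = 4] \/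
  [/\ c %% 5 = (ord_pred c %% 5).+1 & slot (ord_pred c) = slot c].
Proof.
have [c5|c5] := eqVneq (c %% 5) 0; [left|right]; split=> //=; try apply: val_inj => /=.
all: case: c c5 => c /= ltc c5; lia.
Qed.

Definition base_vert (u : V) := if u is VP _ _ _ then false else true.

Lemma fstv_base j c : base_vert (fstv j c).
Proof. by rewrite /fstv; case: (c %% 5) => [|[|[|[|r]]]]. Qed.

Lemma sndv_base j c : base_vert (sndv j c).
Proof. by rewrite /sndv; case: (c %% 5) => [|[|[|[|r]]]]. Qed.

Lemma arc_private_base j c a u : base_vert u ->
  arc (VP j c a) u = (u == fstv j c) && ((a + 3, 1) \in gate_arcs) ||
                     (u == sndv j c) && ((a + 3, 2) \in gate_arcs).
Proof. by case: u. Qed.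

Lemma arc_base_private j c a u : base_vert u -> arc u (VP j c a) = false.
Proof. by case: u. Qed.

Lemma xh_neq0 : xh != x0.
Proof. by rewrite -val_eqE /=; lia. Qed.

Lemma adj_fst_snd j c : adj sat_graph (fstv j c) (sndv j c).
Proof.
rewrite adj_sat /fstv /sndv; have : c %% 5 < 5 by rewrite ltn_mod.
by case: (c %% 5) => [|[|[|[|[|r]]]]] //=; rewrite ?eqxx ?orbT.
Qed.

Lemma fst_neq_snd j c : fstv j c != sndv j c.
Proof. exact: adj_neq (adj_fst_snd j c). Qed.

(** This is how consecutive gates are glued: the entrance 01 of gate [c] is an edge at the apex 9 of
    the preceding gate and lies in the triangle 129 of that gate. *)
Lemma fst_pred j c : fstv j c = fstv j (ord_pred c) \/ fstv j c = sndv j (ord_pred c).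
Proof.
rewrite /fstv /sndv; have : c %% 5 < 5 by rewrite ltn_mod.
case: (ord_pred_slot c) => [[-> ->]|[-> ->]]; first by right.
by case: (ord_pred c %% 5) => [|[|[|[|r]]]] // _; [left|right|right|right].
Qed.

(** Keeps the local vertices 0 and 2 of a gate nonadjacent; an edge between them would create the
    unwanted triangle 012. *)
Lemma snd_pred j c : sndv j c != fstv j (ord_pred c) /\ sndv j c != sndv j (ord_pred c).
Proof.
have [p0 ph] := pos_neq j (slot c).
rewrite /fstv /sndv; have : c %% 5 < 5 by rewrite ltn_mod.
case: (ord_pred_slot c) => [[-> ->]|[-> ->]].
  by split=> //; apply: contraNneq ph => -[_ ->].
case: (ord_pred c %% 5) => [|[|[|[|r]]]] // _; split=> //.
- by apply: contraNneq p0 => -[<-].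
- by apply/eqP=> -[h0]; move: h_gt1; rewrite h0.
Qed.

Lemma gv_arc j c x y : (x, y) \in gate_arcs -> arc (gv j c x) (gv j c y).
Proof.
have : 3 <= x < 13 \/ (x, y) \notin gate_arcs.
  case: (boolP ((x, y) \in gate_arcs)) => [xy|]; [left|by right].
  suff /allP allG : all (fun e => 3 <= e.1 < 13) gate_arcs by move: (allG _ xy).
  by vm_compute.
case=> [lt_x|/negPf->//]; case: x lt_x => [|[|[|x]]] // ltx xy.
have x10 : x < 10 by lia.
have ltyx := gate_arcs_lt xy.
case: y xy ltyx => [|[|[|y]]] xy ltyx; rewrite [gv j c x.+3]/=.
- by rewrite /= !eqxx !inordK // !addn3 xy orbT.
- by rewrite arc_private_base ?fstv_base // eqxx inordK // addn3 xy.
- by rewrite arc_private_base ?sndv_base // eqxx inordK // addn3 xy orbT.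
have y10 : y < 10 by lia.
by rewrite /= !eqxx !inordK // !addn3 xy.
Qed.

Lemma gv_adj j c a b : a < 13 -> b < 13 -> gate_adj a b -> adj sat_graph (gv j c a) (gv j c b).
Proof.
have edgeP x y : (x, y) \in gate_edges -> adj sat_graph (gv j c x) (gv j c y).
  rewrite 2!in_cons => /or3P[/eqP[-> ->]|/eqP[-> ->]|xy]; last by rewrite adj_sat gv_arc.
    rewrite adj_sat; case: (fst_pred j c) => eq_f; rewrite [gv _ _ 1]/= eq_f [gv _ _ 0]/=.
      by rewrite arc_private_base ?fstv_base // eqxx inordK.
    by rewrite arc_private_base ?sndv_base // eqxx inordK //= orbT.
  exact: adj_fst_snd.
by move=> _ _ /orP[/edgeP//|/edgeP]; rewrite adjC.
Qed.

Lemma gv_inj j c a b : a < 13 -> b < 13 -> gv j c a = gv j c b -> a = b.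
Proof.
have fs := fst_neq_snd j c; have fB := fstv_base j c; have sB := sndv_base j c.
have pc := ord_pred_neq c.
have P0 x : x < 10 -> VP j (ord_pred c) (inord 6) <> VP j c (inord x) :> V.
  by move=> _ [eq_c _]; rewrite eq_c eqxx in pc.
have inj x y : x < 10 -> y < 10 -> inord x = inord y :> 'I_10 -> x = y.
  by move=> x10 y10 /(congr1 (@nat_of_ord _)); rewrite !inordK.
case: a => [|[|[|a]]]; case: b => [|[|[|b]]] //= a13 b13 eq_g.
all: try by move: fB; rewrite -eq_g.
all: try by move: fB; rewrite eq_g.
all: try by move: sB; rewrite -eq_g.
all: try by move: sB; rewrite eq_g.
all: try by rewrite eq_g eqxx in fs.
all: try by case: (P0 _ _ eq_g); lia.
all: try by case: (P0 _ _ (esym eq_g)); lia.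
by case: eq_g => /inj-> //; lia.
Qed.

Lemma adj_gv j c a b : a < 13 -> b < 13 -> adj sat_graph (gv j c a) (gv j c b) -> gate_adj a b.
Proof.
move=> a13 b13; wlog leab : a b a13 b13 / b <= a.
  move=> wl; case: (leqP b a) => [|/ltnW] le; first exact: wl.
  by rewrite adjC /gate_adj orbC; apply: wl.
have [->|] := eqVneq a b; first by move/adj_neq; rewrite eqxx.
have pc := ord_pred_neq c; have [Sc SSc _] := ordS_neq c.
have ppc : ord_pred (ord_pred c) != c.
  by apply/eqP=> eq_c; have := ord_predS_neq (ord_pred c); rewrite eq_c ord_predK eqxx.
rewrite adj_sat; case: a leab a13 => [|[|[|a]]]; case: b b13 => [|[|[|b]]] // b13 leab a13 _.
- rewrite [gv _ _ 2]/= [gv _ _ 0]/= arc_base_private ?sndv_base // arc_private_base ?sndv_base //.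
  by have [/negPf-> /negPf->] := snd_pred j c.
all: have a10 : a < 10 by lia.
- rewrite /= !eqxx inordK // (eq_sym c) (negPf pc) (eq_sym c) (negPf ppc) /= !orbF addn3.
  by case/andP=> _; apply: gate_arcs_adj.
- rewrite [gv _ _ 1]/= [gv _ _ a.+3]/= arc_base_private ?fstv_base // arc_private_base ?fstv_base //.
  rewrite eqxx (negPf (fst_neq_snd j c)) /= !orbF inordK // addn3.
  exact: gate_arcs_adj.
- rewrite [gv _ _ 2]/= [gv _ _ a.+3]/= arc_base_private ?sndv_base // arc_private_base ?sndv_base //.
  rewrite eqxx eq_sym (negPf (fst_neq_snd j c)) /= !orbF inordK // addn3.
  exact: gate_arcs_adj.
have b10 : b < 10 by lia.
rewrite /= !eqxx !inordK // (eq_sym c) (negPf pc) /= !orbF !addn3.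
by case/orP=> /gate_arcs_adj //; rewrite /gate_adj orbC.
Qed.

Lemma adj_private j c a u : adj sat_graph (VP j c a) u ->
  (exists2 b, b < 13 & u = gv j c b) \/
  (a = inord 6 /\ exists a', u = VP j (ordS c) a').
Proof.
rewrite adj_sat; case: (boolP (base_vert u)) => [uB|].
  rewrite arc_base_private // arc_private_base // orbF.
  by case/orP=> /andP[/eqP-> _]; left; [exists 1 | exists 2].
case: u => // j' c' a' _ /=; case/orP.
  case/andP=> /eqP<- /orP[/andP[/eqP<- _]|/and3P[/eqP-> /eqP a6 _]]; left.
    by exists a'.+3; [have := ltn_ord a'; lia | rewrite /= inord_val].
  by exists 0 => //=; congr VP; apply: val_inj; rewrite /= a6 inordK.
case/andP=> /eqP-> /orP[/andP[/eqP-> _]|/and3P[/eqP-> /eqP a6 _]].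
  by left; exists a'.+3; [have := ltn_ord a'; lia | rewrite /= inord_val].
right; split; first by apply: val_inj; rewrite /= a6 inordK.
by exists a'; rewrite ord_predK.
Qed.

Definition sphere_tri (v : X) (i : 'I_h.*2) (b : bool) : {set V} :=
  [set (if b then VO else VB v); VX v i; VX v (ordS i)].

Definition gate_tri (j : J) (c : 'I_25) (t : nat * nat * nat) : {set V} :=
  [set gv j c t.1.1; gv j c t.1.2; gv j c t.2].

Lemma gate_triangle j c x y z : x < 13 -> y < 13 -> z < 13 ->
    adj sat_graph (gv j c x) (gv j c y) -> adj sat_graph (gv j c x) (gv j c z) ->
    adj sat_graph (gv j c y) (gv j c z) ->
  exists2 t, t \in gate_triangles & [set gv j c x; gv j c y; gv j c z] = gate_tri j c t.
Proof.
move=> x13 y13 z13 xy xz yz.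
have [t tG /and3P[xt yt zt]] :=
  gate_adj_triangle x13 y13 z13 (adj_gv x13 y13 xy) (adj_gv x13 z13 xz) (adj_gv y13 z13 yz).
exists t => //; apply/eqP; rewrite eqEcard.
have mem_t n : in_triple n t -> gv j c n \in gate_tri j c t.
  by rewrite /in_triple !inE => /or3P[]/eqP->; rewrite eqxx ?orbT.
rewrite !subUset !sub1set !mem_t //= (leq_trans (cards3_le _ _ _)) //.
by rewrite setUC cardsU1 cards2 !inE negb_or ![gv j c z == _]eq_sym (adj_neq xz) (adj_neq yz) (adj_neq xy).
Qed.

(** A private vertex sees only its own gate, except that an apex 9 also sees the next gate, where it
    is the local vertex 0. If one neighbour is private to that next gate, the whole triangle lies
    there: a ring of 25 gates is too long for a triangle to reach a third one. *)
Lemma private_triangle j c a u w :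
    adj sat_graph (VP j c a) u -> adj sat_graph (VP j c a) w -> adj sat_graph u w ->
  exists c' t, t \in gate_triangles /\ [set VP j c a; u; w] = gate_tri j c' t.
Proof.
have self d b : VP j d b = gv j d b.+3 by rewrite /= inord_val.
have self13 (b : 'I_10) : b.+3 < 13 by have := ltn_ord b; lia.
have next u' w' : a = inord 6 -> (exists a', u' = VP j (ordS c) a') ->
    adj sat_graph (VP j c a) u' -> adj sat_graph (VP j c a) w' -> adj sat_graph u' w' ->
    exists2 t, t \in gate_triangles & [set VP j c a; u'; w'] = gate_tri j (ordS c) t.
  move=> def_a [a' ->] xu xw uw.
  have def_x : VP j c a = gv j (ordS c) 0 by rewrite /= ordSK def_a.
  case: (adj_private uw) => [[z z13 def_w]|[_ [a'' def_w]]].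
    by move: xu xw uw; rewrite def_w def_x self => *; apply: gate_triangle.
  move: xw; rewrite def_w adj_sat /= !eqxx /= => /orP[]/orP[]/andP[/eqP eq_c].
  - by have [_] := ordS_neq c; rewrite -eq_c eqxx.
  - by have [_ _] := ordS_neq c; rewrite eq_c ord_predK eqxx.
  - by have [_] := ordS_neq c; rewrite eq_c eqxx.
  - by move: eq_c; rewrite ordSK => eq_c; have [] := ordS_neq c; rewrite -eq_c eqxx.
move=> xu xw uw.
case: (adj_private xu) => [[y y13 def_u]|[def_a eu]]; last first.
  by have [t tG eq_t] := next u w def_a eu xu xw uw; exists (ordS c), t.
case: (adj_private xw) => [[z z13 def_w]|[def_a ew]]; last first.
  rewrite adjC in uw; have [t tG eq_t] := next w u def_a ew xw xu uw.
  by exists (ordS c), t; rewrite setUAC.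
move: xu xw uw; rewrite def_u def_w self => xu xw uw.
have [t tG eq_t] := gate_triangle (self13 a) y13 z13 xu xw uw.
by exists c, t.
Qed.

Lemma sat_triangles t : t \in triangles sat_graph ->
  (exists v i b, t = sphere_tri v i b) \/
  (exists j c t', t' \in gate_triangles /\ t = gate_tri j c t').
Proof.
case/trianglesP=> u [v [w [def_t [uv uw vw]]]].
have priv x y z : ~~ base_vert x -> t = [set x; y; z] -> adj sat_graph x y ->
    adj sat_graph x z -> adj sat_graph y z ->
    exists j c t', t' \in gate_triangles /\ t = gate_tri j c t'.
  case: x => // j c a _ -> xy xz yz; have [c' [t' [t'G ->]]] := private_triangle xy xz yz.
  by exists j, c', t'.
have [ub|nub] := boolP (base_vert u); last by right; apply: priv nub def_t uv uw vw.
have [vb|nvb] := boolP (base_vert v); last first.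
  by right; apply: (priv _ u w) nvb _ _ vw uw; rewrite 1?adjC // def_t; congr (_ :|: _); rewrite setUC.
have [wb|nwb] := boolP (base_vert w); last first.
  right; apply: (priv _ u v) nwb _ _ _ uv; rewrite 1?adjC // def_t.
  by rewrite setUC setUA.
left; have sph x y z v0 b i i' : t = [set x; y; z] ->
    (if b then VO else VB v0) = x -> y = VX v0 i -> z = VX v0 i' -> 
    adj sat_graph y z -> exists v i b, t = sphere_tri v i b.
  move=> -> <- -> ->; rewrite adj_sat /= eqxx /= => /orP[]/eqP->.
    by exists v0, i, b.
  by exists v0, i', b; rewrite setUAC.
have perm1 : [set u; v; w] = [set v; u; w] by rewrite (setUC [set u]).
have perm2 : [set u; v; w] = [set w; u; v] by rewrite setUC setUA.
have uv' := uv; have uw' := uw; have vw' := vw.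
rewrite !adj_sat in uv uw vw; rewrite perm1 in perm2; have def_t1 := def_t.
rewrite perm1 in def_t1; have def_t2 := def_t1; rewrite perm2 in def_t2.
clear priv perm1 perm2.
move: uv uw vw ub vb wb def_t def_t1 def_t2 uv' uw' vw'.
case: u => [|u|u i|//|u]; case: v => [|v|v j|//|v]; case: w => [|w|w k|//|w] //=;
  rewrite ?orbF => uv uw vw _ _ _ def_t def_t1 def_t2 uv' uw' vw'.
- have /eqP eq_v : v == w by case/orP: vw => /andP[/eqP->].
  by subst w; apply: (@sph VO _ _ v true j k) def_t _ _ _ vw'.
- by have /eqP ? := uv; have /eqP ? := uw; subst v w; apply: (@sph (VB u) _ _ u false j k) def_t _ _ _ vw'.
- have /eqP eq_v : u == w by case/orP: uw => /andP[/eqP->].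
  by subst w; apply: (@sph VO _ _ u true i k) def_t1 _ _ _ uw'.
- by have /eqP ? := uv; have /eqP ? := vw; subst u w; apply: (@sph (VB v) _ _ v false i k) def_t1 _ _ _ uw'.
- have /eqP eq_v : u == v by case/orP: uv => /andP[/eqP->].
  by subst v; apply: (@sph VO _ _ u true i j) def_t2 _ _ _ uv'.
- by have /eqP ? := uw; have /eqP ? := vw; subst u v; apply: (@sph (VB w) _ _ w false i j) def_t2 _ _ _ uv'.
(* Three vertices on one cycle remain. The cycle has even length, so parity alternates along its
   edges and there is no triangle; this is why its length is a double. *)
have oddS (a : 'I_h.*2) : odd (ordS a) = ~~ odd a.
  rewrite val_ordS; case: eqP => // eq_a.
  by rewrite -[LHS]/false -(negbK (odd a)) -[~~ odd a]/(odd a.+1) eq_a odd_double.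
have step (a b : 'I_h.*2) (x y : X) : (x == y) && (b == ordS a) ||
    (y == x) && (a == ordS b) -> odd a != odd b.
  by case/orP=> /andP[_ /eqP->]; rewrite oddS; case: (odd _).
have := step _ _ _ _ uv; have := step _ _ _ _ uw; have := step _ _ _ _ vw.
by case: (odd i); case: (odd j); case: (odd k).
Qed.

Lemma card_sat_triangles :
  #|triangles sat_graph| <= #|X| * h.*2 * 2 + #|J| * 25 * 24.
Proof.
pose sph (p : X * 'I_h.*2 * bool) := sphere_tri p.1.1 p.1.2 p.2.
pose gat (p : J * 'I_25 * 'I_24) := gate_tri p.1.1 p.1.2 (nth (0, 0, 0) gate_triangles p.2).
have sub : triangles sat_graph \subset [set sph p | p in predT] :|: [set gat p | p in predT].
  apply/subsetP=> t /sat_triangles[[v [i [b ->]]]|[j [c [t' [t'G ->]]]]]; rewrite inE.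
    by apply/orP; left; apply/imsetP; exists (v, i, b).
  apply/orP; right; apply/imsetP.
  have lt_t' : index t' gate_triangles < 24 by rewrite -[24]/(size gate_triangles) index_mem.
  by exists (j, c, Ordinal lt_t') => //; rewrite /gat /= nth_index.
apply: leq_trans (subset_leq_card sub) _; rewrite cardsU (leq_trans (leq_subr _ _)) //.
by rewrite leq_add // (leq_trans (leq_imset_card _ _)) // !card_prod !card_ord ?card_bool.
Qed.

Lemma card_sat_edges :
  #|X| * h.*2 * 3 + #|J| * 25 * 34 + #|Z| <= #|edges sat_graph|.
Proof.
rewrite card_oriented.
pose f (p : X * 'I_h.*2 * option bool + J * 'I_25 * 'I_34 + Z) : V * V :=
  match p with
  | inl (inl (v, i, Some b)) => (if b then VO else VB v, VX v i)
  | inl (inl (v, i, None)) => (VX v i, VX v (ordS i))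
  | inl (inr (j, c, e)) =>
      (gv j c (nth (0, 0) gate_arcs e).1, gv j c (nth (0, 0) gate_arcs e).2)
  | inr z => (VO, VZ z)
  end.
have gate_arc (e : 'I_34) : nth (0, 0) gate_arcs e \in gate_arcs by rewrite mem_nth.
have arc_ge e : e \in gate_arcs -> 3 <= e.1 < 13.
  suff /allP allG : all (fun e => 3 <= e.1 < 13) gate_arcs by apply: allG.
  by vm_compute.
have gv3 j c (e : 'I_34) : gv j c (nth (0, 0) gate_arcs e).1 =
    VP j c (inord ((nth (0, 0) gate_arcs e).1 - 3)).
  by have := arc_ge _ (gate_arc e); case: (nth _ _ _) => -[|[|[|a]]] b //= _; rewrite ?subSS ?subn0.
have fI : injective f.
  case=> [[[[v i] [b|]]|[[j c] e]]|z] [[[[v' i'] [b'|]]|[[j' c'] e']]|z'] //=; rewrite ?gv3.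
  all: try by case: b.
  all: try by case: b'.
  all: try by case: b b' => -[] // [] *; subst.
  all: try by case=> *; subst.
  case=> eqj eqc /(congr1 (@nat_of_ord _)); subst j' c'.
  have := arc_ge _ (gate_arc e); have := arc_ge _ (gate_arc e').
  have := gate_arcs_lt; have := gate_arc e; have := gate_arc e'.
  case eE: (nth _ _ e) => [a b]; case e'E: (nth _ _ e') => [a' b'] /=.
  move=> e'G eG lt_arc a'ge age; rewrite !inordK; try lia.
  move=> eq_a; have := lt_arc _ _ eG; have := lt_arc _ _ e'G => lt' lt eq_b.
  have eq_e : (a, b) = (a', b').
    congr (_, _); first by lia.
    by apply: gv_inj eq_b; lia.
  congr (inl (inr (_, _))); apply: val_inj; apply/eqP.
  have lt_sz (d : 'I_34) : d < size gate_arcs by apply: ltn_ord.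
  by rewrite -(@nth_uniq _ (0, 0) gate_arcs) ?lt_sz //; apply/eqP; rewrite [LHS]eE [RHS]e'E.
rewrite -[X in X <= _](_ : #|[set f p | p in predT]| = _).
  apply: subset_leq_card; apply/subsetP=> _ /imsetP[p _ ->]; rewrite !inE.
  case: p => [[[[v i] [b|]]|[[j c] e]]|z] //=; rewrite ?eqxx //; first by case: b => /=.
  have := gate_arc e; case: (nth _ _ _) => a b ab.
  by rewrite (@gv_arc j c).
by rewrite card_imset // !card_sum !card_prod card_option card_bool !card_ord.
Qed.

Lemma sat_unused : (wsat sat_graph K3).+1 = #|{: V}| ->
  exists U : {set {set V}}, [/\ U \subset triangles sat_graph,
    #|triangles sat_graph :\: U| <= #|X|
    & forall S : {set {set V}}, S \subset U -> closed_triangles S -> S = set0].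
Proof.
case/wsat_used=> U [UT cU closedU]; exists U; split=> //.
(* Triangles minus edges plus vertices: a variable gives 4h - 6h + (2h + 1) = 1, a gate 24 - 34 + 10
   = 0, a vertex [VZ] gives 0 - 1 + 1 = 0, and [VO] cancels against the successor in [cU]. *)
rewrite cardsD (setIidPr UT); move: cU; rewrite card_vert.
by have := card_sat_triangles; have := card_sat_edges; lia.
Qed.

Lemma ordS_odd (i : 'I_h.*2) : odd (ordS i) = ~~ odd i.
Proof.
rewrite val_ordS; case: eqP => // eq_i.
by rewrite -[LHS]/false -(negbK (odd i)) -[~~ odd i]/(odd i.+1) eq_i odd_double.
Qed.

Lemma ordS_neq_id (i : 'I_h.*2) : (ordS i == i) = false.
Proof. by apply/eqP=> eq_i; have := ordS_odd i; rewrite eq_i; case: odd. Qed.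

Lemma ordSS_neq_id (i : 'I_h.*2) : (ordS (ordS i) == i) = false.
Proof.
apply/eqP=> /(congr1 (@nat_of_ord _)); rewrite !val_ordS.
by have := ltn_ord i; case: (i.+1 =P h.*2) => eq_i; case: eqP; lia.
Qed.

Lemma VX_eq (v : X) (i i' : 'I_h.*2) : (VX v i == VX v i' :> V) = (i == i').
Proof. by apply/eqP/eqP=> [[]|->]. Qed.

Lemma sphere_tri_inj v v' i i' b b' :
  sphere_tri v i b = sphere_tri v' i' b' -> v = v' /\ i = i'.
Proof.
move=> eq_t.
have memt u : u \in sphere_tri v i b -> u \in sphere_tri v' i' b' by rewrite eq_t.
have := memt (VX v i); have := memt (VX v (ordS i)).
rewrite !inE !eqxx !orbT => /(_ isT) + /(_ isT).
have noY u k : (VX u k == (if b' then VO else VB v') :> V) = false by case: (b').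
have eqX u u' k k' : VX u k = VX u' k' :> V -> u = u' /\ k = k' by case.
rewrite !noY /= => /orP[]/eqP/eqX[_ eqS] /orP[]/eqP/eqX[eqv eqi]; split=> //.
  by move: (ordSS_neq_id i'); rewrite -eqi eqS eqxx.
exact: (can_inj (@ordSK _)).
Qed.

Lemma sphere_cofacet_pred (S : {set {set V}}) v i b : sphere_tri v (ord_pred i) b \in S ->
  cofacet S (if b then VO else VB v) (VX v i) (VX v (ordS i)).
Proof.
move=> tS; exists (sphere_tri v (ord_pred i) b) => //.
rewrite !inE ord_predK !eqxx !orbT /= !negb_or !VX_eq.
have := ordSS_neq_id (ord_pred i); rewrite ord_predK => ->.
by rewrite ordS_neq_id; case: b {tS}.
Qed.

Lemma sphere_cofacet_succ (S : {set {set V}}) v i b : sphere_tri v (ordS i) b \in S ->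
  cofacet S (if b then VO else VB v) (VX v (ordS i)) (VX v i).
Proof.
move=> tS; exists (sphere_tri v (ordS i) b) => //.
rewrite !inE !eqxx !orbT /= !negb_or !VX_eq ![i == _]eq_sym ordS_neq_id ordSS_neq_id.
by case: b {tS}.
Qed.

Lemma sphere_cofacet_pole (S : {set {set V}}) v i b : sphere_tri v i (~~ b) \in S ->
  cofacet S (VX v i) (VX v (ordS i)) (if b then VO else VB v).
Proof.
move=> tS; exists (sphere_tri v i (~~ b)) => //.
by rewrite !inE !eqxx !orbT /=; case: b {tS}.
Qed.

Lemma sphere_closed v : closed_triangles [set sphere_tri v p.1 p.2 | p : 'I_h.*2 * bool].
Proof.
have inS i b : sphere_tri v i b \in [set sphere_tri v p.1 p.2 | p : 'I_h.*2 * bool].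
  by apply/imsetP; exists (i, b).
apply: closed_trianglesI => _ /imsetP[[i b] _ ->] /=.
exists (if b then VO else VB v), (VX v i), (VX v (ordS i)); split=> //; split.
- exact: sphere_cofacet_pred.
- exact: sphere_cofacet_succ.
- exact: sphere_cofacet_pole.
Qed.

(** * From minimal weak saturation number to a satisfying assignment *)

Section ClauseClosed.

Variables (tau : X -> bool) (j : J).
Hypothesis unsat : forall k, (pos j k < h) != tau (var j k).

Definition clause_tris : {set {set V}} :=
  [set gate_tri j p.1 (nth (0, 0, 0) gate_triangles p.2) | p : 'I_25 * 'I_24] :|:
  [set sphere_tri (var j p.1.1) p.1.2 p.2 |
    p in [pred p : 'I_5 * 'I_h.*2 * bool | (p.1.2 < h) != tau (var j p.1.1)]].

Lemma gate_in_clause c t : t \in gate_triangles -> gate_tri j c t \in clause_tris.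
Proof.
move=> tG; rewrite inE; apply/orP; left; apply/imsetP.
have lt_t : index t gate_triangles < 24 by rewrite -[24]/(size gate_triangles) index_mem.
by exists (c, Ordinal lt_t) => //=; rewrite nth_index.
Qed.

Lemma sphere_in_clause k (i : 'I_h.*2) b : (i < h) != tau (var j k) ->
  sphere_tri (var j k) i b \in clause_tris.
Proof.
by move=> ti; rewrite inE; apply/orP; right; apply/imsetP; exists (k, i, b).
Qed.

Lemma in_gate_tri c t u : u \in gate_tri j c t -> exists2 n, in_triple n t & u = gv j c n.
Proof.
rewrite !inE -orbA => /or3P[]/eqP->; [exists t.1.1|exists t.1.2|exists t.2] => //;
  by rewrite /in_triple !inE eqxx ?orbT.
Qed.

Lemma gate_triangle_lt t n : t \in gate_triangles -> in_triple n t -> n < 13.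
Proof.
move=> tG; have [/and3P[lt1 lt2 lt3] _ _ _] := gate_closed tG.
rewrite /in_triple !inE => /or3P[]/eqP-> //; last exact: ltn_trans lt2 lt3.
exact: ltn_trans (ltn_trans lt1 lt2) lt3.
Qed.

Lemma mem_gate_tri c t n : in_triple n t -> gv j c n \in gate_tri j c t.
Proof. by rewrite /in_triple !inE => /or3P[]/eqP->; rewrite eqxx ?orbT. Qed.

Lemma gate_cofacet_clause c x y z : z < 13 -> gate_cofacet x y z ->
  cofacet clause_tris (gv j c x) (gv j c y) (gv j c z).
Proof.
move=> z13 /hasP[t tG /and3P[xt yt zt]]; exists (gate_tri j c t); first exact: gate_in_clause.
apply/and3P; split; try exact: mem_gate_tri.
apply/negP=> /in_gate_tri[n nt eq_zn]; case/negP: zt.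
by rewrite (gv_inj z13 (gate_triangle_lt tG nt) eq_zn).
Qed.

Lemma slot_mul5 (k : 'I_5) r : r < 5 -> exists2 c : 'I_25, c %% 5 = r & slot c = k.
Proof.
move=> r5; have lt_c : 5 * k + r < 25 by have := ltn_ord k; lia.
exists (Ordinal lt_c) => /=; first by have := ltn_ord k; lia.
by apply: val_inj => /=; have := ltn_ord k; lia.
Qed.

Lemma gate_edge_cofacet c u w z : base_vert z -> z != u -> z != w ->
  (fstv j c = u /\ sndv j c = w) \/ (fstv j c = w /\ sndv j c = u) ->
  cofacet clause_tris u w z.
Proof.
move=> zB zu zw eq_uw; exists (gate_tri j c (1, 2, 9)); first by apply: gate_in_clause.
rewrite !inE /= !negb_or; case: eq_uw => -[-> ->]; rewrite !eqxx ?orbT /= zu zw /=;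
  by case: z zB {zu zw}.
Qed.

Lemma equator_cofacet k b i z : i = x0 \/ i = xh -> base_vert z ->
    z != (if b then VO else VB (var j k)) -> z != VX (var j k) i ->
  cofacet clause_tris (if b then VO else VB (var j k)) (VX (var j k) i) z.
Proof.
move=> eq_i zB zY zi.
(* The gates 1, 2, 3, 4 of a slot run along [VO]-[x0], [x0]-[VB], [VB]-[xh] and [xh]-[VO]. *)
have [r r5 rP] : exists2 r, r < 5 & forall c : 'I_25, c %% 5 = r -> slot c = k ->
   (fstv j c = (if b then VO else VB (var j k)) /\ sndv j c = VX (var j k) i) \/
   (fstv j c = VX (var j k) i /\ sndv j c = (if b then VO else VB (var j k))).
  case: eq_i b {zY zi} => -> [|]; [exists 1|exists 2|exists 4|exists 3] => // c c5 ck;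
    rewrite /fstv /sndv c5 ck; try (by left); by right.
by have [c c5 ck] := slot_mul5 k r5; apply: gate_edge_cofacet (rP c c5 ck).
Qed.

(** The edge 12 of every gate lies on the half taken into [clause_tris]: the edge of the literal
    because the literal is false, the four boundary edges because they belong to both halves. *)
Lemma sphere_gate_edge c :
  cofacet clause_tris (fstv j c) (sndv j c) (VP j c (inord 6)).
Proof.
set k := slot c; set v := var j k.
have side (i : 'I_h.*2) b : (i < h) != tau v -> fstv j c \in sphere_tri v i b -> sndv j c \in sphere_tri v i b ->
    cofacet clause_tris (fstv j c) (sndv j c) (VP j c (inord 6)).
  move=> ti fin sin; exists (sphere_tri v i b); first exact: sphere_in_clause.
  by rewrite fin sin !inE; case: b {fin sin}.
(* The triangle [i] lies between the meridians of [i] and [ordS i]. Thus on the upper half [x0] and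
   [xh] are met by the last and by the first triangle, on the lower half by the first and by the
   last one. *)
have eqtr b : exists i0 ih : 'I_h.*2, [/\ (i0 < h) != tau v, (ih < h) != tau v,
    VX v x0 \in sphere_tri v i0 b & VX v xh \in sphere_tri v ih b].
  have predP (i : 'I_h.*2) : VX v i \in sphere_tri v (ord_pred i) b.
    by rewrite !inE ord_predK eqxx !orbT.
  have selfP (i : 'I_h.*2) : VX v i \in sphere_tri v i b by rewrite !inE eqxx !orbT.
  case: (tau v).
    exists (ord_pred x0), xh; split=> //=; last by rewrite ltnn.
    by rewrite add0n modn_small //; lia.
  exists x0, (ord_pred xh); split=> //=; first by rewrite ltnNge; lia.
  rewrite [(h + _).-1](_ : _ = h.-1 + h.*2); last lia.
  by rewrite modnDr modn_small; lia.
have poleP i b : (if b then VO else VB v) \in sphere_tri v i b by rewrite !inE eqxx.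
have := unsat k; rewrite -/v => unsat_k.
have : c %% 5 < 5 by rewrite ltn_mod.
have [i0 [ih [t0 th m0 mh]]] := eqtr true; have [i0' [ih' [t0' th' m0' mh']]] := eqtr false.
rewrite /fstv /sndv -/k -/v in side *.
case: (c %% 5) side => [|[|[|[|[|r]]]]] // side _.
- by apply: (side (pos j k) true) => //; [exact: poleP|rewrite !inE eqxx !orbT].
- by apply: (side i0 true) => //; exact: poleP.
- by apply: (side i0' false) => //; exact: poleP.
- by apply: (side ih' false) => //; exact: poleP.
- by apply: (side ih true) => //; exact: poleP.
Qed.

Lemma clause_closed : closed_triangles clause_tris.
Proof.
apply: closed_trianglesI => t; rewrite inE => /orP[]/imsetP.
  case=> -[c e] _ -> /=; set t' := nth _ _ _.
  have tG : t' \in gate_triangles by rewrite mem_nth // (ltn_ord e).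
  have [/and3P[lt1 lt2 lt3] cof23 cof13 cof12] := gate_closed tG.
  have lt2' := ltn_trans lt2 lt3; have lt1' := ltn_trans lt1 lt2'.
  exists (gv j c t'.1.1), (gv j c t'.1.2), (gv j c t'.2); split=> //; split.
  - case: cof12 => [->|[->|cof]]; last exact: gate_cofacet_clause.
      exists (gate_tri j (ord_pred c) (1, 2, 9)); first exact: gate_in_clause.
      have VP_base a u : base_vert u -> (VP j c a == u) = false by case: u.
      apply/and3P; split; rewrite !inE.
      - by rewrite /= eqxx !orbT.
      - by rewrite [gv j c _]/=; case: (fst_pred j c) => ->; rewrite eqxx ?orbT.
      rewrite /= (VP_base _ _ (fstv_base j _)) (VP_base _ _ (sndv_base j _)) /=.
      by apply/eqP=> -[eq_c]; have := ord_pred_neq c; rewrite -eq_c eqxx.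
    exact: sphere_gate_edge.
  - exact: gate_cofacet_clause.
  - exact: gate_cofacet_clause.
case=> -[[k i] b] /=; rewrite inE /= => ti ->.
exists (if b then VO else VB (var j k)), (VX (var j k) i), (VX (var j k) (ordS i)).
have YB : base_vert (if b then VO else VB (var j k) : V) by case: b.
have XY i' : VX (var j k) i' != (if b then VO else VB (var j k)) by case: (b).
have boundary (i' : 'I_h.*2) : (i' < h) != (ordS i' < h) -> ordS i' = x0 \/ ordS i' = xh.
  move=> ne; have := val_ordS i'; case: eqP => [_ eq0|_ eqS]; [left|right]; apply: val_inj => //.
  rewrite eqS in ne; rewrite [LHS]eqS [RHS]/=; move: (nat_of_ord i') ne => n.
  by case: (ltngtP n.+1 h).
split=> //; split.
- have [eq_side|ne] := eqVneq ((ord_pred i : 'I_h.*2) < h) (i < h).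
    by apply/sphere_cofacet_pred/sphere_in_clause; rewrite eq_side.
  apply: equator_cofacet => //; last by rewrite VX_eq ordS_neq_id.
  by have := boundary (ord_pred i); rewrite ord_predK; apply.
- have [eq_side|ne] := eqVneq ((ordS i : 'I_h.*2) < h) (i < h).
    by apply/sphere_cofacet_succ/sphere_in_clause; rewrite eq_side.
  apply: equator_cofacet => //; last by rewrite VX_eq eq_sym ordS_neq_id.
  by apply: boundary; rewrite eq_sym.
- exact/sphere_cofacet_pole/sphere_in_clause.
Qed.

End ClauseClosed.

Definition satisfiable := exists tau : X -> bool,
  forall j, exists k, tau (var j k) = (pos j k < h).

Lemma gate_tri_apex j c t : t \in gate_triangles -> exists a, VP j c a \in gate_tri j c t.
Proof.
move=> tG; exists (inord (t.2 - 3)); rewrite !inE.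
suff /allP/(_ _ tG) : all (fun t : nat * nat * nat => 2 < t.2) gate_triangles.
  by case: (t.2) => [|[|[|n]]] //= _; rewrite ?subSS ?subn0 eqxx orbT.
by vm_compute.
Qed.

Lemma sphere_tri_triangle v i b : sphere_tri v i b \in triangles sat_graph.
Proof.
rewrite mem_triangles.
- by rewrite !adj_sat; case: b => /=; rewrite !eqxx ?orbT.
- by case: b.
- by case: b.
- by rewrite VX_eq eq_sym ordS_neq_id.
Qed.

Lemma gate_tri_triangle j c t : t \in gate_triangles -> gate_tri j c t \in triangles sat_graph.
Proof.
move=> tG; have [/and3P[lt1 lt2 lt3] _ _ _] := gate_closed tG.
have lt2' := ltn_trans lt2 lt3; have lt1' := ltn_trans lt1 lt2'.
have /and3P[adj12 adj13 adj23] : [&& gate_adj t.1.1 t.1.2, gate_adj t.1.1 t.2 & gate_adj t.1.2 t.2].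
  suff /allP/(_ _ tG) : all (fun t : nat * nat * nat =>
      [&& gate_adj t.1.1 t.1.2, gate_adj t.1.1 t.2 & gate_adj t.1.2 t.2]) gate_triangles by [].
  by vm_compute.
have [a12 a13 a23] := And3 (gv_adj j c lt1' lt2' adj12) (gv_adj j c lt1' lt3 adj13) (gv_adj j c lt2' lt3 adj23).
by rewrite mem_triangles ?a12 ?a13 ?a23 ?(adj_neq a12) ?(adj_neq a13) ?(adj_neq a23).
Qed.

Lemma wsat_satisfiable : (wsat sat_graph K3).+1 = #|{: V}| -> satisfiable.
Proof.
case/sat_unused=> U [UT leX closedU].
have unusedP v : exists p : 'I_h.*2 * bool, sphere_tri v p.1 p.2 \in triangles sat_graph :\: U.
  apply/existsP; apply: contraT => /existsPn usedP.
  have := closedU [set sphere_tri v p.1 p.2 | p : 'I_h.*2 * bool].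
  have -> : [set sphere_tri v p.1 p.2 | p : 'I_h.*2 * bool] \subset U.
    apply/subsetP=> _ /imsetP[p _ ->]; have := usedP p.
    by rewrite inE sphere_tri_triangle andbT negbK.
  move=> /(_ isT (@sphere_closed v))/setP/(_ (sphere_tri v x0 true)).
  by rewrite inE; case: imsetP => // -[]; exists (x0, true).
have [u uP] := fin_all_exists unusedP.
pose tr v := sphere_tri v (u v).1 (u v).2.
have eq_unused : triangles sat_graph :\: U = [set tr v | v in X].
  apply/eqP; rewrite eq_sym eqEcard; apply/andP; split.
    by apply/subsetP=> _ /imsetP[v _ ->]; apply: uP.
  by rewrite card_imset // => v v' /sphere_tri_inj[].
exists (fun v => (u v).1 < h) => j.
suff /existsP[k /eqP kP] : [exists k, ((u (var j k)).1 < h) == (pos j k < h)] by exists k.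
apply: contraT => /existsPn unsat.
have unsat' k : (pos j k < h) != ((u (var j k)).1 < h) by rewrite eq_sym; apply/unsat.
have := closedU (clause_tris (fun v => (u v).1 < h) j) _ (clause_closed unsat').
have -> : clause_tris (fun v => (u v).1 < h) j \subset U.
  apply/subsetP=> t tK; apply: contraT => tU.
  have tT : t \in triangles sat_graph.
    move: tK; rewrite inE => /orP[]/imsetP.
      case=> -[c e] _ -> /=; set t' := nth _ _ _.
      have tG : t' \in gate_triangles by rewrite mem_nth // (ltn_ord e).
      exact: gate_tri_triangle.
    by case=> -[[k i] b] _ ->; apply: sphere_tri_triangle.
  have : t \in [set tr v | v in X] by rewrite -eq_unused inE tU.
  case/imsetP=> v _ tE; move: tK; rewrite inE => /orP[]/imsetP.
    case=> -[c e] _ /=; set t' := nth _ _ _ => t_gate.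
    have tG : t' \in gate_triangles by rewrite mem_nth // (ltn_ord e).
    have [a] := gate_tri_apex j c tG; rewrite -t_gate tE !inE.
    by case: (u v) => i' [].
  case=> -[[k i] b] /=; rewrite inE /= => ti; rewrite tE => /sphere_tri_inj[eq_v eq_i].
  by rewrite -eq_v -eq_i eqxx in ti.
have tG : (0, 1, 9) \in gate_triangles by [].
move/(_ isT)/setP/(_ (gate_tri j (inord 0) (0, 1, 9))).
by rewrite (gate_in_clause _ _ _ tG) inE.
Qed.

(** * From a satisfying assignment to a percolating spanning tree *)

Hypothesis slot_inj : forall j k j' k',
  var j k = var j' k' -> pos j k = pos j' k' -> j = j' /\ k = k'.

Section Percolation.

Variables (tau : X -> bool) (sel : J -> 'I_5).
Hypothesis sel_sat : forall j, tau (var j (sel j)) = (pos j (sel j) < h).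

Lemma sel_gate_proof j : 5 * sel j < 25.
Proof. by have := ltn_ord (sel j); lia. Qed.

Definition sel_gate j : 'I_25 := Ordinal (sel_gate_proof j).

Lemma slot_sel j : slot (sel_gate j) = sel j.
Proof. by apply: val_inj => /=; rewrite mulKn. Qed.

Lemma sel_gate_mod j : sel_gate j %% 5 = 0.
Proof. by rewrite /= modnMr. Qed.

Lemma eq_sel_gate j (c : 'I_25) : c %% 5 = 0 -> slot c = sel j -> c = sel_gate j.
Proof. by move=> c5 /(congr1 (@nat_of_ord _)) /= eq_s; apply: val_inj => /=; lia. Qed.

(** By [slot_inj] at most one clause qualifies, so the choice made by [pick] is forced. *)
Definition selected v i := [pick j | (var j (sel j) == v) && (pos j (sel j) == i)].

Definition tree_parent (tree : seq (nat * nat)) n :=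
  (nth (0, 0) tree (find (fun e => e.1 == n) tree)).2.

(** The tree leaves out the edge from [VO] to a selected vertex, since the gate has to produce it;
    such a vertex hangs on its gate instead. The apex 9, of index 6, takes its parent as vertex 0 of
    the next gate, or is attached to [VO] when that gate is the selected one. *)
Definition par (u : V) : V :=
  match u with
  | VO => VO
  | VB v => VX v xh
  | VX v i => if i == x0 then VB v else
              if selected v i is Some j then gv j (sel_gate j) 12 else VO
  | VP j c a =>
      if a == 6 :> nat then
        if ordS c == sel_gate j then VO else gv j (ordS c) 12
      else gv j c (tree_parent (if c == sel_gate j then gate_tree12 else gate_tree01) (a + 3))
  | VZ _ => VO
  end.

Lemma selected_sel j : selected (var j (sel j)) (pos j (sel j)) = Some j.
Proof.
rewrite /selected; case: pickP => [j' /andP[/eqP eqv /eqP eqp]|/(_ j)]; last by rewrite !eqxx.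
by have [->] := slot_inj eqv eqp.
Qed.

Lemma tree_parent_adj b n : 3 <= n < 13 -> n != 9 ->
  tree_parent (if b then gate_tree12 else gate_tree01) n < 13 /\
  gate_adj n (tree_parent (if b then gate_tree12 else gate_tree01) n).
Proof.
move=> lt_n n9; suff /allP/(_ n) : all (fun n => [==> 3 <= n, n != 9 =>
    (tree_parent (if b then gate_tree12 else gate_tree01) n < 13) &&
    gate_adj n (tree_parent (if b then gate_tree12 else gate_tree01) n)]) (iota 0 13).
  by rewrite mem_iota /=; case/andP: lt_n => -> -> /(_ isT); rewrite n9 => /andP.
by case: b; vm_compute.
Qed.

Lemma fst_sel j : fstv j (sel_gate j) = VO.
Proof. by rewrite /fstv sel_gate_mod. Qed.

Lemma snd_sel j : sndv j (sel_gate j) = VX (var j (sel j)) (pos j (sel j)).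
Proof. by rewrite /sndv sel_gate_mod slot_sel. Qed.

Lemma private_gv j c a : VP j c a = gv j c (a + 3).
Proof. by rewrite addn3 /= inord_val. Qed.

Lemma par_adj u : u != VO -> adj sat_graph u (par u).
Proof.
case: u => [|v|v i|j c a|z] //= _; first by rewrite adj_sat /= eqxx.
- case: eqP => [->|_]; first by rewrite adj_sat /= eqxx.
  rewrite /selected; case: pickP => [j /andP[/eqP<- /eqP<-]|_]; last by rewrite adj_sat.
  by rewrite -snd_sel; apply: (@gv_adj j (sel_gate j) 2 12).
- have [a6|a6] := eqVneq (a : nat) 6.
    have -> : VP j c a = gv j (ordS c) 0.
      by rewrite /= ordSK; congr VP; apply: val_inj; rewrite /= a6 inordK.
    case: eqP => [->|_]; last exact: (@gv_adj j _ 0 12).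
    by rewrite -[X in adj _ _ X](fst_sel j); apply: (@gv_adj j _ 0 1).
  have [||lt_p adj_p] := @tree_parent_adj (c == sel_gate j) (a + 3).
  + by have := ltn_ord a; lia.
  + by lia.
  by rewrite private_gv; apply: gv_adj => //; have := ltn_ord a; lia.
- by rewrite adj_sat.
Qed.

Lemma tree_edgesP : [forall e in [set [set u; par u] | u in [set~ VO]], #|e| == 2].
Proof.
apply/forall_inP=> _ /imsetP[u uO ->].
by rewrite cards2 (adj_neq (par_adj _)) //; move: uO; rewrite !inE.
Qed.

Definition tree_graph : graph V := Graph tree_edgesP.

Local Notation act := (active sat_graph tree_graph).

Lemma act_par u : u != VO -> act u (par u).
Proof. by move=> uO; apply/ActiveEdge/imsetP; exists u; rewrite ?inE. Qed.

Lemma tree_sub : edges tree_graph \subset edges sat_graph.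
Proof.
by apply/subsetP=> _ /imsetP[u uO ->]; apply: par_adj; move: uO; rewrite !inE.
Qed.

Lemma act_triangle u v w : adj sat_graph u v -> act u w -> act v w -> act u v.
Proof. by move=> uv uw vw; apply: ActiveTriangle uv uw (active_sym vw). Qed.

Definition gate_active j c :=
  forall a b, a < 13 -> b < 13 -> gate_adj a b -> act (gv j c a) (gv j c b).

Lemma gate_percolation j c s :
    (forall e, e \in s -> act (gv j c e.1) (gv j c e.2)) -> gate_percolates s ->
  gate_active j c.
Proof.
move=> act_s perc.
have has_act s' : (forall e, e \in s' -> act (gv j c e.1) (gv j c e.2)) ->
    forall a b, has_edge s' a b -> act (gv j c a) (gv j c b).
  by move=> act_s' a b /orP[/act_s'|/act_s'/active_sym].
have lt13 e : e \in gate_edges -> (e.1 < 13) && (e.2 < 13).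
  suff /allP allG : all (fun e => (e.1 < 13) && (e.2 < 13)) gate_edges by apply: allG.
  by vm_compute.
have act_n n : forall e, e \in iter n gate_grow s -> act (gv j c e.1) (gv j c e.2).
  elim: n => [//|n IHn] e; rewrite iterS mem_filter => /andP[eP eG].
  case/orP: eP => [/(has_act _ IHn)//|/hasP[d _ /andP[/(has_act _ IHn) act1 /(has_act _ IHn) act2]]].
  have /andP[e1 e2] := lt13 e eG.
  apply: ActiveTriangle act1 act2; apply: gv_adj => //.
  by rewrite /gate_adj -surjective_pairing eG.
have act_e e : e \in gate_edges -> act (gv j c e.1) (gv j c e.2).
  by move=> eG; apply: (has_act (iter 20 gate_grow s) (act_n 20)); apply: gate_percolatesP.
by move=> a b _ _ /orP[/act_e|/act_e/active_sym].
Qed.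

(** Selected positions lie inside the half chosen by [tau], because the selected literals are
    true. *)
Lemma par_VX v i : i != x0 -> (i < h) != tau v \/ i = xh -> par (VX v i) = VO.
Proof.
move=> i0 side; rewrite /= (negPf i0) /selected; case: pickP => // j /andP[/eqP eqv /eqP eqp].
have [_ /negPf] := pos_neq j (sel j); rewrite eqp => neh.
by case: side => [|eqh]; [rewrite -eqv -eqp sel_sat eqxx | rewrite eqh eqxx in neh].
Qed.

Lemma act_sphere_step v (i i' : 'I_h.*2) :
    i' = ordS i \/ i = ordS i' -> act VO (VX v i) -> act VO (VX v i') ->
  act (VB v) (VX v i) -> act (VB v) (VX v i').
Proof.
move=> ii' Oi Oi' Bi.
have adj_ii' : adj sat_graph (VX v i') (VX v i).
  by rewrite adj_sat /= !eqxx /=; case: ii' => ->; rewrite eqxx ?orbT.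
have i'i : act (VX v i') (VX v i).
  by apply: act_triangle adj_ii' _ _; apply: active_sym; [exact: Oi' | exact: Oi].
by apply: act_triangle Bi i'i; rewrite adj_sat /= eqxx.
Qed.

Lemma act_VB_xh v : act (VB v) (VX v xh).
Proof. exact: act_par. Qed.

Lemma act_VB_x0 v : act (VB v) (VX v x0).
Proof. by apply: active_sym; exact: (@act_par (VX v x0) isT). Qed.

Lemma act_VO_side v i : i != x0 -> (i < h) != tau v \/ i = xh -> act VO (VX v i).
Proof.
by move=> i0 side; apply: active_sym; rewrite -[X in act _ X](par_VX i0 side); apply: act_par.
Qed.

Lemma val_ord_pred (i : 'I_h.*2) : ord_pred i = (if i == x0 then h.*2.-1 else i.-1) :> nat.
Proof.
rewrite -val_eqE /=; have := ltn_ord i; case: eqP => [->|i0] lt_i.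
  by rewrite add0n modn_small //; lia.
by rewrite [(i + _).-1](_ : _ = i.-1 + h.*2) ?modnDr ?modn_small; lia.
Qed.

(* The hemisphere of [v] not chosen by [tau] is swept from the meridian of
   [xh] to the meridian of [x0]. *)
Lemma act_VO_x0 v : act VO (VX v x0).
Proof.
pose f : 'I_h.*2 -> 'I_h.*2 := if tau v then @ordS _ else @ord_pred _.
have fS i : f i = ordS i \/ i = ordS (f i).
  by rewrite /f; case: (tau v); [left|right; rewrite ord_predK].
have fval n : n < h -> iter n f xh = (if tau v then h + n else h - n) :> nat.
  elim: n => [|n IHn] lt_n; first by case: (tau v); rewrite ?addn0 ?subn0.
  rewrite iterS {1}/f; move: (IHn (ltnW lt_n)); case: (tau v) => eq_n.
    by rewrite val_ordS eq_n; case: eqP; lia.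
  by rewrite val_ord_pred -val_eqE eq_n /=; case: eqP; lia.
have fh : f (iter h.-1 f xh) = x0.
  have /fval : h.-1 < h by lia.
  move=> eq_h; apply: val_inj; move: eq_h; rewrite {2}/f.
  case: (tau v) => eq_h /=.
    by rewrite eq_h (_ : (h + h.-1).+1 = h.*2) ?modnn //; lia.
  by rewrite eq_h (_ : (h - h.-1 + h.*2).-1 = h.*2) ?modnn //; lia.
have VOn n : n < h -> act VO (VX v (iter n f xh)).
  move=> lt_n; apply: act_VO_side.
    by rewrite -val_eqE /= fval //; case: (tau v); lia.
  case: n lt_n => [|n] lt_n; first by right.
  by left; rewrite fval //; case: (tau v); [rewrite ltnNge leq_addr | rewrite ltn_subrL; lia].
have VBn n : n < h -> act (VB v) (VX v (iter n f xh)).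
  elim: n => [_|n IHn lt_n]; first exact: act_VB_xh.
  have lt_n' := ltnW lt_n.
  exact: act_sphere_step (fS _) (VOn n lt_n') (VOn n.+1 lt_n) (IHn lt_n').
(* The edge from [VO] to [x0] is not in the tree. The triangle with [VB v] yields the last cycle
   edge of the sweep, and this edge then joins [VO] to [x0]. *)
set i := iter h.-1 f xh in fh; have lt_h1 : h.-1 < h by lia.
have adj_i0 : adj sat_graph (VX v x0) (VX v i).
  by rewrite adj_sat /= !eqxx /=; case: (fS i); rewrite fh => ->; rewrite eqxx ?orbT.
have act_i0 : act (VX v x0) (VX v i).
  by apply: act_triangle adj_i0 _ _; apply: active_sym; [exact: act_VB_x0 | exact: VBn].
by apply: act_triangle (VOn _ lt_h1) act_i0; rewrite adj_sat.
Qed.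

Lemma par_gate j c n : 3 <= n < 13 -> n != 9 ->
  act (gv j c n) (gv j c (tree_parent (if c == sel_gate j then gate_tree12 else gate_tree01) n)).
Proof.
case: n => [|[|[|n]]] // lt_n n9.
have -> : gv j c n.+3 = VP j c (inord n) by [].
have := @act_par (VP j c (inord n)) isT; rewrite /= inordK; last by lia.
by rewrite (_ : (n == 6) = false) ?addn3 //; lia.
Qed.

Lemma act_apex j c :
  act (gv j c 9) (if ordS c == sel_gate j then VO else gv j (ordS c) 12).
Proof.
suff <- : par (gv j c 9) = if ordS c == sel_gate j then VO else gv j (ordS c) 12 by apply: act_par.
by rewrite -[gv j c 9]/(VP j c (inord 6)) /par inordK.
Qed.

(** Percolation runs against the collapse, from gate [ordS c] to gate [c]: the next gate supplies
    its entrance 01, an edge at the apex 9 of gate [c]. Together with the edge 12 of the rest it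
    starts gate [c]. The predecessor of the selected gate comes first, as the tree contains the
    entrance 01 of the selected gate, and the selected gate comes last and produces its edge 12. *)
Lemma gate_active_step j c :
  (ordS c != sel_gate j -> gate_active j (ordS c)) -> gate_active j c.
Proof.
move=> act_next.
have next9 : gv j (ordS c) 0 = gv j c 9 by rewrite /= ordSK.
have act9 : act (gv j c 9) (fstv j (ordS c)).
  have [eq_c|ne_c] := eqVneq (ordS c) (sel_gate j).
    by have := act_apex j c; rewrite eq_c eqxx fst_sel.
  by rewrite -next9; apply: (act_next ne_c 0 1).
have [x x12 gx] : exists2 x, x \in [:: 1; 2] & gv j c x = fstv j (ordS c).
  by have := fst_pred j (ordS c); rewrite ordSK => -[->|->]; [exists 1|exists 2].
have act9x : act (gv j c x) (gv j c 9) by rewrite gx; apply: active_sym.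
have [eq_c|ne_c] := eqVneq c (sel_gate j).
  (* The gate after the selected one starts at [VO] again, so the shared vertex is 1 and not 2. *)
  have x1 : x = 1.
    move: x12 gx; rewrite !inE => /pred2P[//|->] /=; rewrite eq_c snd_sel.
    have := fst_pred j (ordS c); rewrite ordSK eq_c fst_sel snd_sel.
    have eqO : fstv j (ordS (sel_gate j)) = VO.
      rewrite /fstv (_ : ordS (sel_gate j) %% 5 = 1) //=.
      by have := ltn_ord (sel j); lia.
    by rewrite eqO.
  rewrite x1 in act9x.
  apply: gate_percolation gate_tree12_percolates => e; rewrite 2!in_cons => /or3P[/eqP->|/eqP->//|eT].
    have := act_apex j (ord_pred c); rewrite ord_predK eq_c eqxx => act_p.
    by rewrite /= fst_sel.
  have [->|[e3 e9 eE]] : e = (2, 12) \/ [/\ 3 <= e.1 < 13, e.1 != 9 & e.2 = tree_parent gate_tree12 e.1].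
    have /allP/(_ _ eT) : all (fun e => (e == (2, 12)) ||
        [&& 3 <= e.1 < 13, e.1 != 9 & e.2 == tree_parent gate_tree12 e.1]) gate_tree12 by vm_compute.
    by case/orP=> [/eqP->|/and3P[e3 e9 /eqP eE]]; [left|right].
  - have eq_p : par (sndv j c) = gv j c 12.
      by rewrite eq_c snd_sel /par (negPf (pos_neq _ _).1) selected_sel.
    by have := @act_par (sndv j c); rewrite eq_p; apply; rewrite eq_c snd_sel.
  by have := par_gate j c e3 e9; rewrite [c == _](introT eqP eq_c) -eE.
apply: gate_percolation (gate_tree01_percolates x12) => e.
rewrite 2!in_cons => /or3P[/eqP->|/eqP->//|eT].
  rewrite /= /fstv /sndv.
  have : c %% 5 < 5 by rewrite ltn_mod.
  case c5: (c %% 5) => [|[|[|[|[|r]]]]] // _.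
  (* The edge of a literal that is not selected belongs to the tree: by [slot_inj] its vertex could
     only be selected through this very gate. *)
  - have := @act_par (VX (var j (slot c)) (pos j (slot c))) isT; rewrite /=.
    have [/negPf-> _] := pos_neq j (slot c).
    rewrite /selected; case: pickP => [j' /andP[/eqP eqv /eqP eqp] _|_]; last exact: active_sym.
    have [eqj eqk] := slot_inj eqv eqp; case/eqP: ne_c.
    by apply: eq_sel_gate; rewrite // -eqk eqj.
  - exact: act_VO_x0.
  - exact/active_sym/act_VB_x0.
  - exact: act_VB_xh.
  - by apply/active_sym/act_VO_side; [exact: xh_neq0 | right].
have [->|[e3 e9 eE]] : e = (0, 12) \/ [/\ 3 <= e.1 < 13, e.1 != 9 & e.2 = tree_parent gate_tree01 e.1].
  have /allP/(_ _ eT) : all (fun e => (e == (0, 12)) ||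
      [&& 3 <= e.1 < 13, e.1 != 9 & e.2 == tree_parent gate_tree01 e.1]) gate_tree01 by vm_compute.
  by case/orP=> [/eqP->|/and3P[e3' e9' /eqP eE']]; [left|right].
- by have := act_apex j (ord_pred c); rewrite ord_predK (negPf ne_c).
by have := par_gate j c e3 e9; rewrite (negPf ne_c) -eE.
Qed.
(** The summand [25 * m] keeps the truncated subtraction exact. *)
Lemma iter_ord_pred (c : 'I_25) m : iter m (@ord_pred _) c = (c + 25 * m - m) %% 25 :> nat.
Proof.
elim: m => [|m IHm]; first by rewrite muln0 addn0 subn0 modn_small.
by rewrite iterS /= IHm; lia.
Qed.

Lemma gate_active_all j c : gate_active j c.
Proof.
(* Going backwards round the ring from the selected gate; [m = 25] is the selected gate itself,
   reached last. *)
have act_m m : 0 < m <= 25 -> gate_active j (iter m (@ord_pred _) (sel_gate j)).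
  elim: m => // m IHm /andP[_ lt_m]; apply: gate_active_step.
  rewrite iterS ord_predK; case: m IHm lt_m => [|m] IHm lt_m; first by rewrite eqxx.
  by move=> _; apply: IHm; lia.
pose m := if sel_gate j <= c then 25 - (c - sel_gate j) else sel_gate j - c.
suff -> : c = iter m (@ord_pred _) (sel_gate j).
  by apply: act_m; rewrite /m; have := ltn_ord c; have := ltn_ord (sel_gate j); case: ifP; lia.
apply: val_inj; rewrite /= iter_ord_pred /m; have := ltn_ord c; have := ltn_ord (sel_gate j).
by move: (nat_of_ord (sel_gate j)) (nat_of_ord c) => a b; case: ifP; lia.
Qed.

Lemma act_VO v i : act VO (VX v i).
Proof.
have [->|i0] := eqVneq i x0; first exact: act_VO_x0.
apply: active_sym; have := @act_par (VX v i) isT; rewrite /= (negPf i0) /selected.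
case: pickP => // j /andP[/eqP<- /eqP<-] _.
have := @gate_active_all j (sel_gate j) 2 1 isT isT isT.
by rewrite /= fst_sel snd_sel.
Qed.

Lemma act_VX v i : act (VX v i) (VX v (ordS i)).
Proof.
by apply: (@act_triangle _ _ VO); rewrite ?adj_sat /= ?eqxx //; apply/active_sym/act_VO.
Qed.

Lemma act_VB v i : act (VB v) (VX v i).
Proof.
have act_n n : act (VB v) (VX v (iter n (@ordS _) xh)).
  elim: n => [|n IHn]; first exact: act_VB_xh.
  by apply: act_sphere_step IHn; [left | exact: act_VO | exact: act_VO].
suff <- : iter (i + h) (@ordS _) xh = i by apply: act_n.
have valn n : iter n (@ordS _) xh = (h + n) %% h.*2 :> nat.
  elim: n => [|n IHn]; first by rewrite addn0 modn_small //= lthM.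
  by rewrite iterS /= IHn addnS -addn1 modnDml addn1.
apply: val_inj; rewrite /= valn (_ : h + (i + h) = i + h.*2); last by lia.
by rewrite modnDr modn_small.
Qed.

Lemma act_adj u v : adj sat_graph u v -> act u v.
Proof.
suff arc_act x y : arc x y -> act x y.
  by rewrite adj_sat => /orP[/arc_act|/arc_act/active_sym].
case: x y => [|v0|v0 i|j c a|z] [|w|w i'|j' c' a'|z'] //=.
- by move=> _; apply: act_VO.
- by move=> _; apply: active_sym; apply: (@act_par (VZ z')).
- by move/eqP->; apply: act_VB.
- by case/andP=> /eqP-> /eqP->; apply: act_VX.
all: have a13 : a + 3 < 13 by have := ltn_ord a; lia.
all: try by rewrite private_gv => /orP[/andP[/eqP-> ag]|/andP[/eqP-> ag]];
  [apply: (@gate_active_all j c (a + 3) 1) | apply: (@gate_active_all j c (a + 3) 2)];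
  rewrite ?gate_arcs_adj.
case/andP=> /eqP<- /orP[/andP[/eqP<- ag]|/and3P[/eqP-> /eqP a6 ag]].
  have a'13 : a' + 3 < 13 by have := ltn_ord a'; lia.
  by rewrite !private_gv; apply: gate_active_all => //; exact: gate_arcs_adj.
have -> : VP j (ord_pred c) a' = gv j c 0.
  by congr VP; apply: val_inj; rewrite /= a6 inordK.
by rewrite private_gv; apply: gate_active_all => //; exact: gate_arcs_adj.
Qed.

End Percolation.

Lemma sat_connected u : connect (adj sat_graph) VO u.
Proof.
have XO v i : connect (adj sat_graph) VO (VX v i) by apply: connect1; rewrite adj_sat.
have BO v : connect (adj sat_graph) VO (VB v).
  by apply: connect_trans (XO v x0) _; apply: connect1; rewrite adj_sat /= eqxx.
have base w : base_vert w -> connect (adj sat_graph) VO w.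
  case: w => [|v|v i|//|z] _; [exact: connect0 | exact: BO | exact: XO |].
  by apply: connect1; rewrite adj_sat.
have [/base//|] := boolP (base_vert u); case: u => // j c a _.
have q : connect (adj sat_graph) VO (gv j c 2) by apply/base/sndv_base.
have near n m : n < 13 -> m < 13 -> gate_adj n m -> connect (adj sat_graph) VO (gv j c n) ->
    connect (adj sat_graph) VO (gv j c m).
  by move=> n13 m13 nm /connect_trans; apply; apply/connect1/gv_adj.
have q5 := near 2 5 isT isT isT q; have q4 := near 5 4 isT isT isT q5.
rewrite private_gv; case: a => -[|[|[|[|[|[|[|[|[|[|a]]]]]]]]]] lt_a; last by [].
- exact: near 2 3 isT isT isT q.
- exact: (near 5 4 isT isT isT q5).
- exact: (near 2 5 isT isT isT q).
- exact: near 2 6 isT isT isT q.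
- exact: near 4 7 isT isT isT q4.
- exact: near 4 8 isT isT isT q4.
- exact: near 2 9 isT isT isT q.
- exact: near 2 10 isT isT isT q.
- exact: near 2 11 isT isT isT q.
- exact: near 2 12 isT isT isT q.
Qed.

Lemma satisfiable_wsat : satisfiable -> (wsat sat_graph K3).+1 = #|{: V}|.
Proof.
case=> tau /fin_all_exists[sel sel_sat].
apply: (@wsat_parent _ _ (tree_graph sel) VO (par sel)).
- exact: sat_connected.
- exact: tree_sub.
- exact: subxx.
- by move=> u v; apply: (@act_adj tau sel sel_sat).
Qed.

Theorem wsat_sat_graph : (wsat sat_graph K3).+1 = #|{: V}| <-> satisfiable.
Proof. by split; [exact: wsat_satisfiable | exact: satisfiable_wsat]. Qed.

End SatGraph.

(** * Structured programs for multitape machines *)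

Section Programs.

Variable k : nat.
Local Notation sym := (symbol unit).
Local Notation tapes := {ffun 'I_k.+1 -> tape unit}.
Local Notation reads := {ffun 'I_k.+1 -> sym}.
Local Notation acts := ('I_k.+1 -> sym * move).

(* A machine without output convention: [None] is the exit. *)
Record prog := Prog {
  pstate : finType;
  pstart : pstate;
  pstep : pstate -> reads -> option pstate * acts
}.

Definition tapes_read (c : tapes) : reads := [ffun i => read (c i)].
Definition tapes_act (a : acts) (c : tapes) : tapes :=
  [ffun i => shift (a i).2 (write (a i).1 (c i))].

Inductive reach (p : prog) : pstate p -> tapes -> nat -> tapes -> Prop :=
| ReachExit s c a : pstep s (tapes_read c) = (None, a) -> reach s c 1 (tapes_act a c)
| ReachStep s c s' a n c' :
    pstep s (tapes_read c) = (Some s', a) -> reach s' (tapes_act a c) n c' ->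
    reach s c n.+1 c'.

Definition runs p c n c' := reach (pstart p) c n c'.

Definition machine_of (p : prog) : machine :=
  @Machine (option (pstate p)) unit k (Some (pstart p)) (fun q => q == None)
    (fun q r => if q is Some s then pstep s r else (None, fun i => (None, Stay))).

Lemma machine_reach p s c n c' :
  reach s c n c' -> iter n (@step (machine_of p)) (Some s, c) = (None, c').
Proof.
elim=> {s c n c'} [s c a eq_a|s c s' a n c' eq_a _ IH].
  by rewrite /= /step /= eq_a.
by rewrite iterSr [step _](_ : _ = (Some s', tapes_act a c)) // /step /= eq_a.
Qed.

Definition idle (r : reads) : acts := fun i => (r i, Stay).

Definition pop (a : reads -> acts) : prog :=
  @Prog unit tt (fun _ r => (None, a r)).

Definition pseq (p q : prog) : prog :=
  @Prog (pstate p + pstate q)%type (inl (pstart p)) (fun s r =>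
    match s with
    | inl s => let: (s', a) := pstep s r in
        (Some (if s' is Some s' then inl s' else inr (pstart q)), a)
    | inr s => let: (s', a) := pstep s r in (omap inr s', a)
    end).

Definition pif (b : reads -> bool) (p q : prog) : prog :=
  @Prog (option (pstate p + pstate q)) None (fun s r =>
    match s with
    | None => (Some (Some (if b r then inl (pstart p) else inr (pstart q))), idle r)
    | Some (inl s) => let: (s', a) := pstep s r in (omap (Some \o inl) s', a)
    | Some (inr s) => let: (s', a) := pstep s r in (omap (Some \o inr) s', a)
    end).

Definition pwhile (b : reads -> bool) (p : prog) : prog :=
  @Prog (option (pstate p)) None (fun s r =>
    match s with
    | None => (if b r then Some (Some (pstart p)) else None, idle r)
    | Some s => let: (s', a) := pstep s r in (Some s', a)
    end).

(** Not the identity on lists: writing back a blank read beyond the end of a list stores it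
    explicitly. Tapes are therefore compared only through [nth] with the blank as default. *)
Definition tapes_idle (c : tapes) := tapes_act (idle (tapes_read c)) c.

Lemma runs_pop a c : runs (pop a) c 1 (tapes_act (a (tapes_read c)) c).
Proof. exact: ReachExit. Qed.

Lemma runs_pseq p q c1 n1 c2 n2 c3 :
  runs p c1 n1 c2 -> runs q c2 n2 c3 -> runs (pseq p q) c1 (n1 + n2) c3.
Proof.
move=> run1 run2; have reach2 : @reach (pseq p q) (inr (pstart q)) c2 n2 c3.
  elim: run2 => [s c a eq_a|s c s' a n c' eq_a _ IH].
    by apply: (@ReachExit (pseq p q)); rewrite /= eq_a.
  by apply: (@ReachStep (pseq p q) _ _ (inr s') (a)); rewrite //= eq_a.
rewrite /runs /=; elim: run1 reach2 => [s c a eq_a|s c s' a n c' eq_a _ IH] reach2.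
  by apply: (@ReachStep (pseq p q) _ _ (inr (pstart q)) (a)); rewrite //= eq_a.
by apply: (@ReachStep (pseq p q) _ _ (inl s') (a)); rewrite /= ?eq_a //; apply: IH.
Qed.

Lemma runs_pif (b : reads -> bool) p q c n c' :
    (if b (tapes_read c) then runs p (tapes_idle c) n c' else runs q (tapes_idle c) n c') ->
  runs (pif b p q) c n.+1 c'.
Proof.
case bc: (b _) => run.
  apply: (@ReachStep (pif b p q) _ _ (Some (inl (pstart p))) (idle (tapes_read c))).
    by rewrite /= bc.
  rewrite -/(tapes_idle c); elim: run => [s c1 a eq_a|s c1 s' a n1 c2 eq_a _ IH].
    by apply: (@ReachExit (pif b p q)); rewrite /= eq_a.
  by apply: (@ReachStep (pif b p q) _ _ (Some (inl s')) (a)); rewrite //= eq_a.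
apply: (@ReachStep (pif b p q) _ _ (Some (inr (pstart q))) (idle (tapes_read c))).
  by rewrite /= bc.
rewrite -/(tapes_idle c); elim: run => [s c1 a eq_a|s c1 s' a n1 c2 eq_a _ IH].
  by apply: (@ReachExit (pif b p q)); rewrite /= eq_a.
by apply: (@ReachStep (pif b p q) _ _ (Some (inr s')) (a)); rewrite //= eq_a.
Qed.

Lemma runs_pwhile0 (b : reads -> bool) p c :
  ~~ b (tapes_read c) -> runs (pwhile b p) c 1 (tapes_idle c).
Proof. by move=> bc; apply: (@ReachExit (pwhile b p)); rewrite /= (negPf bc). Qed.

Lemma runs_pwhileS (b : reads -> bool) p c n1 c' n2 c'' :
    b (tapes_read c) -> runs p (tapes_idle c) n1 c' -> runs (pwhile b p) c' n2 c'' ->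
  runs (pwhile b p) c (n1 + n2).+1 c''.
Proof.
move=> bc run1 run2.
apply: (@ReachStep (pwhile b p) _ _ (Some (pstart p)) (idle (tapes_read c))).
  by rewrite /= bc.
rewrite -/(tapes_idle c); elim: run1 run2 => [s c1 a eq_a|s c1 s' a n1' c2 eq_a _ IH] run2.
  by apply: (@ReachStep (pwhile b p) _ _ (None) (a)); rewrite //= eq_a.
by apply: (@ReachStep (pwhile b p) _ _ (Some s') (a)); rewrite /= ?eq_a //; apply: IH.
Qed.

End Programs.

(** * Unary counters and timed triples for counter programs *)

Section Registers.

Variable R : nat.
Local Notation sym := (symbol unit).
Local Notation tapes := {ffun 'I_R.+2 -> tape unit}.
Local Notation reads := {ffun 'I_R.+2 -> sym}.
Local Notation prog := (prog R.+1).

Definition mark : sym := Some (inr tt).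
Definition markf (i : nat) : sym := if i is 0 then mark else None.

(* A tape with cells numbered from 0, blank to the left of cell 0. *)
Definition tape_at (f : nat -> sym) (h : nat) (t : tape unit) :=
  (forall i, nth None t.1 i = if i < h then f (h - i.+1) else None) /\
  (forall i, nth None t.2 i = f (h + i)).

Definition upd (T : Type) (f : nat -> T) (r : nat) (v : T) x := if x == r then v else f x.

Lemma tape_at_read f h t : tape_at f h t -> read t = f h.
Proof. by case=> _ /(_ 0); rewrite nth0 addn0. Qed.

Lemma tape_at_write f h t a : tape_at f h t -> tape_at (upd f h a) h (write a t).
Proof.
case=> tL tR; split=> i /=.
  by rewrite tL; case: ifP => // lt_i; rewrite /upd ifN //; lia.
case: i => [|i] /=; first by rewrite addn0 /upd eqxx.
by rewrite nth_behead tR /upd ifN //; lia.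
Qed.

Lemma tape_at_right f h t : tape_at f h t -> tape_at f h.+1 (shift MoveRight t).
Proof.
case=> tL tR; split=> i /=; last by rewrite nth_behead tR addSnnS.
case: i => [|i] /=; first by rewrite subSS subn0 -nth0 tR addn0.
by rewrite tL ltnS subSS.
Qed.

Lemma tape_at_left f h t : tape_at f h.+1 t -> tape_at f h (shift MoveLeft t).
Proof.
case=> tL tR; split=> i /=; first by rewrite nth_behead tL ltnS subSS.
case: i => [|i] /=; first by rewrite -nth0 tL /= subSS subn0 addn0.
by rewrite tR addSnnS.
Qed.

Lemma tape_at_ext f f' h t : f =1 f' -> tape_at f h t -> tape_at f' h t.
Proof. by move=> eq_f [tL tR]; split=> i; rewrite ?tL ?tR ?eq_f. Qed.

Lemma upd_id (T : Type) (f : nat -> T) h : upd f h (f h) =1 f.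
Proof. by move=> i; rewrite /upd; case: eqP => // ->. Qed.

(* Tape 0 is only used by its right part: its cells to the left of the head
   stay blank. Tape 1 and the counters are numbered from 0, and the value of a
   counter is the distance of its head to the mark in cell 0. *)
Record store := Store {
  cells0 : nat -> sym;
  cells1 : nat -> sym;
  head1 : nat;
  regs : nat -> nat
}.

Definition rep (s : store) (c : tapes) :=
  [/\ forall i, nth None (c (inord 0)).1 i = None,
      forall i, nth None (c (inord 0)).2 i = cells0 s i,
      tape_at (cells1 s) (head1 s) (c (inord 1))
    & forall r, r < R -> tape_at markf (regs s r) (c (inord r.+2))].

(** Output grows to the left: [Emit0] writes a bit and moves left, so the last bit of the answer is
    emitted first. *)
Inductive act0 := Idle0 | Erase0 | Emit0 of bool.
Inductive act1 := Idle1 | Left1 | Right1 | Put1 of sym.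
Inductive actr := IdleR | IncR | DecR.

Definition sym_act0 a x : sym * move :=
  match a with
  | Idle0 => (x, Stay) | Erase0 => (None, MoveRight) | Emit0 b => (Some (inl b), MoveLeft)
  end.

Definition sym_act1 a x : sym * move :=
  match a with
  | Idle1 => (x, Stay) | Left1 => (x, MoveLeft) | Right1 => (x, MoveRight)
  | Put1 y => (y, MoveRight)
  end.

Definition sym_actr a (x : sym) : sym * move :=
  match a with IdleR => (x, Stay) | IncR => (x, MoveRight) | DecR => (x, MoveLeft) end.

Definition instr := (act0 * act1 * (nat -> actr))%type.

Definition instr_acts (a : instr) (r : reads) (i : 'I_R.+2) : sym * move :=
  match (i : nat) with
  | 0 => sym_act0 a.1.1 (r i)
  | 1 => sym_act1 a.1.2 (r i)
  | n.+2 => sym_actr (a.2 n) (r i)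
  end.

Definition instr_store (a : instr) (s : store) : store :=
  Store
    (match a.1.1 with
     | Idle0 => cells0 s
     | Erase0 => fun i => cells0 s i.+1
     | Emit0 b => fun i => match i with
                           | 0 => None | 1 => Some (inl b) | i'.+1 => cells0 s i' end
     end)
    (if a.1.2 is Put1 y then upd (cells1 s) (head1 s) y else cells1 s)
    (match a.1.2 with
     | Idle1 => head1 s | Left1 => (head1 s).-1 | Right1 | Put1 _ => (head1 s).+1 end)
    (fun r => match a.2 r with
              | IdleR => regs s r | IncR => (regs s r).+1 | DecR => (regs s r).-1 end).

Definition instr_ok (a : instr) (s : store) :=
  (if a.1.2 is Left1 then 0 < head1 s else true) /\
  forall r, r < R -> if a.2 r is DecR then 0 < regs s r else true.

Lemma rep_instr a s c : rep s c -> instr_ok a s ->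
  rep (instr_store a s) (tapes_act (instr_acts a (tapes_read c)) c).
Proof.
case: a => -[a0 a1] ar [c0L c0R c1 cr] [/= ok1 okr].
have read_i (i : 'I_R.+2) : (tapes_read c) i = read (c i) by rewrite ffunE.
have val0 : (inord 0 : 'I_R.+2) = 0 :> nat by rewrite inordK.
have val1 : (inord 1 : 'I_R.+2) = 1 :> nat by rewrite inordK.
split=> [i|i||r ltr]; rewrite ffunE /instr_acts ?val0 ?val1 ?inordK //= read_i.
- case: a0 => [||b] /=; rewrite ?nth_behead ?c0L //.
  by case: i => [|i] /=; rewrite ?c0L.
- have read0 : read (c (inord 0)) = cells0 s 0 by rewrite -c0R nth0.
  case: a0 => [||b] /=.
  + by case: i => [|i] /=; rewrite ?nth_behead ?c0R.
  + by rewrite nth_behead c0R.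
  by case: i => [|[|i]] //=; rewrite ?nth_behead ?c0R // -nth0 c0L.
- have rd1 := tape_at_read c1; have w1 := tape_at_write (read (c (inord 1))) c1.
  have {}w1 : tape_at (cells1 s) (head1 s) (write (read (c (inord 1))) (c (inord 1))).
    by apply: tape_at_ext w1; rewrite rd1; apply: upd_id.
  case: a1 ok1 => [||| y] ok1 //.
  + by apply: tape_at_left; rewrite /= prednK.
  + exact: tape_at_right.
  by apply/tape_at_right/tape_at_write.
- have cR := cr r ltr; have rdR := tape_at_read cR.
  have wR := tape_at_write (read (c (inord r.+2))) cR.
  have {}wR : tape_at markf (regs s r) (write (read (c (inord r.+2))) (c (inord r.+2))).
    by apply: tape_at_ext wR; rewrite rdR; apply: upd_id.
  have := okr r ltr; case: (ar r) => ok; [exact: wR | exact: tape_at_right |].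
  by apply: tape_at_left; rewrite prednK.
Qed.

Definition store_eq (s s' : store) :=
  [/\ cells0 s =1 cells0 s', cells1 s =1 cells1 s', head1 s = head1 s'
    & forall r, r < R -> regs s r = regs s' r].

Lemma rep_eq s s' c : store_eq s s' -> rep s c -> rep s' c.
Proof.
case=> e0 e1 eh er [c0L c0R c1 cr]; split=> // [i||r ltr].
- by rewrite -e0.
- by rewrite -eh; apply: tape_at_ext c1.
- by rewrite -er //; apply: cr.
Qed.

Definition instr_idle : instr := (Idle0, Idle1, fun=> IdleR).

Lemma rep_idle s c : rep s c -> rep s (tapes_idle c).
Proof.
move=> sc; have := @rep_instr instr_idle s c sc; rewrite /tapes_idle.
have -> : tapes_act (instr_acts instr_idle (tapes_read c)) c = tapes_act (idle (tapes_read c)) c.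
  by apply/ffunP=> i; rewrite !ffunE /instr_acts; case: (nat_of_ord i) => [|[]].
by case: s {sc} => ? ? ? ?; apply.
Qed.

Definition comp (p : prog) s n s' :=
  forall c, rep s c -> exists2 c', runs p c n c' & rep s' c'.

(** A total-correctness triple with a time bound. The exact number of steps is fixed before the
    tapes representing the store are chosen. *)
Definition tri p s s' n := exists2 m, m <= n & comp p s m s'.

Lemma tri_le p s s' n n' : n <= n' -> tri p s s' n -> tri p s s' n'.
Proof. by move=> le_n [m le_m]; exists m; rewrite // (leq_trans le_m). Qed.

Lemma tri_eqr p s s' s'' n : store_eq s' s'' -> tri p s s' n -> tri p s s'' n.
Proof.
by move=> eq_s [m le_m cp]; exists m => // c /cp[c' rc sc]; exists c' => //; apply: rep_eq sc.
Qed.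

Lemma tri_eql p s s' s'' n : store_eq s s' -> tri p s' s'' n -> tri p s s'' n.
Proof. by move=> eq_s [m le_m cp]; exists m => // c /(rep_eq eq_s)/cp. Qed.

Definition op (a : instr) : prog := pop (instr_acts a).

Lemma tri_op a s : instr_ok a s -> tri (op a) s (instr_store a s) 1.
Proof.
move=> ok; exists 1 => // c sc; eexists; first exact: runs_pop.
exact: rep_instr.
Qed.

Lemma tri_seq p q s1 s2 s3 n1 n2 :
  tri p s1 s2 n1 -> tri q s2 s3 n2 -> tri (pseq p q) s1 s3 (n1 + n2).
Proof.
move=> [m1 le1 cp1] [m2 le2 cp2]; exists (m1 + m2); first exact: leq_add.
move=> c1 /cp1[c2 run1 /cp2[c3 run2 sc3]]; exists c3 => //; exact: runs_pseq run1 run2.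
Qed.

Definition cond_is (b : reads -> bool) s v := forall c, rep s c -> b (tapes_read c) = v.

Lemma tri_if b v p q s s' n : cond_is b s v ->
  tri (if v then p else q) s s' n -> tri (pif b p q) s s' n.+1.
Proof.
move=> bv [m le_m cp]; exists m.+1 => // c sc.
have [c' run sc'] := cp _ (rep_idle sc); exists c' => //.
by apply: runs_pif; rewrite bv //; case: v run {bv cp}.
Qed.

Lemma tri_while0 b p s : cond_is b s false -> tri (pwhile b p) s s 1.
Proof.
move=> bv; exists 1 => // c sc; exists (tapes_idle c); last exact: rep_idle.
by apply: runs_pwhile0; rewrite bv.
Qed.

Lemma tri_whileS b p s s' s'' n1 n2 : cond_is b s true ->
  tri p s s' n1 -> tri (pwhile b p) s' s'' n2 -> tri (pwhile b p) s s'' (n1 + n2).+1.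
Proof.
move=> bv [m1 le1 cp1] [m2 le2 cp2]; exists (m1 + m2).+1; first by rewrite ltnS leq_add.
move=> c sc; have [c' run1 /cp2[c'' run2 sc'']] := cp1 _ (rep_idle sc).
by exists c'' => //; apply: runs_pwhileS run1 run2; apply: bv.
Qed.

Definition isz r (x : reads) := x (inord r.+2) == mark.
Definition isnz r (x : reads) := x (inord r.+2) != mark.

Lemma isz_cond r s : r < R -> cond_is (isz r) s (regs s r == 0).
Proof.
move=> ltr c [_ _ _ /(_ r ltr)/tape_at_read rdr]; rewrite /isz ffunE rdr.
by case: (regs s r).
Qed.

Lemma isnz_cond r s : r < R -> cond_is (isnz r) s (regs s r != 0).
Proof. by move=> ltr c sc; rewrite /isnz -/(isz r _) (isz_cond ltr sc). Qed.

Definition setr s f := Store (cells0 s) (cells1 s) (head1 s) f.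

Definition inc r := op (Idle0, Idle1, fun x => if x == r then IncR else IdleR).
Definition dec r := op (Idle0, Idle1, fun x => if x == r then DecR else IdleR).

Lemma tri_inc r s : tri (inc r) s (setr s (upd (regs s) r (regs s r).+1)) 1.
Proof.
apply: tri_eqr (tri_op _); last by split=> // x _; rewrite /=; case: eqP.
by split=> // x _; rewrite /= /upd; case: eqP => // ->.
Qed.

Lemma tri_dec r s : 0 < regs s r -> tri (dec r) s (setr s (upd (regs s) r (regs s r).-1)) 1.
Proof.
move=> r0; apply: tri_eqr (tri_op _); last by split=> // x _; rewrite /=; case: eqP => // ->.
by split=> // x _; rewrite /= /upd; case: eqP => // ->.
Qed.

Definition loop r p := pwhile (isnz r) (pseq (dec r) p).

(* [F n] is the store when [n] iterations remain. *)
Lemma tri_loop r p (F : nat -> store) n d : r < R ->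
    (forall i, i <= n -> regs (F i) r = i) ->
    (forall i, i < n -> tri p (setr (F i.+1) (upd (regs (F i.+1)) r i)) (F i) d) ->
  tri (loop r p) (F n) (F 0) (n * (d + 2) + 1).
Proof.
move=> ltr Fr; elim: n Fr => [|n IHn] Fr body.
  rewrite mul0n; apply: tri_while0; have := @isnz_cond r (F 0) ltr.
  by rewrite Fr.
have -> : n.+1 * (d + 2) + 1 = (1 + d + (n * (d + 2) + 1)).+1 by lia.
apply: tri_whileS (IHn _ _).
- by have := @isnz_cond r (F n.+1) ltr; rewrite Fr.
- apply: tri_seq (body n _) => //.
  by have := @tri_dec r (F n.+1); rewrite Fr //; apply.
- by move=> i le_i; apply: Fr; apply: leq_trans le_i _.
- by move=> i lt_i; apply: body; apply: leq_trans lt_i _.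
Qed.

End Registers.

(* Quantifier-free formulas whose variables are registers. [FBit a b] is the
   bit of the input at position [a - b] (truncated). *)
Inductive fm :=
| FLe of seq nat & nat & seq nat & nat
| FBit of nat & nat
| FNot of fm
| FAnd of fm & fm.

Definition lsum (f : nat -> nat) (l : seq nat) := sumn [seq f v | v <- l].

Fixpoint feval (w : seq bool) (f : nat -> nat) (phi : fm) : bool :=
  match phi with
  | FLe l1 c1 l2 c2 => lsum f l1 + c1 <= lsum f l2 + c2
  | FBit a b => nth false w (f a - f b)
  | FNot phi => ~~ feval w f phi
  | FAnd phi psi => feval w f phi && feval w f psi
  end.

(** * Compiling formulas, nested loops and polynomials to counter programs *)

Section Macros.

Variable R : nat.
Hypothesis R3 : 3 <= R.
Local Notation store := store.
Local Notation tri := (@tri R).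
Local Notation op := (@op R).
Local Notation inc := (@inc R).
Local Notation dec := (@dec R).
Local Notation loop := (@loop R).

Ltac regs_tac := split=> //= x _; rewrite /upd; repeat (case: eqP => ?); subst; lia.

Definition skip := op instr_idle.

Lemma tri_skip s : tri skip s s 1.
Proof.
have := @tri_op R instr_idle s; case: s => c0 c1 h r.
by apply; split.
Qed.

Definition clear r := loop r skip.

Lemma tri_clear r s : r < R ->
  tri (clear r) s (setr s (upd (regs s) r 0)) (3 * regs s r + 1).
Proof.
move=> ltr; have F i : regs (setr s (upd (regs s) r i)) r = i by rewrite /= /upd eqxx.
apply: (@tri_eql R _ _ (setr s (upd (regs s) r (regs s r)))); first by regs_tac.
apply: (@tri_le _ _ _ _ (regs s r * (1 + 2) + 1)); first by lia.
apply: (@tri_loop R _ _ (fun i => setr s (upd (regs s) r i))) => // i _.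
by apply: (tri_eqr _ (tri_skip _)); regs_tac.
Qed.

(** Emptying [a] is the only way to read it; register 2 keeps a copy from which it is restored. *)
Definition addto a d := pseq (loop a (pseq (inc d) (inc 2))) (loop 2 (inc a)).

Lemma tri_addto a d s : a < R -> a != 2 -> d != 2 -> a != d -> regs s 2 = 0 ->
  tri (addto a d) s (setr s (upd (regs s) d (regs s d + regs s a))) (7 * regs s a + 2).
Proof.
move=> ltR a2 d2 ad s2; set n := regs s a.
pose F i := setr s (fun x => if x == a then i else if x == d then regs s d + (n - i) else
                    if x == 2 then n - i else regs s x).
pose G i := setr s (fun x => if x == 2 then i else if x == a then n - i else
                    if x == d then regs s d + n else regs s x).
apply: (@tri_le _ _ _ _ (n * (2 + 2) + 1 + (n * (1 + 2) + 1))); first by lia.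
apply: (@tri_seq _ _ _ _ (F 0)).
  apply: (@tri_eql R _ _ (F n)); first by rewrite /F /n; regs_tac.
  apply: (@tri_loop R _ _ F) => // [i _|i lt_i]; first by rewrite /= eqxx.
  apply: (@tri_le _ _ _ _ (1 + 1)) => //.
  by apply: (tri_eqr _ (tri_seq (tri_inc _ _ _) (tri_inc _ _ _))); rewrite /F; regs_tac.
apply: (@tri_eql R _ _ (G n)); first by rewrite /F /G; regs_tac.
apply: (@tri_eqr _ _ _ (G 0)); first by rewrite /F /G /n; regs_tac.
apply: (@tri_loop R _ _ G) => // i lt_i.
by apply: (tri_eqr _ (tri_inc _ _ _)); rewrite /G; regs_tac.
Qed.

Definition incs c d := iter c (pseq (inc d)) skip.

Lemma tri_incs c d s : tri (incs c d) s (setr s (upd (regs s) d (regs s d + c))) (c + 1).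
Proof.
elim: c s => [|c IHc] s; first by apply: (tri_eqr _ (tri_skip _)); regs_tac.
apply: (tri_eqr _ (tri_seq (tri_inc _ d s) (IHc _))).
by regs_tac.
Qed.

Definition var_ok v := 3 <= v < R.

Definition sumto l c d := foldr (fun v => pseq (addto v d)) (incs c d) l.

Lemma tri_sumto l c d s b : all var_ok l -> d < 2 -> regs s 2 = 0 ->
    (forall v, var_ok v -> regs s v <= b) ->
  tri (sumto l c d) s (setr s (upd (regs s) d (regs s d + (lsum (regs s) l + c))))
      (size l * (7 * b + 2) + c + 1).
Proof.
elim: l s => [|v l IHl] s /=; first by move=> *; rewrite mul0n !add0n; apply: tri_incs.
case/andP=> v_ok l_ok d2 s2 le_b; have /andP[v3 vR] := v_ok.
rewrite mulSn -2!addnA; apply: tri_le (tri_eqr _ (tri_seq (tri_addto _ _ _ _ _) (IHl _ _ _ _ _))) => //; try lia.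
- have := le_b v v_ok; rewrite !addnA leq_add2r leq_add2r leq_add2r; lia.
- have -> : lsum (regs (setr s (upd (regs s) d (regs s d + regs s v)))) l = lsum (regs s) l.
    congr sumn; apply/eq_in_map => x xl; rewrite /= /upd ifN //.
    by have := allP l_ok x xl; rewrite /var_ok; lia.
  by rewrite /lsum /=; regs_tac.
- by rewrite /= /upd ifN //; lia.
- by move=> x x_ok; rewrite /= /upd ifN; [exact: le_b | move: x_ok; rewrite /var_ok; lia].
Qed.

Definition both01 (x : {ffun 'I_R.+2 -> symbol unit}) := isnz 0 x && isnz 1 x.
(** Leaves both truncated differences, so a test of register 0 for zero decides the comparison. *)
Definition cancel01 := pwhile both01 (pseq (dec 0) (dec 1)).

Lemma tri_cancel01 s :
  tri cancel01 s (setr s (upd (upd (regs s) 0 (regs s 0 - regs s 1)) 1 (regs s 1 - regs s 0)))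
      (3 * regs s 0 + 1).
Proof.
have cond t : cond_is both01 t ((regs t 0 != 0) && (regs t 1 != 0)).
  by move=> c tc; rewrite /both01 !(isnz_cond _ tc) //; lia.
move: {-1}(regs s 0) (erefl (regs s 0)) => n; elim: n s => [|n IHn] s s0.
  apply: (tri_eqr _ (tri_while0 _ _)); first by regs_tac.
  by move=> c sc; rewrite (cond s c sc) s0.
case s1: (regs s 1) => [|m].
  apply: (@tri_le _ _ _ _ 1) => //; apply: (tri_eqr _ (tri_while0 _ _)); first by regs_tac.
  by move=> c sc; rewrite (cond s c sc) s1 andbF.
pose s' := setr s (upd (upd (regs s) 0 n) 1 m).
apply: (@tri_le _ _ _ _ (1 + 1 + (3 * n + 1)).+1); first by lia.
apply: (@tri_whileS _ _ _ _ s').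
- by move=> c sc; rewrite (cond s c sc) s0 s1.
- apply: (tri_eqr _ (tri_seq (tri_dec _ _) (tri_dec _ _))); rewrite /s' /= ?s0 ?s1 //.
    by regs_tac.
  by rewrite /upd /= s1.
by apply: (tri_eqr _ (IHn s' _)); rewrite /s' //; regs_tac.
Qed.

Definition xleft := op (Idle0, Left1, fun=> IdleR).
Definition xright := op (Idle0, Right1, fun=> IdleR).
Definition xbit (x : {ffun 'I_R.+2 -> symbol unit}) := x (inord 1) == Some (inl true).

Definition seth s h := Store (cells0 s) (cells1 s) h (regs s).

Lemma tri_xleft s : 0 < head1 s -> tri xleft s (seth s (head1 s).-1) 1.
Proof. by move=> h0; apply: (tri_eqr _ (tri_op _)). Qed.

Lemma tri_xright s : tri xright s (seth s (head1 s).+1) 1.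
Proof. by apply: (tri_eqr _ (tri_op _)). Qed.

Lemma xbit_cond s : cond_is xbit s (cells1 s (head1 s) == Some (inl true)).
Proof. by move=> c [_ _ /tape_at_read rd1 _]; rewrite /xbit ffunE rd1. Qed.

Fixpoint fm_ok phi := match phi with
  | FLe l1 _ l2 _ => all var_ok l1 && all var_ok l2
  | FBit a b => var_ok a && var_ok b
  | FNot phi => fm_ok phi
  | FAnd phi psi => fm_ok phi && fm_ok psi
  end.

(** Branches into one of two continuations, so negation swaps them, conjunction nests them and no
    truth value has to be stored. The scratch registers and the head of tape 1 are restored before
    the continuation starts. *)
Fixpoint test phi (p q : prog R.+1) : prog R.+1 := match phi with
  | FLe l1 c1 l2 c2 =>
      pseq (sumto l1 c1 0) (pseq (sumto l2 c2 1) (pseq cancel01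
        (pif (@isz R 0) (pseq (clear 1) p) (pseq (clear 0) q))))
  | FBit a b =>
      pseq (addto a 0) (pseq (addto b 1) (pseq cancel01 (pseq (clear 1)
        (pseq (loop 0 (pseq xright (inc 1)))
          (pif xbit (pseq (loop 1 xleft) p) (pseq (loop 1 xleft) q))))))
  | FNot phi => test phi q p
  | FAnd phi psi => test phi (test psi p q) q
  end.

Fixpoint fcost b phi := match phi with
  | FLe l1 c1 l2 c2 => 20 * ((size l1 + size l2 + 1) * (7 * b + 2) + c1 + c2 + 1)
  | FBit a b' => 60 * (b + 1)
  | FNot phi => fcost b phi
  | FAnd phi psi => fcost b phi + fcost b psi
  end.

Variable w : seq bool.

Definition store_ok b s :=
  [/\ forall r, r < 3 -> regs s r = 0, forall v, var_ok v -> regs s v <= b, head1 s = 1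
    & forall i, (cells1 s i.+1 == Some (inl true)) = nth false w i].

Lemma lsum_le f l b : (forall v, var_ok v -> f v <= b) -> all var_ok l ->
  lsum f l <= size l * b.
Proof.
move=> le_b; elim: l => //= v l IHl /andP[v_ok l_ok].
by rewrite mulSn /lsum /= leq_add ?le_b ?IHl.
Qed.

Lemma tri_test b phi p q s s' n : fm_ok phi -> store_ok b s ->
    tri (if feval w (regs s) phi then p else q) s s' n ->
  tri (test phi p q) s s' (fcost b phi + n).
Proof.
move=> phi_ok s_ok; have [s012 le_b h1 bits] := s_ok.
have [s0 s1 s2] : [/\ regs s 0 = 0, regs s 1 = 0 & regs s 2 = 0] by rewrite !s012.
have R0 : 0 < R by lia. have R1 : 1 < R by lia.
elim: phi p q s' n phi_ok => [l1 c1 l2 c2|a a'|phi IHphi|phi IHphi psi IHpsi] p q s' n /= phi_ok tri_pq.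
- have /andP[l1_ok l2_ok] := phi_ok.
  set f := regs s in tri_pq *; set m1 := lsum f l1 + c1; set m2 := lsum f l2 + c2.
  pose t1 := setr s (upd f 0 m1); pose t2 := setr s (upd (upd f 0 m1) 1 m2).
  pose t3 := setr s (upd (upd f 0 (m1 - m2)) 1 (m2 - m1)).
  have le1 : m1 <= size l1 * b + c1 by rewrite leq_add2r lsum_le.
  have le2 : m2 <= size l2 * b + c2 by rewrite leq_add2r lsum_le.
  have tri1 : tri (sumto l1 c1 0) s t1 (size l1 * (7 * b + 2) + c1 + 1).
    apply: (tri_eqr _ (@tri_sumto _ c1 0 s b l1_ok _ _ _)) => //.
    by rewrite s0 add0n.
  have tri2 : tri (sumto l2 c2 1) t1 t2 (size l2 * (7 * b + 2) + c2 + 1).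
    apply: (tri_eqr _ (@tri_sumto _ c2 1 t1 b l2_ok _ _ _)) => //.
      have -> : lsum (regs t1) l2 = lsum f l2.
        congr sumn; apply/eq_in_map => x xl; rewrite /= /upd ifN //.
        by have := allP l2_ok x xl; rewrite /var_ok; lia.
      by rewrite /t2 /t1 /m2 /f; regs_tac.
    by move=> v v_ok; rewrite /= /upd ifN; [exact: le_b | move: v_ok; rewrite /var_ok; lia].
  have tri3 : tri cancel01 t2 t3 (3 * m1 + 1).
    by apply: (tri_eqr _ (tri_cancel01 t2)); rewrite /t3 /t2; regs_tac.
  have z3 : cond_is (@isz R 0) t3 (m1 <= m2).
    by move=> c tc; rewrite (isz_cond R0 tc) /= /upd /= subn_eq0.
  apply: (@tri_le _ _ _ _ ((size l1 * (7 * b + 2) + c1 + 1) + ((size l2 * (7 * b + 2) + c2 + 1) +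
     ((3 * m1 + 1) + ((3 * (m1 + m2) + 1) + n).+1)))); first by nia.
  apply: (tri_seq tri1 (tri_seq tri2 (tri_seq tri3 _))); apply: (tri_if z3).
  case: leqP tri_pq => cmp tri_pq.
    apply: (@tri_seq _ _ _ _ s) tri_pq.
    apply: (@tri_le _ _ _ _ (3 * (m2 - m1) + 1)); first by lia.
    apply: (tri_eqr _ (tri_clear t3 R1)).
    by rewrite /t3 /f; regs_tac.
  apply: (@tri_seq _ _ _ _ s) tri_pq.
  apply: (@tri_le _ _ _ _ (3 * (m1 - m2) + 1)); first by lia.
  apply: (tri_eqr _ (tri_clear t3 R0)).
  by rewrite /t3 /f; regs_tac.
- have /andP[a_ok a'_ok] := phi_ok; have [la la'] := (le_b _ a_ok, le_b _ a'_ok).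
  have /andP[a3 aR] := a_ok; have /andP[a'3 a'R] := a'_ok.
  set f := regs s in tri_pq la la' *.
  pose t1 := setr s (upd f 0 (f a)); pose t2 := setr s (upd (upd f 0 (f a)) 1 (f a')).
  pose t3 := setr s (upd (upd f 0 (f a - f a')) 1 (f a' - f a)).
  pose d := f a - f a'.
  (* With [i] steps to the right remaining, register 1 records the steps already made, so that [G]
     can bring the head back. *)
  pose F i := seth (setr s (upd (upd f 0 i) 1 (d - i))) (1 + (d - i)).
  pose G i := seth (setr s (upd f 1 i)) (1 + i).
  have tri1 : tri (addto a 0) s t1 (7 * f a + 2).
    apply: (tri_eqr _ (tri_addto _ _ _ _ _)) => //; try lia.
    by rewrite s0 add0n.
  have tri2 : tri (addto a' 1) t1 t2 (7 * f a' + 2).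
    have -> : f a' = regs t1 a' by rewrite /= /upd ifN //; lia.
    apply: (tri_eqr _ (tri_addto _ _ _ _ _)) => //; try lia.
    by rewrite /t1 /t2 /f; regs_tac.
  have tri3 : tri cancel01 t2 t3 (3 * f a + 1).
    by apply: (tri_eqr _ (tri_cancel01 t2)); rewrite /t3 /t2; regs_tac.
  have tri4 : tri (clear 1) t3 (F d) (3 * b + 1).
    apply: (@tri_le _ _ _ _ (3 * (f a' - f a) + 1)); first by lia.
    apply: (tri_eqr _ (tri_clear t3 R1)); rewrite /F /t3 subnn /seth /=.
    by regs_tac.
  have tri5 : tri (loop 0 (pseq xright (inc 1))) (F d) (F 0) (b * (2 + 2) + 1).
    apply: (@tri_le _ _ _ _ (d * (2 + 2) + 1)); first by rewrite /d; lia.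
    apply: (@tri_loop R _ _ F) => // i lt_i.
    apply: (@tri_le _ _ _ _ (1 + 1)) => //.
    apply: (tri_eqr _ (tri_seq (tri_xright _) (tri_inc _ _ _))); rewrite /F; split=> //=; first by lia.
    by move=> x _; rewrite /upd; repeat (case: eqP => ?); subst; lia.
  have FG : store_eq R (F 0) (G d).
    by rewrite /F /G /f subn0; regs_tac.
  have tri6 : tri (loop 1 xleft) (F 0) s (b * (1 + 2) + 1).
    apply: (@tri_le _ _ _ _ (d * (1 + 2) + 1)); first by rewrite /d; lia.
    apply: (@tri_eql R _ _ _ _ _ FG); apply: (@tri_eqr R _ _ (G 0)).
      by rewrite /G /f; regs_tac.
    apply: (@tri_loop R _ _ G) => // i lt_i.
    apply: (tri_eqr _ (tri_xleft _)) => //; rewrite /G /f.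
    by regs_tac.
  have bitF : cond_is xbit (F 0) (nth false w d).
    by move=> c tc; rewrite (xbit_cond tc) /F /= subn0 add1n bits.
  apply: (@tri_le _ _ _ _ ((7 * f a + 2) + ((7 * f a' + 2) + ((3 * f a + 1) + ((3 * b + 1) +
     ((b * (2 + 2) + 1) + ((b * (1 + 2) + 1) + n).+1)))))); first by lia.
  apply: (tri_seq tri1 (tri_seq tri2 (tri_seq tri3 (tri_seq tri4 (tri_seq tri5 _))))).
  apply: (tri_if bitF); rewrite /d.
  by case: (nth _ _ _) tri_pq => tri_pq; apply: (tri_seq tri6).
- by apply: IHphi => //; case: (feval w (regs s) phi) tri_pq.
have /andP[phi_ok' psi_ok] := phi_ok.
rewrite -addnA; apply: IHphi => //; case: (feval w (regs s) phi) tri_pq => /= tri_pq.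
  exact: IHpsi.
by apply: tri_le tri_pq; apply: leq_addl.
Qed.

(** While printing, the head rests on the blank just left of the output; this blank is cell 0. *)
Definition outf (l : seq bool) i : symbol unit :=
  if i is i'.+1 then nth None [seq Some (inl b) | b <- l] i' else None.

Definition seto s l := Store (outf l) (cells1 s) (head1 s) (regs s).

Definition emit b := op (Emit0 b, Idle1, fun=> IdleR).

Lemma tri_emit b s l : tri (emit b) (seto s l) (seto s (b :: l)) 1.
Proof. by apply: (tri_eqr _ (tri_op _)); split=> //= -[|[|i]]. Qed.

Section Output.

Variables (phi : fm) (bnd : nat).
Hypotheses (phi_ok : fm_ok phi) (bnd_ok : var_ok bnd).

(** The loops count down and visit the assignments in reverse lexicographic order. As the output
    grows to the left, it ends up in lexicographic order. *)
Fixpoint gen d m := match d with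
  | 0 => test phi (emit true) (emit false)
  | d'.+1 => pseq (addto bnd m) (loop m (gen d' m.+1))
  end.

(* The values of [phi] for all assignments to the registers m, ..., m + d - 1
   of numbers less than b, in lexicographic order. *)
Fixpoint outs b d m f := match d with
  | 0 => [:: feval w f phi]
  | d'.+1 => flatten [seq outs b d' m.+1 (upd f m i) | i <- iota 0 b]
  end.

Fixpoint gcost b d := match d with
  | 0 => fcost b phi + 1
  | d'.+1 => 7 * b + 2 + (b * (gcost b d' + 2) + 1)
  end.

Lemma tri_gen d m s l b : bnd < m -> m + d <= R -> store_ok b s -> regs s bnd = b ->
    (forall r, m <= r < R -> regs s r = 0) ->
  tri (gen d m) (seto s l) (seto s (outs b d m (regs s) ++ l)) (gcost b d).
Proof.
have /andP[bnd3 bndR] := bnd_ok.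
elim: d m s l => [|d IHd] m s l lt_m le_R s_ok sb s0.
  apply: (@tri_test b) => //.
  by rewrite /=; case: (feval _ _ _); apply: tri_emit.
have mR : m < R by lia.
pose outi i := flatten [seq outs b d m.+1 (upd (regs s) m j) | j <- iota i (b - i)] ++ l.
pose F i := seto (setr s (upd (regs s) m i)) (outi i).
rewrite [gen _ _]/= [gcost _ _]/=.
apply: (@tri_seq _ _ _ _ (F b)).
  apply: (@tri_le _ _ _ _ (7 * regs (seto s l) bnd + 2)); first by rewrite /= sb.
  apply: (tri_eqr _ (tri_addto _ _ _ _ _)) => //=; try lia.
    rewrite /F /outi subnn /=; split=> //= x _; rewrite /upd; case: eqP => // ?.
    by rewrite s0 ?leqnn ?mR // sb.
  by case: s_ok => + _ _ _; apply.
apply: (@tri_eqr _ _ _ (F 0)).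
  rewrite /F /outi subn0; split=> //= x _; rewrite /upd; case: eqP => // ->.
  by rewrite s0 ?leqnn ?mR.
apply: (@tri_loop R _ _ F) => // [i _|i lt_i]; first by rewrite /F /= /upd eqxx.
have outiS : outi i = outs b d m.+1 (upd (regs s) m i) ++ outi i.+1.
  by rewrite /outi -subnSK //= catA.
rewrite /F outiS; pose s' := setr s (upd (regs s) m i).
apply: (@tri_eql R _ _ (seto s' (outi i.+1))).
  by split=> //= x _; rewrite /upd; case: eqP.
apply: (IHd m.+1 s') => //; try lia.
- case: s_ok => s012 le_b h1 bits; split=> //= r r_ok; rewrite /upd.
    by rewrite ifN ?s012 //; lia.
  by case: eqP => _; [exact: ltnW | exact: le_b].
- by rewrite /s' /= /upd ifN //; lia.
- by move=> r r_ok; rewrite /s' /= /upd ifN ?s0 //; lia.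
Qed.

End Output.

Section PolynomialValue.

(** Horner's scheme: register 3 holds the argument, and the partial value moves to register 0 to
    control the multiplication by repeated addition. *)
Fixpoint polyto (cs : seq nat) d := match cs with
  | [::] => skip
  | a :: cs' => pseq (polyto cs' d) (pseq (loop d (inc 0))
                  (pseq (loop 0 (addto 3 d)) (incs a d)))
  end.

Fixpoint pcost n (cs : seq nat) := match cs with
  | [::] => 1
  | a :: cs' => pcost n cs' + (3 * horner_rec cs' n + 1 +
                 (horner_rec cs' n * (7 * n + 4) + 1 + (a + 1)))
  end.

Lemma tri_polyto cs d s : 3 < d < R -> regs s 0 = 0 -> regs s 2 = 0 -> regs s d = 0 ->
  tri (polyto cs d) s (setr s (upd (regs s) d (horner_rec cs (regs s 3))))
      (pcost (regs s 3) cs).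
Proof.
move=> /andP[d3 dR] s0 s2 sd; have R0 : 0 < R by lia. set n := regs s 3.
elim: cs => [|a cs IHcs].
  by apply: (tri_eqr _ (tri_skip _)); split=> //= x _; rewrite /upd; case: eqP => // ->.
set v := horner_rec cs n in IHcs *.
have eq_v : horner_rec (a :: cs) n = v * n + a by [].
rewrite eq_v [pcost _ _]/= -/v [polyto _ _]/=.
pose F i := setr s (upd (upd (regs s) 0 (v - i)) d i).
pose G i := setr s (upd (upd (regs s) 0 i) d ((v - i) * n)).
apply: (tri_seq IHcs); apply: (@tri_seq _ _ _ _ (G v)).
  apply: (@tri_le _ _ _ _ (v * (1 + 2) + 1)); first by lia.
  apply: (@tri_eql R _ _ (F v)); first by rewrite /F subnn; regs_tac.
  apply: (@tri_eqr R _ _ (F 0)); first by rewrite /F /G subnn subn0 mul0n; regs_tac.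
  apply: (@tri_loop R _ _ F) => // [i _|i lt_i]; first by rewrite /= /upd eqxx.
  by apply: (tri_eqr _ (tri_inc _ _ _)); rewrite /F; regs_tac.
apply: (@tri_seq _ _ _ _ (G 0)).
  apply: (@tri_le _ _ _ _ (v * ((7 * n + 2) + 2) + 1)); first by lia.
  apply: (@tri_loop R _ _ G) => // [i _|i lt_i]; first by rewrite /= /upd ifN ?eqxx //; lia.
  set t := setr _ _; have tn : regs t 3 = n by rewrite /t /G /= /upd !ifN //; lia.
  rewrite -tn; apply: (tri_eqr _ (tri_addto _ _ _ _ _)) => //; try lia.
    rewrite tn /t /G; split=> //= x _; rewrite /upd.
    repeat (case: eqP => ?); subst; try lia.
    by rewrite -(subnSK lt_i) mulSn addnC.
  by rewrite /t /G /= /upd !ifN //; lia.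
apply: (tri_eqr _ (tri_incs _ _ _)); rewrite /G subn0; split=> //= x _; rewrite /upd.
by repeat (case: eqP => ?); subst; lia.
Qed.

End PolynomialValue.

End Macros.

(** * Polynomial time bounds and the printing machine *)

Definition poly_bounded (f : nat -> nat) := exists p : {poly nat}, forall n, f n <= (p.[n])%R.

Lemma poly_bounded_horner (p : {poly nat}) : poly_bounded (fun n => (p.[n])%R).
Proof. by exists p. Qed.

Lemma poly_bounded_const c : poly_bounded (fun=> c).
Proof. by exists (polyC c) => n; rewrite hornerC. Qed.

Lemma poly_bounded_id : poly_bounded id.
Proof. by exists 'X%R => n; rewrite hornerX. Qed.

Lemma poly_bounded_add f g :
  poly_bounded f -> poly_bounded g -> poly_bounded (fun n => f n + g n).
Proof.
move=> [p le_p] [q le_q]; exists (p + q)%R => n; rewrite hornerD.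
exact: leq_add.
Qed.

Lemma poly_bounded_mul f g :
  poly_bounded f -> poly_bounded g -> poly_bounded (fun n => f n * g n).
Proof.
move=> [p le_p] [q le_q]; exists (p * q)%R => n; rewrite hornerM.
exact: leq_mul.
Qed.

Ltac poly_bound := repeat first
  [ apply: poly_bounded_const | apply: poly_bounded_id | apply: poly_bounded_horner
  | assumption | apply: poly_bounded_add | apply: poly_bounded_mul ].

Lemma poly_bounded_pcost cs : poly_bounded (fun n => pcost n cs).
Proof.
elim: cs => [|a cs IHcs] /=; first by poly_bound.
have H : poly_bounded (fun n => horner_rec cs n).
  elim: cs {IHcs} => [|a' cs IHcs] /=; first by poly_bound.
  by apply: poly_bounded_add; poly_bound.
by poly_bound.
Qed.

Lemma poly_bounded_fcost f phi : poly_bounded f -> poly_bounded (fun n => fcost (f n) phi).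
Proof. by move=> bf; elim: phi => [l1 c1 l2 c2|a b|phi IH|phi IH psi IH'] /=; poly_bound. Qed.

Lemma poly_bounded_gcost f phi d : poly_bounded f -> poly_bounded (fun n => gcost phi (f n) d).
Proof.
move=> bf; have bphi := poly_bounded_fcost phi bf.
by elim: d => [|d IHd] /=; poly_bound.
Qed.

(* The input tape holds the prefix of [encode_pair x y] given by [x]. *)
Definition dbl (x : seq bool) := flatten [seq [:: true; b] | b <- x].

Section Driver.

Variables (ps : seq {poly nat}) (d b : nat) (phi : fm).
Let R := 4 + size ps + d.
Hypotheses (b_ok : 3 < b < 4 + size ps) (phi_ok : fm_ok R phi).
Local Notation bnd N := ((nth 0 ps (b - 4)).[N])%R.
(** The bound of the loops also dominates the input length and all parameters, so that it can serve
    as the register bound in [store_ok]. *)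
Hypothesis le_bnd : forall N, N <= bnd N.
Hypothesis ps_le_bnd : forall N i, ((nth 0 ps i).[N])%R <= bnd N.

Local Notation tri := (@tri R).
Local Notation op := (@op R).
Local Notation reads := {ffun 'I_R.+2 -> symbol unit}.

Lemma R3 : 3 <= R. Proof. by rewrite /R; lia. Qed.

Definition inpf (x : seq bool) i : symbol unit := nth None [seq Some (inl b) | b <- x] i.
Definition xf (w : seq bool) i : symbol unit := if i is i'.+1 then inpf w i' else mark.

Definition copy_store x w n := Store (inpf x) (xf w) (size w).+1 (upd (fun=> 0) 3 n).

Definition copy_bit v :=
  op (Erase0, Put1 (Some (inl v)), fun x => if x == 3 then IncR else IdleR).

(** Consumes the input, which leaves tape 0 blank for the output, puts the doubled bits on tape 1
    and counts the input length in register 3. *)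
Definition copy := pwhile (fun r : reads => r (inord 0) != None)
  (pseq (op (Idle0, Put1 (Some (inl true)), fun=> IdleR))
    (pif (fun r : reads => r (inord 0) == Some (inl true)) (copy_bit true) (copy_bit false))).

Lemma cells0_cond (P : symbol unit -> bool) s :
  cond_is (fun r : reads => P (r (inord 0))) s (P (cells0 s 0)).
Proof. by move=> c [_ /(_ 0) c0 _ _]; rewrite ffunE /read -nth0 c0. Qed.

Lemma cells1_cond (P : symbol unit -> bool) s :
  cond_is (fun r : reads => P (r (inord 1))) s (P (cells1 s (head1 s))).
Proof. by move=> c [_ _ /tape_at_read rd1 _]; rewrite ffunE rd1. Qed.

Lemma xf_rcons w v : upd (xf w) (size w).+1 (Some (inl v)) =1 xf (rcons w v).
Proof.
case=> [|i] //; rewrite /upd /= eqSS /inpf map_rcons nth_rcons size_map.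
by case: ltngtP => // lt_i; rewrite nth_default // size_map ltnW.
Qed.

Lemma tri_copy x w n :
  tri copy (copy_store x w n) (copy_store [::] (w ++ dbl x) (n + size x)) (size x * 4 + 1).
Proof.
elim: x w n => [|v x IHx] w n.
  rewrite cats0 addn0; apply: tri_while0.
  exact: (@cells0_cond (fun a => a != None) (copy_store [::] w n)).
have -> : w ++ dbl (v :: x) = rcons (rcons w true) v ++ dbl x by rewrite -!cats1 -!catA.
rewrite [size (v :: x)]/= -(addSnnS n); apply: (@tri_le _ _ _ _ (1 + 2 + (size x * 4 + 1)).+1).
  by lia.
apply: tri_whileS (IHx _ _).
  exact: (@cells0_cond (fun a => a != None) (copy_store (v :: x) w n)).
pose s' := Store (inpf (v :: x)) (xf (rcons w true)) (size w).+2 (upd (fun=> 0) 3 n).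
apply: (@tri_seq _ _ _ _ s').
  apply: (tri_eqr _ (tri_op _)); last by split.
  by split=> //= i; exact: xf_rcons.
apply: (@tri_if _ _ v).
  have eq_v : (Some (inl v) == Some (inl true) :> symbol unit) = v by case: (v).
  rewrite -[X in cond_is _ _ X]eq_v.
  exact: (@cells0_cond (fun a => a == Some (inl true)) s').
have -> : (if v then copy_bit true else copy_bit false) = copy_bit v by case: (v).
apply: (tri_eqr _ (tri_op _)); last by split=> // r _ /=; case: eqP.
split=> [i|i||r _] /=; rewrite ?size_rcons //.
  by rewrite -xf_rcons size_rcons.
by rewrite /upd; case: eqP => // _.
Qed.

Definition rewind := pwhile (fun r : reads => r (inord 1) != mark) (xleft R).

Lemma inpf_neq_mark w i : inpf w i != mark.
Proof.
rewrite /inpf; have [lt_i|le_i] := ltnP i (size w); last by rewrite nth_default ?size_map.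
by rewrite (nth_map false).
Qed.

Lemma tri_rewind w s h : cells1 s =1 xf w ->
  tri rewind (seth s h) (seth s 0) (h * 2 + 1).
Proof.
move=> s1; elim: h => [|h IHh].
  apply: tri_while0; have := @cells1_cond (fun a => a != mark) (seth s 0).
  by rewrite /= s1.
apply: (@tri_le _ _ _ _ (1 + (h * 2 + 1)).+1); first by lia.
apply: tri_whileS IHh.
  have := @cells1_cond (fun a => a != mark) (seth s h.+1).
  by rewrite /= s1 /= inpf_neq_mark.
exact: (@tri_xleft R (seth s h.+1)).
Qed.

Fixpoint polysto (qs : seq {poly nat}) r := match qs with
  | [::] => skip R
  | q :: qs' => pseq (polyto R q r) (polysto qs' r.+1)
  end.

Fixpoint pscost n (qs : seq {poly nat}) :=
  if qs is q :: qs' then pcost n q + pscost n qs' else 1.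

Lemma tri_polysto qs r s : 3 < r -> r + size qs <= R -> regs s 0 = 0 -> regs s 2 = 0 ->
    (forall x, r <= x < R -> regs s x = 0) ->
  tri (polysto qs r)
      s (setr s (fun x => if r <= x < r + size qs then ((nth 0 qs (x - r)).[regs s 3])%R
                          else regs s x))
      (pscost (regs s 3) qs).
Proof.
elim: qs r s => [|q qs IHqs] r s r3 le_R s0 s2 sr /=.
  apply: (tri_eqr _ (tri_skip R s)); split=> //= x _.
  by rewrite ifN //; lia.
rewrite /= in le_R; have tri1 : tri (polyto R q r) s (setr s (upd (regs s) r (q.[regs s 3])%R)) (pcost (regs s 3) q).
  by apply: tri_polyto => //; [lia | apply: sr; lia].
apply: (tri_seq tri1); set s' := setr s _ in tri1 *.
have s'3 : regs s' 3 = regs s 3 by rewrite /s' /= /upd ifN //; lia.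
apply: (@tri_le _ _ _ _ (pscost (regs s' 3) qs)); first by rewrite s'3.
apply: (tri_eqr _ (IHqs r.+1 s' _ _ _ _ _)); try lia.
- rewrite s'3; split=> //= x xR; rewrite /upd; case: (x =P r) => [->|ne_x].
    by rewrite ltnn /= subnn leqnn /= ifT //; lia.
  rewrite addSnnS; case: (ltnP r x) => lt_x /=.
    by rewrite (ltnW lt_x) -(subnSK lt_x).
  by rewrite ifN //; lia.
- by rewrite /s' /= /upd ifN //; lia.
- by rewrite /s' /= /upd ifN //; lia.
- by move=> x x_ok; rewrite /s' /= /upd ifN ?sr //; lia.
Qed.

Definition init_acts (r : reads) (i : 'I_R.+2) : symbol unit * move :=
  match (i : nat) with 0 => (r i, Stay) | 1 => (mark, MoveRight) | _ => (mark, Stay) end.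

(** The final instruction moves from the blank left of the output onto its first bit, where [output]
    starts reading. *)
Definition driver : prog R.+1 :=
  pseq (pop init_acts) (pseq copy (pseq rewind (pseq (xright R) (pseq (polysto ps 4)
    (pseq (gen R phi b d (4 + size ps)) (op (Erase0, Idle1, fun=> IdleR))))))).

Definition params N x :=
  if x == 3 then N else if 4 <= x < 4 + size ps then ((nth 0 ps (x - 4)).[N])%R else 0.

Definition driver_out x :=
  outs (dbl x) phi (bnd (size x)) d (4 + size ps) (params (size x)).

Definition driver_cost n :=
  n * 4 + 1 + ((n * 2).+1 * 2 + 1 + (1 + (pscost n ps + (gcost phi (bnd n) d + 1)))).

Lemma size_dbl x : size (dbl x) = size x * 2.
Proof. by elim: x => //= v x IHx; rewrite IHx mulSn. Qed.

Lemma poly_bounded_cost : poly_bounded (fun n => 1 + driver_cost n).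
Proof.
have Hps : poly_bounded (fun n => pscost n ps).
  elim: (ps) => [|q qs IHqs] /=; first exact: poly_bounded_const.
  exact: poly_bounded_add (poly_bounded_pcost _) IHqs.
have Hg : poly_bounded (fun n => gcost phi (bnd n) d).
  exact/poly_bounded_gcost/poly_bounded_horner.
have Hn : poly_bounded (fun n => (n * 2).+1).
  have : poly_bounded (fun n => 1 + n * 2) by poly_bound.
  by [].
by rewrite /driver_cost; poly_bound.
Qed.

Lemma tri_driver x : exists2 s, forall i, cells0 s i = inpf (driver_out x) i &
  tri (pseq copy (pseq rewind (pseq (xright R) (pseq (polysto ps 4)
    (pseq (gen R phi b d (4 + size ps)) (op (Erase0, Idle1, fun=> IdleR)))))))
    (copy_store x [::] 0) s (driver_cost (size x)).
Proof.
set n := size x; pose w := dbl x.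
pose s1 := copy_store [::] w n; pose s2 := seth s1 0; pose s3 := seth s1 1.
pose s4 := setr (seto s3 [::]) (params n).
pose s5 := seto s4 (driver_out x ++ [::]).
exists (instr_store (Erase0, Idle1, fun=> IdleR) s5); first by rewrite /= cats0.
apply: (@tri_seq _ _ _ _ s1); first exact: (tri_copy x [::] 0).
apply: (@tri_seq _ _ _ _ s2).
  apply: (@tri_le _ _ _ _ ((size w).+1 * 2 + 1)); first by rewrite size_dbl.
  by apply: (@tri_rewind w s1).
apply: (@tri_seq _ _ _ _ s3); first exact: (@tri_xright R s2).
apply: (@tri_seq _ _ _ _ s4).
  apply: (tri_eqr _ (@tri_polysto ps 4 s3 _ _ _ _ _)) => //; try by rewrite /R; lia.
    split=> //= [|r rR]; first by case=> //= i; rewrite /inpf nth_nil.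
    rewrite /params; case: (r =P 3) => [->|r3] //.
    by case: ifP => // _; rewrite /upd; case: eqP.
  by move=> r r_ok; rewrite /= /upd ifN //; lia.
apply: (@tri_seq _ _ _ _ s5); last by apply: tri_op; split.
apply: (@tri_eql R _ _ (seto s4 [::])); first by split.
have params_le v : params n v <= bnd n.
  by rewrite /params; case: ifP => // _; case: ifP => // _; exact: le_bnd.
have b3 : (b == 3) = false by lia.
apply: tri_gen => //.
- by rewrite /var_ok /R; lia.
- by lia.
- split=> [r r3|v _||i] //=; first by rewrite /params !ifN //; lia.
  rewrite -/w /inpf; have [lt_i|le_i] := ltnP i (size w).
    by rewrite (nth_map false) //; case: (nth _ _ _).
  by rewrite !nth_default ?size_map.
- by rewrite /= /params b3 ifT.
- by move=> r r_ok; rewrite /= /params !ifN //; lia.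
Qed.

Lemma leading_bitsE (W : finType) (l : seq (symbol W)) y :
  (forall i, nth None l i = nth None [seq Some (inl b) | b <- y] i) -> leading_bits l = y.
Proof.
elim: y l => [|v y IHy] [|a l] eq_l //=.
- by have := eq_l 0; case: a {eq_l}.
- by have := eq_l 0.
have := eq_l 0 => /= ->; congr cons; apply: IHy => i; exact: (eq_l i.+1).
Qed.

Lemma rep_init x c : c = (init (machine_of driver) x).2 ->
  rep (copy_store x [::] 0) (tapes_act (init_acts (tapes_read c)) c).
Proof.
move=> def_c.
have val0 : (inord 0 : 'I_R.+2) = 0 :> nat by rewrite inordK.
have val1 : (inord 1 : 'I_R.+2) = 1 :> nat by rewrite inordK.
have c0 : c (inord 0) = ([::], [seq Some (inl b) | b <- x]).
  by rewrite def_c ffunE -val_eqE /= val0.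
have c1 (i : 'I_R.+2) : i != 0 :> nat -> c i = ([::], [::]).
  by move=> i0; rewrite def_c ffunE -val_eqE /= (negPf i0).
split=> [i|i||r rR]; rewrite ffunE /init_acts ?val0 ?val1 ?inordK //= ?ffunE.
- by rewrite c0 /= nth_nil.
- by rewrite c0 /inpf; case: x {def_c c0 c1} => [|v x] //=; case: i => [|[]].
- rewrite c1 ?val1 //; split=> i /=; first by case: i => [|[]].
  by rewrite nth_nil /= /inpf nth_nil.
have -> : upd (fun=> 0) 3 0 r = 0 by rewrite /upd; case: eqP.
rewrite c1 ?inordK //; split=> i /=; first by rewrite nth_nil.
by case: i => [|[]].
Qed.

Theorem polytime_driver : polytime driver_out.
Proof.
have [p le_p] := poly_bounded_cost; exists (machine_of driver), p => x.
have [s s0 [m le_m comp_m]] := tri_driver x.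
have [c' run_c' rep_c'] := comp_m _ (rep_init (erefl (init (machine_of driver) x).2)).
have run := machine_reach (runs_pseq (runs_pop _ _) run_c').
have halted n (c : config (machine_of driver)) : halting c.1 -> iter n (@step _) c = c.
  by move=> hc; elim: n => //= n ->; rewrite /step hc.
set n := (p.[size x])%R; have le_n : 1 + m <= n.
  by apply: leq_trans (le_p _); rewrite leq_add2l.
have -> : iter n (@step _) (init (machine_of driver) x) = (None, c').
  rewrite -(subnK le_n) iterD -[RHS](halted (n - (1 + m))) //; congr (iter _ _ _).
  exact: run.
split=> //; rewrite /output /=; apply: leading_bitsE => i.
have -> : (ord0 : 'I_R.+2) = inord 0 by apply: val_inj; rewrite /= inordK.
by case: rep_c' => _ -> _ _; apply: s0.
Qed.

End Driver.

(** * Computations of the verifier as a formula with five literals per clause *)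

Section Tableau.

Variable M : machine.

Definition column := {ffun 'I_(ntapes M).+1 -> symbol (work M)}.

(* State, contents of one cell of every tape, and whether this cell is the one
   under the heads. *)
Definition letter : finType := (state M * column * bool)%type.

(** The heads stay over one cell and the tapes move instead. The new letter of a cell depends on the
    letter [g0] under the heads and on the letters [g1], [g2], [g3] at the cell and its two
    neighbours. *)
Definition letter_rule (g0 g1 g2 g3 : letter) : letter :=
  if halting g0.1.1 then g2 else
  let: (q, act) := delta g0.1.1 g0.1.2 in
  let wr (g : letter) i := if g.2 then (act i).1 else g.1.2 i in
  (q, [ffun i => match (act i).2 with
                 | MoveLeft => wr g1 i | Stay => wr g2 i | MoveRight => wr g3 i end],
   g2.2).

(* Cell [W] is the one under the head. *)
Definition cellz (W : nat) (t : tape (work M)) e :=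
  if W <= e then nth None t.2 (e - W) else nth None t.1 (W - e).-1.

Definition letter_at W (c : config M) e : letter :=
  (c.1, [ffun i => cellz W (c.2 i) e], e == W).

Lemma cellz_write W a t e : cellz W (write a t) e = if e == W then a else cellz W t e.
Proof.
rewrite /cellz /=; case: (ltngtP W e) => [lt_e|//|->]; last by rewrite subnn.
by rewrite -(subnSK lt_e) /= nth_behead.
Qed.

Lemma cellz_right W t e : cellz W (shift MoveRight t) e = cellz W t e.+1.
Proof.
rewrite /cellz /=; have [le_e|lt_e] := leqP W e.
  by rewrite (leqW le_e) nth_behead subSn.
rewrite leq_eqVlt; case: eqP => [->|ne] /=; first by rewrite subSnn subnn /= nth0.
have lt_e1 : e.+1 < W by lia.
rewrite ltnNge lt_e /= -(subnSK lt_e1) (_ : (W - e).-1 = (W - e.+2).+1) //; lia.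
Qed.

Lemma cellz_left W t e : cellz W (shift MoveLeft t) e.+1 = cellz W t e.
Proof.
rewrite /cellz /=; have [le_e|lt_e] := leqP W e.
  by rewrite (leqW le_e) subSn.
rewrite leq_eqVlt; case: eqP => [->|ne] /=; first by rewrite subSnn subnn /= nth0.
have lt_e1 : e.+1 < W by lia.
rewrite ltnNge lt_e /= nth_behead; congr nth; lia.
Qed.

Lemma step_letter W c e :
  letter_at W (step c) e.+1 =
  letter_rule (letter_at W c W) (letter_at W c e) (letter_at W c e.+1) (letter_at W c e.+2).
Proof.
rewrite /letter_rule /step /=; case: ifP => // _.
have -> : [ffun i => cellz W (c.2 i) W] = [ffun i => read (c.2 i)].
  by apply/ffunP=> i; rewrite !ffunE /cellz leqnn subnn /read nth0.
case: (delta _ _) => q act; congr (_, _, _).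
apply/ffunP=> i; rewrite !ffunE; case: (act i).2.
- by rewrite cellz_left cellz_write.
- by rewrite /= cellz_write.
- by rewrite cellz_right cellz_write.
Qed.

Section Clauses.

Variables (T P N : nat) (w : seq bool).

(** Closing the tapes up to a ring corrupts cells from both ends inwards, one cell per step. With
    [T.+1] cells on either side, the cells [center] and [center.+1], which decide acceptance, are
    still correct after [T] steps. *)
Definition center := T.+1.
Definition width := center.*2.+1.

Definition blank_col (a : symbol (work M)) : column :=
  [ffun i => if i == ord0 then a else None].
Definition init_letter a (b : bool) : letter := (start M, blank_col a, b).

(* The clauses: transition rule, initial cell, blanks after the witness form a
   final segment, accepting output. *)
Definition tag : finType := (letter * letter * letter * letter + bool + letter)%type.

(* The local data on which the literals of the clauses at (t, e) depend. *)
Record region := Region {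
  at_start : bool; at_center : bool; after_center : bool; right_half : bool;
  in_input : bool; in_witness : bool; input_bit : bool; at_end : bool
}.

Definition region_at t e := Region (t == 0) (e == center) (e == center.+1) (center <= e)
  (e <= center + N.*2) (e <= center + N.*2 + P) (nth false w (e - center)) (t.+1 == T).

(** The flag [g.2] separates the two cells that determine the output: the one under the head must
    hold the bit true, the one to its right must end the output. *)
Definition bad_letter (g : letter) :=
  let a := g.1.2 ord0 in
  if g.2 then a != Some (inl true) else if a is Some (inl _) then true else false.

Definition lit_next (tg : tag) (k : nat) : bool :=
  match tg with inl (inl _) => k == 4 | inl (inr _) => false | inr _ => true end.

Inductive place := Center | Before | Here | After.

Definition lit_place (tg : tag) (k : nat) : place :=
  match tg with
  | inl (inl _) => match k with 0 => Center | 1 => Before | 3 => After | _ => Here end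
  | inl (inr false) => Here
  | inl (inr true) => if k == 0 then Here else After
  | inr _ => Here
  end.

(** Constant from 2 on: off the first row the literals 2 and 3 have the same letter and opposite
    signs, which makes the clause valid there. *)
Definition witness_symbol (k : nat) : symbol (work M) :=
  match k with 0 => None | 1 => Some (inl false) | _ => Some (inl true) end.

Definition lit_letter (tg : tag) (k : nat) (r : region) : letter :=
  match tg with
  | inl (inl (g0, g1, g2, g3)) =>
      match k with 0 => g0 | 1 => g1 | 2 => g2 | 3 => g3 | _ => letter_rule g0 g1 g2 g3 end
  | inl (inr false) =>
      init_letter (if right_half r then
                     if in_input r then Some (inl (input_bit r))
                     else if in_witness r then witness_symbol k else None
                   else None) (at_center r)
  | inl (inr true) => init_letter None false
  | inr g => g
  end.

(* At cells where a constraint does not apply, two of the literals of its clause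
   are complementary. *)
Definition lit_sign (tg : tag) (k : nat) (r : region) : bool :=
  match tg with
  | inl (inl _) => k == 4
  | inl (inr false) => at_start r || (k == 2)
  | inl (inr true) =>
      if [&& at_start r, right_half r & ~~ in_input r] then k != 0 else k == 1
  | inr g =>
      ~~ [&& at_end r, at_center r || after_center r & bad_letter g] && (k == 0)
  end.

Definition lit_time (b : bool) (t : 'I_T) : 'I_T.+1 :=
  if b then lift ord0 t else widen_ord (leqnSn T) t.

Lemma val_lit_time b t : lit_time b t = b + t :> nat.
Proof. by case: b. Qed.

Definition center_ord : 'I_width := inord center.

Lemma val_center : center_ord = center :> nat.
Proof. by rewrite inordK // /width -addnn; lia. Qed.

Lemma val_ordS_width (e : 'I_width) : ordS e = (if e.+1 == width then 0 else e.+1) :> nat.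
Proof.
rewrite /=; case: eqP => [->|ne]; first by rewrite modnn.
by rewrite modn_small //; have := ltn_ord e; lia.
Qed.

Lemma val_ord_pred_width (e : 'I_width) : ord_pred e = (if e == 0 :> nat then width.-1 else e.-1) :> nat.
Proof.
rewrite /=; case: eqP => [->|ne]; first by rewrite modn_small.
have -> : (e + width).-1 = e.-1 + width by lia.
by rewrite modnDr modn_small //; have := ltn_ord e; lia.
Qed.

Definition place_ord (p : place) (e : 'I_width) : 'I_width :=
  match p with Center => center_ord | Before => ord_pred e | Here => e | After => ordS e end.

Definition tvar (j : tag * 'I_T * 'I_width) (k : nat) : 'I_T.+1 * 'I_width * letter :=
  (lit_time (lit_next j.1.1 k) j.1.2, place_ord (lit_place j.1.1 k) j.2,
   lit_letter j.1.1 k (region_at j.1.2 j.2)).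

Definition tsgn (j : tag * 'I_T * 'I_width) (k : nat) :=
  lit_sign j.1.1 k (region_at j.1.2 j.2).

(** Truth only travels forward: clauses force the letters of the first row, then of each next row,
    and finally exclude bad letters. Hence a cell with several true letters needs no exclusion. *)
Definition tableau_sat := exists tau : 'I_T.+1 * 'I_width * letter -> bool,
  forall j, exists k : 'I_5, tau (tvar j k) = tsgn j k.

Hypothesis T_gt0 : 0 < T.
Hypothesis size_w : size w = N.*2.
Hypothesis le_T : N.*2 + P < T.

Definition word y := w ++ false :: y.

Lemma accepting_letters (c : config M) :
  (output c == [:: true]) =
  ~~ bad_letter (letter_at center c center) && ~~ bad_letter (letter_at center c center.+1).
Proof.
rewrite /output /bad_letter /= !ffunE /cellz leqnn leqnSn subnn subSnn eqxx gtn_eqF //=.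
by case: (c.2 ord0).2 => [|[[[]|b]|] [|[[b'|b']|] r]].
Qed.

Lemma init_letter_at z e : letter_at center (init M z) e =
  init_letter (if center <= e then nth None [seq Some (inl b) | b <- z] (e - center) else None)
    (e == center).
Proof.
congr (_, _, _); apply/ffunP=> i; rewrite !ffunE /cellz.
by case: eqP => // _; case: ifP; rewrite ?nth_nil.
Qed.

Fixpoint ring (r0 : 'I_width -> letter) t e := match t with
  | 0 => r0 e
  | t'.+1 => letter_rule (ring r0 t' center_ord) (ring r0 t' (ord_pred e))
               (ring r0 t' e) (ring r0 t' (ordS e))
  end.

Definition row0 z (e : 'I_width) := letter_at center (init M z) e.

Lemma ring_iter z t (e : 'I_width) : t <= e <= center.*2 - t -> t <= center ->
  ring (row0 z) t e = letter_at center (iter t (@step M) (init M z)) e.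
Proof.
elim: t e => // t IHt e /andP[lt_e le_e] lt_t; rewrite [LHS]/=.
have le_cw : center.*2.+1 = width by [].
have predE : (ord_pred e).+1 = e.
  by rewrite val_ord_pred_width; case: eqP => e0; lia.
have succE : ordS e = e.+1 :> nat.
  by rewrite val_ordS_width; case: eqP => // eS; lia.
rewrite !IHt ?val_center ?succE; try lia.
by rewrite -predE step_letter predE.
Qed.

Lemma ring_final z (e : 'I_width) : center <= e <= center.+1 ->
  ring (row0 z) T e = letter_at center (iter T (@step M) (init M z)) e.
Proof. by move=> e_ok; apply: ring_iter; rewrite /center in e_ok *; lia. Qed.

Lemma row0E z (e : 'I_width) : row0 z e =
  init_letter (if center <= e then nth None [seq Some (inl b) | b <- z] (e - center) else None)
    (e == center :> nat).
Proof. exact: init_letter_at. Qed.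

Lemma init_letter_inj a b a' b' : init_letter a b = init_letter a' b' -> a = a' /\ b = b'.
Proof.
by case=> /ffunP/(_ ord0); rewrite !ffunE eqxx.
Qed.

Lemma size_word y : size (word y) = N.*2.+1 + size y.
Proof. by rewrite size_cat /= size_w addSnnS. Qed.

Lemma nth_word_None y i i' : i <= i' ->
  nth None [seq Some (inl b) : symbol (work M) | b <- word y] i = None ->
  nth None [seq Some (inl b) : symbol (work M) | b <- word y] i' = None.
Proof.
move=> le_i; have [lt_i|le_s _] := ltnP i (size (word y)); first by rewrite (nth_map false).
by rewrite nth_default // size_map; lia.
Qed.

(** At [i = N.*2] the default value [false] of [nth] coincides with the delimiter of the encoded
    pair. *)
Lemma nth_word_input y i : i <= N.*2 ->
  nth None [seq Some (inl b) : symbol (work M) | b <- word y] i = Some (inl (nth false w i)).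
Proof.
move=> le_i; rewrite (nth_map false) ?size_word ?ltn_addr //; congr (Some (inl _)).
rewrite nth_cat; case: ltnP => // le_w.
have -> : i = size w by apply/eqP; rewrite eqn_leq le_w size_w le_i.
by rewrite subnn [RHS]nth_default.
Qed.

Lemma nth_word_witness y i : N.*2 < i ->
  nth None [seq Some (inl b) : symbol (work M) | b <- word y] i =
  nth None [seq Some (inl b) : symbol (work M) | b <- y] (i - N.*2.+1).
Proof.
move=> lt_i; rewrite /word map_cat nth_cat size_map size_w ltnNge (ltnW lt_i) /=.
by rewrite -(subnSK lt_i).
Qed.

Lemma sat_of_witness y : size y <= P ->
  output (iter T (@step M) (init M (word y))) = [:: true] -> tableau_sat.
Proof.
move=> le_y /eqP; rewrite accepting_letters => /andP[ok0 ok1].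
exists (fun v : 'I_T.+1 * 'I_width * letter => ring (row0 (word y)) v.1.1 v.1.2 == v.2) => -[[tg t] e].
suff /existsP[k /eqP kP] : [exists k : 'I_5, (ring (row0 (word y)) (tvar (tg, t, e) k).1.1
   (tvar (tg, t, e) k).1.2 == (tvar (tg, t, e) k).2) == tsgn (tg, t, e) k] by exists k.
apply: contraT => /existsPn unsat.
have {}unsat k (lt_k : k < 5) := unsat (Ordinal lt_k).
have u0 := unsat 0 isT; have u1 := unsat 1 isT; have u2 := unsat 2 isT.
have u3 := unsat 3 isT; have u4 := unsat 4 isT.
case: tg u0 u1 u2 u3 u4 {unsat} => [[[[[g0 g1] g2] g3]|[]]|g] u0 u1 u2 u3 u4.
- move: u0 u1 u2 u3 u4; rewrite /tvar /tsgn /= !eqbF_neg !negbK => /eqP e0 /eqP e1 /eqP e2 /eqP e3.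
  by rewrite /bump /= !add0n e0 e1 e2 e3 !eqxx.
- move: u0 u1 u2 {u3 u4}; rewrite /tvar /tsgn /=.
  (* Where the constraint does not apply, the literals 1 and 2 are complementary. *)
  case: ifP => [/and3P[/eqP t0 le_e gt_e]|_]; last by rewrite !(eqxx, eqbF_neg, eqb_id, negbK) => _ /negPf->.
  rewrite /= t0 /= !eqbF_neg !negbK eqb_id !row0E => /eqP/init_letter_inj[nth_e e_c] /negP[].
  apply/eqP; congr init_letter.
    case: ifP => // le_e'; rewrite le_e in nth_e; apply: nth_word_None _ nth_e.
    have := val_ordS_width e; case: eqP => [_ e0|_ ->]; last by lia.
    by rewrite e0 in le_e'.
  apply/negP=> /eqP e_c'; have := val_ordS_width e.
  by rewrite e_c'; case: eqP => _ //; lia.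
- move: u0 u1 u2 u3 {u4}; rewrite /tvar /tsgn /=.
  case t0: (t == 0 :> nat); move/eqP: t0 => t0; rewrite /=; last first.
    by rewrite !(eqxx, eqbF_neg, eqb_id, negbK) => _ _ /negPf->.
  rewrite t0 /= !eqb_id row0E => u0 u1 u2 _; move: u0 u1 u2.
  case: ifP => le_e; last by rewrite eqxx.
  case: (leqP e (center + N.*2)) => [le_in|gt_in].
    by rewrite nth_word_input ?eqxx //; lia.
  case: (leqP e (center + N.*2 + P)) => [le_wit|gt_wit]; last first.
    by rewrite nth_default ?eqxx // size_map /word size_cat /= size_w; lia.
  rewrite nth_word_witness; last by lia.
  have [lt_i|le_i] := ltnP (e - center - N.*2.+1) (size y).
    by rewrite (nth_map false) //; case: (nth _ _ _); rewrite eqxx.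
  by rewrite nth_default ?size_map // eqxx.
move: u0 u1 {u2 u3 u4}; rewrite /tvar /tsgn /=.
case: and3P => [[/eqP t_end e_c bad_g]|_] /=; last by rewrite eqb_id eqbF_neg => /negPf->.
rewrite /= eqbF_neg negbK => /eqP eq_g _.
have {}eq_g : ring (row0 (word y)) T e = g by rewrite -[X in ring _ X]t_end; exact: eq_g.
rewrite ring_final in eq_g; last by case/orP: e_c => /eqP->; rewrite leqnn ?leqnSn.
by move: bad_g; rewrite -eq_g; case/orP: e_c => /eqP->; rewrite (negPf ok0, negPf ok1).
Qed.

(* The witness is read off the first row up to the first blank. *)
Lemma witness_of_sat : tableau_sat ->
  exists2 y, size y <= P & output (iter T (@step M) (init M (word y))) = [:: true].
Proof.
case=> tau tauP.
pose t0 : 'I_T := Ordinal T_gt0.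
have init_time : widen_ord (leqnSn T) t0 = ord0 by apply: val_inj.
pose pos i : 'I_width := inord (center + N.*2.+1 + i).
have val_pos i : i <= P -> pos i = center + N.*2.+1 + i :> nat.
  by move=> le_i; rewrite inordK // /width /center -addnn; lia.
pose blank i := tau (ord0, pos i, init_letter None false).
pose len := find blank (iota 0 P).
pose y := [seq tau (ord0, pos i, init_letter (Some (inl true)) false) | i <- iota 0 len].
have le_len : len <= P by rewrite -[X in _ <= X](size_iota 0) find_size.
have size_y : size y = len by rewrite size_map size_iota.
exists y; first by rewrite size_y.
have row0_sat (e : 'I_width) : tau (ord0, e, row0 (word y) e).
  have [k] := tauP (inl (inr false), t0, e); rewrite /tvar /tsgn /= init_time row0E.
  case: ifP => [le_e|_] //.
  case: (leqP e (center + N.*2)) => [le_in|gt_in].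
    by rewrite nth_word_input //; lia.
  case: (leqP e (center + N.*2 + P)) => [le_wit|gt_wit]; last first.
    by rewrite nth_default ?size_map /word ?size_cat /= ?size_w ?size_y; lia.
  rewrite nth_word_witness; last by lia.
  set i := e - center - N.*2.+1; have iP : i < P by rewrite /i; lia.
  have e_pos : e = pos i by apply: val_inj; rewrite /= val_pos /i; lia.
  have e_c : (e == center :> nat) = false by lia.
  rewrite e_c => tau_k; have [lt_i|le_i] := ltnP i (size y).
    rewrite (nth_map false) //; move: lt_i; rewrite size_y => lt_i.
    have := before_find 0 lt_i; rewrite nth_iota // add0n /blank -e_pos => nb.
    rewrite /y (nth_map 0) ?size_iota // nth_iota // add0n -e_pos.
    case tt: (tau (ord0, e, init_letter (Some (inl true)) false)) => //.
    by move: tau_k; case: (nat_of_ord k) => [|[|k']] /=; rewrite ?nb ?tt.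
  rewrite nth_default; last by rewrite size_map.
  have {}le_i : len <= i by rewrite -size_y.
  have has_b : has blank (iota 0 P) by rewrite has_find size_iota -/len; lia.
  have blank_len : blank len by have := nth_find 0 has_b; rewrite -/len nth_iota ?add0n //; lia.
  (* The first blank spreads to the right by the clauses [inl (inr true)]; without them a cell
     beyond it might be true for a bit only. *)
  suff blankP n : len <= n < P -> blank n by rewrite e_pos; apply: blankP; rewrite le_i.
  elim: n => [|n IHn]; first by rewrite leqn0 => /andP[/eqP<-].
  rewrite leq_eqVlt => /andP[/orP[/eqP<-//|lt_n] lt_nP].
  have blank_n : blank n by apply: IHn; lia.
  have [k'] := tauP (inl (inr true), t0, pos n); rewrite /tvar /tsgn /= init_time val_pos; last by lia.
  have -> : (center <= center + N.*2.+1 + n) && ~~ (center + N.*2.+1 + n <= center + N.*2) by lia.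
  have posS : ordS (pos n) = pos n.+1.
    apply: ord_inj; rewrite val_ordS_width !val_pos; try lia.
    by rewrite /width /center -addnn; case: eqP; lia.
  case: (k' == 0 :> nat); first by rewrite [LHS]blank_n.
  by rewrite /= posS.
have ring_sat t (le_t : t <= T) (e : 'I_width) : tau (inord t, e, ring (row0 (word y)) t e).
  elim: t le_t e => [|t IHt] lt_t e.
    by rewrite (_ : inord 0 = ord0) //; apply: val_inj; rewrite /= inordK.
  set r := ring (row0 (word y)) t in IHt *.
  have [k] := tauP (inl (inl (r center_ord, r (ord_pred e), r e, r (ordS e))), Ordinal lt_t, e).
  have time0 : widen_ord (leqnSn T) (Ordinal lt_t) = inord t by apply: val_inj; rewrite /= inordK // ltnW.
  have time1 : lift ord0 (Ordinal lt_t) = inord t.+1 by apply: val_inj; rewrite /= inordK.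
  rewrite /tvar /tsgn /=; have := ltn_ord k; have IH := IHt (ltnW lt_t).
  by case: (nat_of_ord k) => [|[|[|[|[|k']]]]] //= _; rewrite ?time0 ?time1 // IH.
have fin_sat (e : 'I_width) : (e == center :> nat) || (e == center.+1 :> nat) ->
    ~~ bad_letter (letter_at center (iter T (@step M) (init M (word y))) e).
  move=> e_ok; apply/negP=> bad_e; have lt_T : T.-1 < T by rewrite prednK.
  have [k] := tauP (inr (letter_at center (iter T (@step M) (init M (word y))) e), Ordinal lt_T, e).
  rewrite /tvar /tsgn /= prednK // eqxx e_ok bad_e /=.
  have -> : lift ord0 (Ordinal lt_T) = inord T by apply: val_inj; rewrite /= /bump add1n prednK // inordK.
  rewrite -ring_final ?ring_sat //.
  by case/orP: e_ok => /eqP->; rewrite leqnn ?leqnSn.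
apply/eqP; rewrite accepting_letters.
have c1 : (inord center.+1 : 'I_width) = center.+1 :> nat by rewrite inordK // /width /center -addnn; lia.
have := fin_sat center_ord; rewrite val_center eqxx => -> //=.
by have := fin_sat (inord center.+1); rewrite c1 eqxx orbT => ->.
Qed.

Theorem tableau_satP : tableau_sat <->
  exists2 y, size y <= P & output (iter T (@step M) (init M (word y))) = [:: true].
Proof. by split=> [/witness_of_sat//|[y]]; apply: sat_of_witness. Qed.

End Clauses.

End Tableau.

(** * Quantifier-free definability over registers *)

Section Definability.

Variable R : nat.

Definition linear (A : (nat -> nat) -> nat) :=
  exists l c, all (var_ok R) l /\ forall f, A f = lsum f l + c.

Lemma linear_var v : var_ok R v -> linear (fun f => f v).
Proof. by move=> v_ok; exists [:: v], 0; rewrite /= v_ok /lsum; split=> // f /=; rewrite !addn0. Qed.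

Lemma linear_const c : linear (fun _ => c).
Proof. by exists [::], c. Qed.

Lemma linear_add A A' : linear A -> linear A' -> linear (fun f => A f + A' f).
Proof.
move=> [l [c [l_ok AE]]] [l' [c' [l_ok' AE']]]; exists (l ++ l'), (c + c').
rewrite all_cat l_ok; split=> // f; rewrite AE AE' /lsum map_cat sumn_cat; lia.
Qed.

Lemma linear_succ A : linear A -> linear (fun f => (A f).+1).
Proof.
move=> [l [c [l_ok AE]]]; exists l, c.+1; split=> // f; rewrite AE; lia.
Qed.

Lemma linear_mul c A : linear A -> linear (fun f => c * A f).
Proof.
move=> linA; elim: c => [|c IHc].
  by case: (linear_const 0) => l [c [l_ok E]]; exists l, c.
by case: (linear_add linA IHc) => l [c' [l_ok E]]; exists l, c'; split=> // f; rewrite -E mulSn.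
Qed.

Lemma linear_double A : linear A -> linear (fun f => (A f).*2).
Proof.
by case/(linear_mul 2) => l [c [l_ok E]]; exists l, c; split=> // f; rewrite -mul2n.
Qed.

Definition definable (F : seq bool -> (nat -> nat) -> bool) :=
  exists phi, fm_ok R phi /\ forall w f, feval w f phi = F w f.

Lemma definable_le A A' : linear A -> linear A' -> definable (fun _ f => A f <= A' f).
Proof.
move=> [l [c [l_ok AE]]] [l' [c' [l_ok' AE']]]; exists (FLe l c l' c') => /=.
by rewrite l_ok; split=> // w f; rewrite AE AE'.
Qed.

Lemma definable_bit a b : var_ok R a -> var_ok R b ->
  definable (fun w f => nth false w (f a - f b)).
Proof. by move=> a_ok b_ok; exists (FBit a b); rewrite /= a_ok. Qed.

Lemma definable_not F : definable F -> definable (fun w f => ~~ F w f).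
Proof. by case=> phi [ok E]; exists (FNot phi); split=> // w f; rewrite /= E. Qed.

Lemma definable_and F F' : definable F -> definable F' -> definable (fun w f => F w f && F' w f).
Proof.
case=> phi [ok E] [phi' [ok' E']]; exists (FAnd phi phi').
by rewrite /= ok; split=> // w f; rewrite E E'.
Qed.

Lemma definable_ext F F' : (forall w f, F w f = F' w f) -> definable F -> definable F'.
Proof. by move=> eqF [phi [ok E]]; exists phi; split=> // w f; rewrite E. Qed.

Lemma definable_or F F' : definable F -> definable F' -> definable (fun w f => F w f || F' w f).
Proof.
move=> dF dF'; apply: definable_ext (definable_not (definable_and (definable_not dF) (definable_not dF'))).
by move=> w f; rewrite negb_and !negbK.
Qed.

Lemma definable_eq A A' : linear A -> linear A' -> definable (fun _ f => A f == A' f).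
Proof.
move=> lA lA'; apply: definable_ext (definable_and (definable_le lA lA') (definable_le lA' lA)).
by move=> _ f; rewrite -eqn_leq.
Qed.

Lemma definable_const b : definable (fun _ _ => b).
Proof.
by apply: definable_ext (definable_eq (linear_const b) (linear_const 1)) => _ _; case: b.
Qed.

(** Replaces a defined Boolean by a constant. Applied to each field of a region, it turns terms such
    as [lit_letter tg k r] into fixed data, so that they need no formula. *)
Lemma definable_case (F : bool -> seq bool -> (nat -> nat) -> bool) c :
  definable c -> (forall b, definable (F b)) -> definable (fun w f => F (c w f) w f).
Proof.
move=> dc dF; apply: definable_ext
  (definable_or (definable_and dc (dF true)) (definable_and (definable_not dc) (dF false))).
by move=> w f; case: (c w f); rewrite ?orbF.
Qed.

Lemma definable_if c F F' : definable c -> definable F -> definable F' ->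
  definable (fun w f => if c w f then F w f else F' w f).
Proof.
move=> dc dF dF'.
by apply: (definable_case (F := fun b w f => if b then F w f else F' w f)) => // -[].
Qed.

Definition some (T : finType) (F : T -> bool) := has F (enum T).

Lemma someP (T : finType) (F : T -> bool) : reflect (exists x, F x) (some F).
Proof.
by apply: (iffP hasP) => [[x _]|[x]] Fx; exists x; rewrite // mem_enum.
Qed.

Lemma definable_some (T : finType) (F : T -> seq bool -> (nat -> nat) -> bool) :
  (forall x, definable (F x)) -> definable (fun w f => some (fun x => F x w f)).
Proof.
move=> dF; rewrite /some; elim: (enum T) => [|x s IHs] /=; first exact: definable_const.
exact: definable_or.
Qed.

End Definability.

Definition quad := (nat * nat * nat * nat)%type.

(** Listed in the order in which four nested loops run. *)
Definition quads b : seq quad :=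
  [seq (x, i) | x <- [seq (y, e) | y <- [seq (a, t) | a <- iota 0 b, t <- iota 0 b],
                                   e <- iota 0 b], i <- iota 0 b].

Lemma mem_quads b (q : quad) :
  (q \in quads b) = [&& q.1.1.1 < b, q.1.1.2 < b, q.1.2 < b & q.2 < b].
Proof.
case: q => [[[a t] e] i] /=; apply/allpairsP/and4P => /= [[[x i']]|[]].
  move=> /= [/allpairsP[[y e'] /= [/allpairsP[[a' t'] /= [+ + ->] + ->]] + [-> -> -> ->]]].
  by rewrite !mem_iota.
move=> *; exists ((a, t, e), i); rewrite mem_iota; split=> //.
apply/allpairsP; exists ((a, t), e); rewrite mem_iota; split=> //.
by apply/allpairsP; exists (a, t); rewrite !mem_iota.
Qed.

Lemma quads_uniq b : uniq (quads b).
Proof.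
have pair_uniq (T T' : eqType) (s : seq T) (s' : seq T') :
    uniq s -> uniq s' -> uniq [seq (x, y) | x <- s, y <- s'].
  by move=> *; apply: allpairs_uniq => // -[? ?] [? ?] _ _ [-> ->].
by rewrite !pair_uniq ?iota_uniq.
Qed.

Lemma flatten_map_allpairs (S T U R : Type) (F : U -> seq R) (g : S -> T -> U) s t :
  flatten [seq F x | x <- [seq g y z | y <- s, z <- t]] =
  flatten [seq flatten [seq F (g y z) | z <- t] | y <- s].
Proof.
elim: s => //= y s IHs; rewrite map_cat flatten_cat IHs; congr (_ ++ _).
by rewrite -map_comp.
Qed.

Definition upd_quad (f : nat -> nat) m (q : quad) :=
  upd (upd (upd (upd f m q.1.1.1) m.+1 q.1.1.2) m.+2 q.1.2) m.+3 q.2.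

Lemma outs_quads w phi b d m f : outs w phi b d.+4 m f =
  flatten [seq outs w phi b d m.+4 (upd_quad f m q) | q <- quads b].
Proof. by rewrite !flatten_map_allpairs. Qed.

Lemma outs_quads2 w phi b m f : outs w phi b 8 m f =
  [seq feval w (upd_quad (upd_quad f m q) m.+4 q') phi | q <- quads b, q' <- quads b].
Proof.
rewrite outs_quads; congr flatten; apply: eq_map => q; rewrite outs_quads.
by elim: (quads b) => //= q' s ->.
Qed.

(** * Names of vertices and adjacency of names *)

Section Adjacency.

Variable M : machine.

Local Notation letter := (letter M).
Local Notation tag := (tag M).
Local Notation private := (tag * 'I_25 * 'I_10)%type.

(* A vertex is named by a code, a time, a cell, and a position on the cycle
   [VX v _]. *)
Definition isO (q : quad) := [&& q.1.1.1 == 0, q.1.1.2 == 0, q.1.2 == 0 & q.2 == 0].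

(** The code 0 belongs to [VO]; the codes of [VB], [VX] and [VP] fill three consecutive intervals
    after it. *)
Definition codeB (g : letter) := (enum_rank g).+1.
Definition codeX (g : letter) := #|letter| + codeB g.
Definition codeP (p : private) := (2 * #|letter| + enum_rank p).+1.

(* Number of positions on the cycles [VX v _] reserved for each cell, twice. *)
Definition stride := (5 * #|tag|).+1.

Section Quads.

Variables (w : seq bool) (N P W : nat).

Definition height := stride * W.*2.+1.

Definition isB g (q : quad) :=
  [&& q.1.1.1 == codeB g, q.1.1.2 < W, q.1.2 < W.*2.+1 & q.2 == 0].

Definition isX g (q : quad) :=
  [&& q.1.1.1 == codeX g, q.1.1.2 < W, q.1.2 < W.*2.+1 & q.2 < height.*2].

Definition isP p (q : quad) :=
  [&& q.1.1.1 == codeP p, q.1.1.2.+1 < W, q.1.2 < W.*2.+1 & q.2 == 0].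

(** Quadruples that name nothing else become pendant vertices at [VO]. The vertex set is then a full
    cube, which loops can enumerate without any test, and a pendant vertex changes neither the
    triangles nor the difference of vertices and edges. *)
Definition isZ (q : quad) :=
  ~~ [|| isO q, some (fun g => isB g q), some (fun g => isX g q) | some (fun p => isP p q)].

Definition same (q q' : quad) := (q.1.1.2 == q'.1.1.2) && (q.1.2 == q'.1.2).

Definition is_place p (e e' : nat) :=
  match p with
  | Center => e' == W
  | Before => if e == 0 then e' == W.*2 else e'.+1 == e
  | Here => e' == e
  | After => if e == W.*2 then e' == 0 else e' == e.+1
  end.

Definition region_of (q : quad) := Region (q.1.1.2 == 0) (q.1.2 == W) (q.1.2 == W.+1) (W <= q.1.2)
  (q.1.2 <= W + N.*2) (q.1.2 <= W + N.*2 + P) (nth false w (q.1.2 - W)) (q.1.1.2.+2 == W).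

Definition is_var (tg : tag) k (q q' : quad) :=
  (q'.1.1.2 == lit_next tg k + q.1.1.2) && is_place (lit_place tg k) q.1.2 q'.1.2.

Definition isB_var (tg : tag) k q q' :=
  is_var tg k q q' && isB (lit_letter tg k (region_of q)) q'.

Definition isX_var (tg : tag) k q q' i :=
  [&& is_var tg k q q', isX (lit_letter tg k (region_of q)) q' & q'.2 == i].

Definition offset (tg : tag) k := (5 * enum_rank tg + k).+1.

Definition isX_pos (tg : tag) k q q' :=
  isX_var tg k q q'
    (stride * q.1.2 + offset tg k + if lit_sign tg k (region_of q) then 0 else height).

Definition isfst (tg : tag) c q q' :=
  match c %% 5 with
  | 0 | 1 => isO q'
  | 2 => isX_var tg (c %/ 5) q q' 0
  | 3 => isB_var tg (c %/ 5) q q'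
  | _ => isX_var tg (c %/ 5) q q' height
  end.

Definition issnd (tg : tag) c q q' :=
  match c %% 5 with
  | 0 => isX_pos tg (c %/ 5) q q'
  | 1 => isX_var tg (c %/ 5) q q' 0
  | 2 => isB_var tg (c %/ 5) q q'
  | 3 => isX_var tg (c %/ 5) q q' height
  | _ => isO q'
  end.

Definition private_arc (p p' : private) :=
  (p.1.1 == p'.1.1) &&
  ((p.1.2 == p'.1.2) && ((p.2 + 3, p'.2 + 3) \in gate_arcs) ||
   [&& p'.1.2 == ord_pred p.1.2, p'.2 == 6 :> nat & (p.2 + 3, 0) \in gate_arcs]).

Definition quad_arc (q q' : quad) :=
  [|| isO q && (some (fun g => isX g q') || isZ q'),
      same q q' && some (fun g => isX g q' && (isB g q ||
        isX g q && if q.2.+1 == height.*2 then q'.2 == 0 else q'.2 == q.2.+1)),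
      same q q' && some (fun p => isP p q && some (fun p' => isP p' q' && private_arc p p'))
    | some (fun p => isP p q &&
        (isfst p.1.1 p.1.2 q q' && ((p.2 + 3, 1) \in gate_arcs) ||
         issnd p.1.1 p.1.2 q q' && ((p.2 + 3, 2) \in gate_arcs)))].

End Quads.

Definition quad_at (f : nat -> nat) m : quad := (f m, f m.+1, f m.+2, f m.+3).

Section DefinableAdjacency.

Variables R m m' : nat.
Hypotheses (R_gt : 5 < R) (m_ok : 2 < m) (m_lt : m.+3 < R) (m_ok' : 2 < m') (m_lt' : m'.+3 < R).

Ltac definability := repeat first
  [ apply: linear_var; rewrite /var_ok; lia
  | apply: linear_const | apply: linear_mul | apply: linear_add | apply: linear_double
  | apply: linear_succ | apply: definable_const | apply: definable_le | apply: definable_eq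
  | apply: definable_and | apply: definable_or | apply: definable_not
  | apply: definable_if | apply: definable_some => ? ].

Lemma definable_isO n : 2 < n -> n.+3 < R -> definable R (fun _ f => isO (quad_at f n)).
Proof. by move=> *; rewrite /isO /quad_at /=; definability. Qed.

Lemma definable_isB n g : 2 < n -> n.+3 < R -> definable R (fun _ f => isB (f 5) g (quad_at f n)).
Proof. by move=> *; rewrite /isB /quad_at /=; definability. Qed.

Lemma definable_isX n g : 2 < n -> n.+3 < R -> definable R (fun _ f => isX (f 5) g (quad_at f n)).
Proof. by move=> *; rewrite /isX /height /quad_at /=; definability. Qed.

Lemma definable_isP n p : 2 < n -> n.+3 < R -> definable R (fun _ f => isP (f 5) p (quad_at f n)).
Proof. by move=> *; rewrite /isP /quad_at /=; definability. Qed.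

Lemma definable_isZ n : 2 < n -> n.+3 < R -> definable R (fun _ f => isZ (f 5) (quad_at f n)).
Proof.
move=> *; apply: definable_not; apply: definable_or; first exact: definable_isO.
apply: definable_or; first by apply: definable_some => g; apply: definable_isB.
apply: definable_or; first by apply: definable_some => g; apply: definable_isX.
by apply: definable_some => p; apply: definable_isP.
Qed.

Lemma definable_regions (F : region -> seq bool -> (nat -> nat) -> bool) c1 c2 c3 c4 c5 c6 c7 c8 :
  (forall r, definable R (F r)) ->
  definable R c1 ->  definable R c2 ->  definable R c3 ->  definable R c4 ->
  definable R c5 ->  definable R c6 ->  definable R c7 ->  definable R c8 ->
  definable R (fun w f =>
    F (Region (c1 w f) (c2 w f) (c3 w f) (c4 w f) (c5 w f) (c6 w f) (c7 w f) (c8 w f)) w f).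
Proof.
move=> dF *.
apply: (definable_case (F := fun b w f =>
  F (Region b (c2 w f) (c3 w f) (c4 w f) (c5 w f) (c6 w f) (c7 w f) (c8 w f)) w f)) => // b1.
apply: (definable_case (F := fun b w f =>
  F (Region b1 b (c3 w f) (c4 w f) (c5 w f) (c6 w f) (c7 w f) (c8 w f)) w f)) => // b2.
apply: (definable_case (F := fun b w f =>
  F (Region b1 b2 b (c4 w f) (c5 w f) (c6 w f) (c7 w f) (c8 w f)) w f)) => // b3.
apply: (definable_case (F := fun b w f =>
  F (Region b1 b2 b3 b (c5 w f) (c6 w f) (c7 w f) (c8 w f)) w f)) => // b4.
apply: (definable_case (F := fun b w f =>
  F (Region b1 b2 b3 b4 b (c6 w f) (c7 w f) (c8 w f)) w f)) => // b5.
apply: (definable_case (F := fun b w f =>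
  F (Region b1 b2 b3 b4 b5 b (c7 w f) (c8 w f)) w f)) => // b6.
apply: (definable_case (F := fun b w f =>
  F (Region b1 b2 b3 b4 b5 b6 b (c8 w f)) w f)) => // b7.
apply: (definable_case (F := fun b w f =>
  F (Region b1 b2 b3 b4 b5 b6 b7 b) w f)) => // b8.
Qed.

Lemma definable_region (F : region -> seq bool -> (nat -> nat) -> bool) :
  (forall r, definable R (F r)) ->
  definable R (fun w f => F (region_of w (f 3) (f 4) (f 5) (quad_at f m)) w f).
Proof.
move=> dF; rewrite /region_of /quad_at /=.
apply: (definable_regions (c7 := fun w f => nth false w (f m.+2 - f 5))) => //.
all: try by definability.
by apply: definable_bit; rewrite /var_ok; lia.
Qed.

Lemma definable_is_var tg k :
  definable R (fun _ f => is_var (f 5) tg k (quad_at f m) (quad_at f m')).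
Proof.
rewrite /is_var /quad_at /=; apply: definable_and; first by definability.
by case: (lit_place _ _); rewrite /is_place; definability.
Qed.

Lemma definable_isB_var tg k : definable R (fun w f =>
  isB_var w (f 3) (f 4) (f 5) tg k (quad_at f m) (quad_at f m')).
Proof.
apply: definable_and; first exact: definable_is_var.
apply: (definable_region (F := fun r _ f => isB (f 5) (lit_letter tg k r) (quad_at f m'))) => r.
exact: definable_isB.
Qed.

Lemma definable_isX_var tg k A : linear R A -> definable R (fun w f =>
  isX_var w (f 3) (f 4) (f 5) tg k (quad_at f m) (quad_at f m') (A f)).
Proof.
move=> lA; apply: definable_and; first exact: definable_is_var.
apply: definable_and; last by rewrite /quad_at; definability.
apply: (definable_region (F := fun r _ f => isX (f 5) (lit_letter tg k r) (quad_at f m'))) => r.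
exact: definable_isX.
Qed.

Lemma linear_height : linear R (fun f => height (f 5)).
Proof. by rewrite /height; definability. Qed.

Lemma definable_isX_pos tg k : definable R (fun w f =>
  isX_pos w (f 3) (f 4) (f 5) tg k (quad_at f m) (quad_at f m')).
Proof.
apply: (definable_region (F := fun r w f =>
  isX_var w (f 3) (f 4) (f 5) tg k (quad_at f m) (quad_at f m')
    (stride * (quad_at f m).1.2 + offset tg k + if lit_sign tg k r then 0 else height (f 5)))) => r.
apply: definable_isX_var; rewrite /quad_at /=.
by case: (lit_sign _ _ _) => /=; [definability | apply: linear_add; [definability | exact: linear_height]].
Qed.

Lemma definable_isfst tg c : definable R (fun w f =>
  isfst w (f 3) (f 4) (f 5) tg c (quad_at f m) (quad_at f m')).
Proof.
rewrite /isfst; case: (c %% 5) => [|[|[|[|k]]]].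
- exact: definable_isO.
- exact: definable_isO.
- by apply: definable_isX_var; definability.
- exact: definable_isB_var.
- exact: definable_isX_var linear_height.
Qed.

Lemma definable_issnd tg c : definable R (fun w f =>
  issnd w (f 3) (f 4) (f 5) tg c (quad_at f m) (quad_at f m')).
Proof.
rewrite /issnd; case: (c %% 5) => [|[|[|[|k]]]].
- exact: definable_isX_pos.
- by apply: definable_isX_var; definability.
- exact: definable_isB_var.
- exact: definable_isX_var linear_height.
- exact: definable_isO.
Qed.

Lemma definable_quad_arc : definable R (fun w f =>
  quad_arc w (f 3) (f 4) (f 5) (quad_at f m) (quad_at f m')).
Proof.
have same_ok : definable R (fun _ f => same (quad_at f m) (quad_at f m')).
  by rewrite /same /quad_at /=; definability.
apply: definable_or.
  apply: definable_and; first exact: definable_isO.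
  apply: definable_or; last exact: definable_isZ.
  by apply: definable_some => g; apply: definable_isX.
apply: definable_or.
  apply: definable_and => //; apply: definable_some => g.
  apply: definable_and; first exact: definable_isX.
  apply: definable_or; first exact: definable_isB.
  apply: definable_and; first exact: definable_isX.
  by rewrite /quad_at /height /=; definability.
apply: definable_or.
  apply: definable_and => //; apply: definable_some => p.
  apply: definable_and; first exact: definable_isP.
  apply: definable_some => p'; apply: definable_and; first exact: definable_isP.
  exact: definable_const.
apply: definable_some => p; apply: definable_and; first exact: definable_isP.
apply: definable_or; apply: definable_and; try exact: definable_const.
  exact: definable_isfst.
exact: definable_issnd.
Qed.

End DefinableAdjacency.

End Adjacency.

Lemma some_pred0 (T : finType) (F : T -> bool) : (forall x, F x = false) -> some F = false.
Proof. by move=> F0; apply/someP => -[x]; rewrite F0. Qed.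

Lemma some_eq (T : finType) (a : T) (F : T -> bool) : some (fun x => (x == a) && F x) = F a.
Proof.
by apply/someP/idP => [[x /andP[/eqP->]]|Fa] //; exists a; rewrite eqxx.
Qed.

Lemma eq_some (T : finType) (F F' : T -> bool) : F =1 F' -> some F = some F'.
Proof. by move=> eqF; apply: eq_has. Qed.

Lemma enum_rank_lt (T : finType) (x : T) : enum_rank x < #|T|.
Proof. exact: ltn_ord. Qed.

(** * The graph of the tableau and its description by names *)

Section Encoding.

Variables (M : machine) (T P N : nat) (w : seq bool) (B : nat).

Local Notation letter := (letter M).
Local Notation tag := (tag M).
Local Notation W := T.+1.
Local Notation h := (height M W).
Local Notation E := (width T).
Local Notation var_type := ('I_T.+1 * 'I_E * letter)%type.
Local Notation clause := (tag * 'I_T * 'I_E)%type.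
Local Notation tsgn := (tsgn P N w).
Local Notation tvar := (tvar P N w).

Definition junk := seq_sub [seq q <- quads B | isZ M W q].

Local Notation V := (vert var_type clause junk h.*2).

Lemma height_gt1 : 1 < h.
Proof. by rewrite /height /stride; nia. Qed.

Lemma offset_lt (tg : tag) k : k < 5 -> 0 < offset tg k < stride M.
Proof. by move=> lt_k; rewrite /offset /stride; have := enum_rank_lt tg; lia. Qed.

Lemma cell_offset_lt (tg : tag) k (e : 'I_E) : k < 5 -> 0 < stride M * e + offset tg k < h.
Proof.
move=> /(offset_lt tg) /andP[gt0 lt_o]; have lt_e : e < W.*2.+1 := ltn_ord e.
by rewrite addn_gt0 gt0 orbT /= /height (leq_trans _ (leq_mul (leqnn _) lt_e)) // mulnS; lia.
Qed.

Definition posn (j : clause) k := stride M * j.2 + offset j.1.1 k + if tsgn j k then 0 else h.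

Lemma posn_lt (j : clause) (k : 'I_5) : posn j k < h.*2.
Proof.
by have := cell_offset_lt j.1.1 j.2 (ltn_ord k); rewrite /posn; case: (tsgn j k); lia.
Qed.

Definition tpos (j : clause) (k : 'I_5) : 'I_h.*2 := Ordinal (posn_lt j k).

Lemma tpos_sign j k : (tpos j k < h) = tsgn j k.
Proof.
have := cell_offset_lt j.1.1 j.2 (ltn_ord k); rewrite /= /posn => /andP[_ lt_h].
by case: (tsgn j k); rewrite ?addn0 // ltnNge leq_addl.
Qed.

Lemma tpos_neq j k : tpos j k != x0 height_gt1 /\ tpos j k != xh height_gt1.
Proof.
have := cell_offset_lt j.1.1 j.2 (ltn_ord k); move=> lt_h.
split; apply/eqP => /(congr1 val); move: lt_h; rewrite /= /posn.
all: by case: (tsgn j k); move: (_ + offset _ _) (height _ _) => n n'; lia.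
Qed.

(** The position, with the summand for the sign removed, has the cell as quotient and the pair of
    tag and [k] as remainder modulo [stride]. The time of the clause is not part of it, but follows
    from the time of the variable and [lit_next]. *)
Lemma tslot_inj j (k : 'I_5) j' (k' : 'I_5) :
  tvar j k = tvar j' k' -> tpos j k = tpos j' k' -> j = j' /\ k = k'.
Proof.
move=> eq_v eq_p; have eq_s : tsgn j k = tsgn j' k' by rewrite -!tpos_sign eq_p.
have {eq_p} : stride M * j.2 + offset j.1.1 k = stride M * j'.2 + offset j'.1.1 k'.
  by move/(congr1 val): eq_p; rewrite /= /posn eq_s => /addIn.
case: j j' eq_v {eq_s} => [[tg t] e] [[tg' t'] e'] [+ _ _] /= eq_o.
have /andP[_ lt_o] := offset_lt tg (ltn_ord k).
have /andP[_ lt_o'] := offset_lt tg' (ltn_ord k').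
have eq_o2 : offset tg k = offset tg' k'.
  have := congr1 (modn^~ (stride M)) eq_o.
  by rewrite ![stride M * _]mulnC !modnMDl !modn_small.
have eq_e : e = e' :> nat by move: eq_o; rewrite eq_o2 => /addIn/eqP; rewrite eqn_pmul2l // => /eqP.
have lt_k := ltn_ord k; have lt_k' := ltn_ord k'.
have eq_k : k = k' by apply: ord_inj; move: eq_o2; rewrite /offset; lia.
have eq_tg : tg = tg'.
  by apply: enum_rank_inj; apply: ord_inj; move: eq_o2; rewrite /offset eq_k; lia.
move/(congr1 (@nat_of_ord _)); rewrite !val_lit_time eq_tg eq_k => /addnI/ord_inj->.
by rewrite (ord_inj eq_e).
Qed.

Definition tableau_graph : graph V := sat_graph junk height_gt1 tvar tpos.

Lemma wsat_tableau_graph : (wsat tableau_graph K3).+1 = #|{: V}| <-> tableau_sat M T P N w.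
Proof.
apply: (iff_trans (wsat_sat_graph junk tpos_neq tslot_inj)).
split=> -[tau tauP]; exists tau => j; have [k] := tauP j; exists k.
  by rewrite -tpos_sign.
by rewrite tpos_sign.
Qed.

Definition encode (u : V) : quad :=
  match u with
  | VO => (0, 0, 0, 0)
  | VB v => (codeB v.2, nat_of_ord v.1.1, nat_of_ord v.1.2, 0)
  | VX v i => (codeX v.2, nat_of_ord v.1.1, nat_of_ord v.1.2, nat_of_ord i)
  | VP j c a => (codeP (j.1.1, c, a), nat_of_ord j.1.2, nat_of_ord j.2, 0)
  | VZ z => val z
  end.

Lemma codeB_eq (g g' : letter) : (codeB g == codeB g') = (g' == g).
Proof. by rewrite eqSS eq_sym (inj_eq val_inj) (inj_eq enum_rank_inj). Qed.

Lemma codeX_eq (g g' : letter) : (codeX g == codeX g') = (g' == g).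
Proof. by rewrite eqn_add2l codeB_eq. Qed.

Lemma codeP_eq (p p' : tag * 'I_25 * 'I_10) : (codeP p == codeP p') = (p' == p).
Proof. by rewrite eqSS eqn_add2l eq_sym (inj_eq val_inj) (inj_eq enum_rank_inj). Qed.

Lemma codeB_bounds (g : letter) : 0 < codeB g <= #|letter|.
Proof. exact: ltn_ord. Qed.

Lemma codeX_bounds (g : letter) : #|letter| < codeX g <= 2 * #|letter|.
Proof. by have := codeB_bounds g; rewrite /codeX; lia. Qed.

Lemma codeP_bounds (p : tag * 'I_25 * 'I_10) : 2 * #|letter| < codeP p.
Proof. by rewrite /codeP; lia. Qed.

Lemma codeX_codeB (g g' : letter) : (codeX g == codeB g') = false.
Proof.
have [/andP[_ leB] /andP[ltX _]] := (codeB_bounds g', codeX_bounds g).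
exact: gtn_eqF (leq_ltn_trans leB ltX).
Qed.

Lemma codeP_codeX (p : tag * 'I_25 * 'I_10) (g : letter) : (codeP p == codeX g) = false.
Proof.
have [/andP[_ leX] ltP] := (codeX_bounds g, codeP_bounds p).
exact: gtn_eqF (leq_ltn_trans leX ltP).
Qed.

Lemma codeP_codeB (p : tag * 'I_25 * 'I_10) (g : letter) : (codeP p == codeB g) = false.
Proof.
have [/andP[_ leB] ltP] := (codeB_bounds g, codeP_bounds p); apply: gtn_eqF (leq_ltn_trans _ ltP).
by rewrite mul2n -addnn (leq_trans leB) ?leq_addr.
Qed.

Lemma junkP (z : junk) :
  [/\ isZ M W (val z), isO (val z) = false, forall g : letter, isB W g (val z) = false,
      forall g : letter, isX W g (val z) = false & forall p : tag * 'I_25 * 'I_10, isP W p (val z) = false].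
Proof.
have := valP z; rewrite mem_filter => /andP[zZ _].
move: (zZ); rewrite {1}/isZ !negb_or => /and4P[/negPf nO /someP nB /someP nX /someP nP].
by split=> // x; apply/negP=> zx; [case: nB | case: nX | case: nP]; exists x.
Qed.

Lemma isO_encode u : isO (encode u) = if u is VO then true else false.
Proof.
case: u => //= [v i|z]; first by rewrite /isO /= /codeX /codeB addnS.
by have [_ ->] := junkP z.
Qed.

Lemma isB_encode g u : isB W g (encode u) = if u is VB v then g == v.2 else false.
Proof.
case: u => [|v|v i|j c a|z]; rewrite /isB /=.
- by [].
- by rewrite codeB_eq (ltn_ord v.1.1) (ltn_ord v.1.2 : _ < W.*2.+1) !andbT.
- by rewrite codeX_codeB.
- by rewrite codeP_codeB.
- by have [_ _ nz _ _] := junkP z; exact: nz.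
Qed.

Lemma isX_encode g u : isX W g (encode u) = if u is VX v _ then g == v.2 else false.
Proof.
case: u => [|v|v i|j c a|z]; rewrite /isX /=.
- by rewrite /codeX /codeB addnS.
- by rewrite eq_sym codeX_codeB.
- by rewrite codeX_eq (ltn_ord v.1.1) (ltn_ord v.1.2 : _ < W.*2.+1) (ltn_ord i) !andbT.
- by rewrite codeP_codeX.
- by have [_ _ _ nz _] := junkP z; exact: nz.
Qed.

Lemma isP_encode p u : isP W p (encode u) = if u is VP j c a then p == (j.1.1, c, a) else false.
Proof.
case: u => [|v|v i|j c a|z]; rewrite /isP /=.
- by [].
- by rewrite eq_sym codeP_codeB.
- by rewrite eq_sym codeP_codeX.
- by rewrite codeP_eq ltnS (ltn_ord j.1.2) (ltn_ord j.2 : _ < W.*2.+1) !andbT.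
- by have [_ _ _ _ nz] := junkP z; exact: nz.
Qed.

Lemma isZ_encode u : isZ M W (encode u) = if u is VZ _ then true else false.
Proof.
case: u => [|v|v i|j c a|z] /=.
- by [].
- by apply/negbF/or4P; constructor 2; apply/someP; exists v.2; rewrite (isB_encode v.2 (VB v)).
- by apply/negbF/or4P; constructor 3; apply/someP; exists v.2; rewrite (isX_encode v.2 (VX v i)).
- apply/negbF/or4P; constructor 4; apply/someP; exists (j.1.1, c, a).
  by rewrite (isP_encode _ (VP j c a)).
- by have [] := junkP z.
Qed.

Lemma eq_VB (v v' : var_type) : (VB v == VB v' :> V) = (v == v').
Proof. by apply/eqP/eqP => [[]|->]. Qed.

Lemma eq_VX (v v' : var_type) i i' : (VX v i == VX v' i' :> V) = (v == v') && (i == i').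
Proof. by apply/eqP/andP => [[-> ->]|[/eqP-> /eqP->]]. Qed.

Lemma is_place_ord p (e e' : 'I_E) : is_place W p e e' = (e' == place_ord p e).
Proof.
rewrite -val_eqE; case: p => /=.
- by rewrite val_center.
- by have := val_ord_pred_width e => /= ->; case: eqP => e0 //=; lia.
- by [].
- by have := val_ordS_width e => /= ->; rewrite /E eqSS; case: eqP.
Qed.

Section Clause.

Variables (j : clause) (c : 'I_25) (a : 'I_10).
Local Notation q := (encode (VP j c a)).

Lemma region_encode : region_of w N P W q = region_at T P N w j.1.2 j.2.
Proof. by []. Qed.

Lemma isB_var_encode k u : isB_var w N P W j.1.1 k q (encode u) = (u == VB (tvar j k)).
Proof.
rewrite /isB_var isB_encode region_encode; case: u => [|v|v i|j' c' a'|z]; rewrite ?andbF //.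
rewrite eq_VB /is_var /= is_place_ord /tvar -val_lit_time val_eqE eq_sym.
case: v => [[t e] g] /=; rewrite [X in _ && X]eq_sym [X in X && _ && _]eq_sym.
by rewrite [RHS]xpair_eqE [X in _ = X && _]xpair_eqE.
Qed.

Lemma isX_var_encode k i u :
  isX_var w N P W j.1.1 k q (encode u) (nat_of_ord i) = (u == VX (tvar j k) i).
Proof.
rewrite /isX_var isX_encode region_encode; case: u => [|v|v i'|j' c' a'|z]; rewrite ?andbF //.
rewrite eq_VX /is_var /= is_place_ord /tvar -val_lit_time val_eqE eq_sym.
case: v => [[t e] g] /=; rewrite andbA [X in _ && X && _ = _]eq_sym [X in X && _ && _ && _ = _]eq_sym.
by rewrite -val_eqE [in RHS]xpair_eqE [X in _ = X && _ && _]xpair_eqE.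
Qed.

Local Notation fst_vertex := (fstv junk height_gt1 tvar j c).
Local Notation snd_vertex := (sndv junk height_gt1 tvar tpos j c).

Lemma isO_eq u : isO (encode u) = (u == VO).
Proof. by rewrite isO_encode; apply/idP/eqP => [|->] //; case: u. Qed.

Lemma isfst_encode u : isfst w N P W j.1.1 c q (encode u) = (u == fst_vertex).
Proof.
rewrite /isfst /fstv; case: (c %% 5) => [|[|[|[|n]]]]; rewrite ?isO_eq //.
- exact: (isX_var_encode (c %/ 5) (x0 height_gt1)).
- exact: (isB_var_encode (c %/ 5)).
- exact: (isX_var_encode (c %/ 5) (xh height_gt1)).
Qed.

Lemma issnd_encode u : issnd w N P W j.1.1 c q (encode u) = (u == snd_vertex).
Proof.
rewrite /issnd /sndv; case: (c %% 5) => [|[|[|[|n]]]]; rewrite ?isO_eq //.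
- exact: (isX_var_encode (c %/ 5) (tpos j (slot height_gt1 c))). 
- exact: (isX_var_encode (c %/ 5) (x0 height_gt1)).
- exact: (isB_var_encode (c %/ 5)).
- exact: (isX_var_encode (c %/ 5) (xh height_gt1)).
Qed.

End Clause.

Lemma some_isX u : some (fun g : letter => isX W g (encode u)) = if u is VX _ _ then true else false.
Proof.
rewrite (eq_some (isX_encode^~ u)); case: u => *; try exact: some_pred0.
by apply/someP; eexists; apply: eqxx.
Qed.

Lemma same_encode (x y : var_type) i n n' :
  same (n, nat_of_ord x.1.1, nat_of_ord x.1.2, n') (encode (VX y i)) && (y.2 == x.2) = (x == y).
Proof.
case: x y => [[t e] g] [[t' e'] g'].
by rewrite /same /= !val_eqE [g' == g]eq_sym [RHS]xpair_eqE [X in _ = X && _]xpair_eqE.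
Qed.

Lemma quad_arc_cycle u v :
  same (encode u) (encode v) && some (fun g : letter => isX W g (encode v) && (isB W g (encode u) ||
    isX W g (encode u) && if (encode u).2.+1 == h.*2 then (encode v).2 == 0
                          else (encode v).2 == (encode u).2.+1)) =
  match u, v with
  | VB x, VX y _ => x == y
  | VX x i, VX y i' => (x == y) && (i' == ordS i)
  | _, _ => false
  end.
Proof.
case: v => [|y|y i'|j' c' a'|z]; try by
  rewrite some_pred0 => [|g]; [rewrite andbF; case: u | cbv beta; rewrite isX_encode].
rewrite (eq_some (F' := fun g => (g == y.2) && (isB W g (encode u) ||
    isX W g (encode u) && if (encode u).2.+1 == h.*2 then i' == 0 :> nat
                          else i' == (encode u).2.+1 :> nat))) => [|g]; last by cbv beta; rewrite isX_encode.
rewrite some_eq isB_encode isX_encode; case: u => [|x|x i|j c a|z]; rewrite ?andbF //.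
  by rewrite orbF same_encode.
rewrite andbA same_encode; congr (_ && _); rewrite -val_eqE /=.
by case: eqP => [->|ne]; rewrite ?modnn // modn_small //; have := ltn_ord i; lia.
Qed.

Lemma quad_arc_private u v :
  same (encode u) (encode v) && some (fun p : tag * 'I_25 * 'I_10 => isP W p (encode u) &&
    some (fun p' => isP W p' (encode v) && private_arc p p')) =
  match u, v with
  | VP j c a, VP j' c' a' => (j == j') && 
      ((c == c') && ((a + 3, a' + 3) \in gate_arcs) ||
       [&& c' == ord_pred c, a' == 6 :> nat & (a + 3, 0) \in gate_arcs])
  | _, _ => false
  end.
Proof.
case: u => [|y|y i'|j c a|z]; try by
  rewrite some_pred0 => [|g]; [rewrite andbF | cbv beta; rewrite isP_encode].
rewrite (eq_some (F' := fun p => (p == (j.1.1, c, a)) && some (fun p' => isP W p' (encode v) &&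
  private_arc p p'))) => [|p]; last by cbv beta; rewrite isP_encode.
rewrite some_eq.
case: v => [|y|y i'|j' c' a'|z]; try by
  rewrite some_pred0 => [|g]; [rewrite andbF | cbv beta; rewrite isP_encode].
rewrite (eq_some (F' := fun p => (p == (j'.1.1, c', a')) && private_arc (j.1.1, c, a) p)) => [|p];
  last by cbv beta; rewrite isP_encode.
rewrite some_eq /private_arc /= andbA; congr (_ && _).
case: j j' => [[tg t] e] [[tg' t'] e'] /=; rewrite /same /= !val_eqE.
by rewrite [RHS]xpair_eqE [X in _ = X && _]xpair_eqE andbC andbA.
Qed.

Lemma quad_arc_glue u v :
  some (fun p : tag * 'I_25 * 'I_10 => isP W p (encode u) &&
    (isfst w N P W p.1.1 p.1.2 (encode u) (encode v) && ((p.2 + 3, 1) \in gate_arcs) ||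
     issnd w N P W p.1.1 p.1.2 (encode u) (encode v) && ((p.2 + 3, 2) \in gate_arcs))) =
  match u with
  | VP j c a =>
     (v == fstv junk height_gt1 tvar j c) && ((a + 3, 1) \in gate_arcs) ||
     (v == sndv junk height_gt1 tvar tpos j c) && ((a + 3, 2) \in gate_arcs)
  | _ => false
  end.
Proof.
case: u => [|y|y i'|j c a|z]; try by rewrite some_pred0 => // g; cbv beta; rewrite isP_encode.
rewrite (eq_some (F' := fun p => (p == (j.1.1, c, a)) && 
    (isfst w N P W p.1.1 p.1.2 (encode (VP j c a)) (encode v) && ((p.2 + 3, 1) \in gate_arcs) ||
     issnd w N P W p.1.1 p.1.2 (encode (VP j c a)) (encode v) && ((p.2 + 3, 2) \in gate_arcs))))
  => [|p]; last by cbv beta; rewrite isP_encode.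
by rewrite some_eq isfst_encode issnd_encode.
Qed.

Lemma quad_arc_encode u v :
  quad_arc M w N P W (encode u) (encode v) = arc height_gt1 tvar tpos u v.
Proof.
rewrite /quad_arc isO_encode isZ_encode some_isX quad_arc_cycle quad_arc_private quad_arc_glue.
case: u v => [|x|x i|j c a|z] [|x'|x' i'|j' c' a'|z'] //=; rewrite ?orbF //.
have -> : (VP j' c' a' == fstv junk height_gt1 tvar j c) = false.
  by apply/eqP; rewrite /fstv; case: (c %% 5) => [|[|[|[|n]]]].
have -> : (VP j' c' a' == sndv junk height_gt1 tvar tpos j c) = false.
  by apply/eqP; rewrite /sndv; case: (c %% 5) => [|[|[|[|n]]]].
by rewrite orbF.
Qed.

Lemma adj_tableau_graph u v : adj tableau_graph u v =
  quad_arc M w N P W (encode u) (encode v) || quad_arc M w N P W (encode v) (encode u).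
Proof. by rewrite !quad_arc_encode adj_sat. Qed.

End Encoding.

Section Numbering.

Variables (M : machine) (T B : nat).
Local Notation letter := (letter M).
Local Notation tag := (tag M).
Local Notation W := T.+1.
Local Notation h := (height M W).
Local Notation E := (width T).
Local Notation var_type := ('I_T.+1 * 'I_E * letter)%type.
Local Notation clause := (tag * 'I_T * 'I_E)%type.
Local Notation V := (vert var_type clause (junk M T B) h.*2).
Local Notation encode := (@encode M T B).

Lemma encode_inj : injective encode.
Proof.
move=> u v eq_uv.
have isO_uv : isO (encode u) = isO (encode v) by rewrite eq_uv.
have isB_uv (g : letter) : isB W g (encode u) = isB W g (encode v) by rewrite eq_uv.
have isX_uv (g : letter) : isX W g (encode u) = isX W g (encode v) by rewrite eq_uv.
have isP_uv (p : tag * 'I_25 * 'I_10) : isP W p (encode u) = isP W p (encode v) by rewrite eq_uv.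
have isZ_uv : isZ M W (encode u) = isZ M W (encode v) by rewrite eq_uv.
case: u v eq_uv isO_uv isB_uv isX_uv isP_uv isZ_uv =>
  [|[[t e] g]|[[t e] g] i|[[tg t] e] c a|z] [|[[t' e'] g']|[[t' e'] g'] i'|[[tg' t'] e'] c' a'|z'] eq_uv.
all: rewrite !isO_encode !isZ_encode // => _ isB_uv isX_uv isP_uv _ //.
all: try by have := isB_uv g; rewrite !isB_encode eqxx.
all: try by have := isX_uv g; rewrite !isX_encode eqxx.
all: try by have := isP_uv (tg, c, a); rewrite !isP_encode eqxx.
all: try by have := isB_uv g'; rewrite !isB_encode eqxx.
all: try by have := isX_uv g'; rewrite !isX_encode eqxx.
- have := isB_uv g; rewrite !isB_encode eqxx => /esym/eqP /= ->.
  by case: eq_uv => _ /ord_inj-> /ord_inj->.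
- have := isX_uv g; rewrite !isX_encode eqxx => /esym/eqP /= ->.
  by case: eq_uv => _ /ord_inj-> /ord_inj-> /ord_inj->.
- have := isP_uv (tg, c, a); rewrite !isP_encode eqxx => /esym/eqP [-> -> ->].
  by case: eq_uv => _ /ord_inj-> /ord_inj->.
by rewrite (val_inj eq_uv : z = z').
Qed.

Lemma encode_surj q : q \in quads B -> exists u, encode u = q.
Proof.
move=> qB; case zq: (isZ M W q).
  have qZ : q \in [seq q <- quads B | isZ M W q] by rewrite mem_filter zq.
  by exists (VZ (SeqSub qZ)).
move/negbFE: zq => /or4P[|/someP[g]|/someP[g]|/someP[[[tg c] a]]]; case: q {qB} => [[[n t] e] i].
- by move=> /and4P[/eqP/= -> /eqP/= -> /eqP/= -> /eqP/= ->]; exists VO.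
- move=> /and4P[/eqP/= -> lt_t lt_e /eqP/= ->].
  by exists (VB (Ordinal lt_t, Ordinal (lt_e : e < E), g)).
- move=> /and4P[/eqP/= -> lt_t lt_e lt_i].
  by exists (VX (Ordinal lt_t, Ordinal (lt_e : e < E), g) (Ordinal lt_i)).
- move=> /and4P[/eqP/= -> lt_t lt_e /eqP/= ->].
  by exists (VP (tg, Ordinal (lt_t : t < T), Ordinal (lt_e : e < E)) c a).
Qed.

Definition num_codes := (2 * #|letter| + #|{: tag * 'I_25 * 'I_10}|).+1.

Lemma codeP_lt (p : tag * 'I_25 * 'I_10) : codeP p < num_codes.
Proof. by rewrite /codeP /num_codes ltnS ltn_add2l enum_rank_lt. Qed.

Lemma codeX_lt (g : letter) : codeX g < num_codes.
Proof. by have /andP[_ le_c] := codeX_bounds g; rewrite ltnS (leq_trans le_c) ?leq_addr. Qed.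

Lemma codeB_lt (g : letter) : codeB g < num_codes.
Proof. by apply: leq_ltn_trans (codeX_lt g); rewrite /codeX leq_addl. Qed.

Hypothesis B_ge : num_codes + (2 * stride M) * W.*2.+1 <= B.

Lemma encode_quads u : encode u \in quads B.
Proof.
have le_width : W.*2.+1 <= B.
  by apply: leq_trans (leq_trans (leq_addl _ _) B_ge); rewrite leq_pmull.
have le_height : h.*2 <= B.
  by apply: leq_trans (leq_trans (leq_addl _ _) B_ge); rewrite -mul2n mulnA.
have le_codes : num_codes <= B by apply: leq_trans (leq_addr _ _) B_ge.
have le_time : W <= B by lia.
have B_gt0 : 0 < B by lia.
have lt_time (t : 'I_W) : t < B by apply: leq_trans (ltn_ord t) le_time.
have lt_cell (e : 'I_E) : e < B by apply: leq_trans (ltn_ord e) le_width.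
rewrite mem_quads; case: u => [|v|v i|j c a|z] /=.
- by rewrite B_gt0.
- by rewrite lt_time lt_cell B_gt0 (leq_trans (codeB_lt _)).
- by rewrite lt_time lt_cell (leq_trans (codeX_lt _)) //= (leq_trans (ltn_ord i)).
- by rewrite (lt_time (widen_ord (leqnSn T) j.1.2)) lt_cell B_gt0 (leq_trans (codeP_lt _)).
by have := valP z; rewrite mem_filter mem_quads => /andP[].
Qed.

(** Numbers the vertices in the order in which the loops meet their names; by [encode_surj] every
    name in the cube has a vertex. *)
Definition vertices : seq V := [seq odflt VO [pick u | encode u == q] | q <- quads B].

Lemma map_encode_vertices : map encode vertices = quads B.
Proof.
rewrite -map_comp -[RHS]map_id; apply/eq_in_map => q qB /=.
case: pickP => [u /eqP //|]; have [u uq] := encode_surj qB.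
by move/(_ u); rewrite uq eqxx.
Qed.

Lemma allpairs_quads (R : Type) (F : quad -> quad -> R) :
  [seq F q q' | q <- quads B, q' <- quads B] =
  [seq F (encode u) (encode v) | u <- vertices, v <- vertices].
Proof. by rewrite -{1 2}map_encode_vertices allpairs_mapl allpairs_mapr. Qed.

Lemma vertices_uniq : uniq vertices.
Proof. by apply: (@map_uniq _ _ encode); rewrite map_encode_vertices quads_uniq. Qed.

Lemma mem_vertices u : u \in vertices.
Proof. by rewrite -(mem_map encode_inj) map_encode_vertices encode_quads. Qed.

Lemma size_vertices : size vertices = #|{: V}|.
Proof.
by apply/eqP; rewrite eq_sym -(card_uniqP vertices_uniq); apply/eqP/eq_card => u; rewrite mem_vertices.
Qed.

End Numbering.

Section NumberGraph.

Variables (V : finType) (F : graph V) (s : seq V).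
Hypotheses (s_uniq : uniq s) (mem_s : forall u, u \in s).

Lemma index_lt u : index u s < size s. Proof. by rewrite index_mem. Qed.

Definition to_ord u : 'I_(size s) := Ordinal (index_lt u).
Definition of_ord (i : 'I_(size s)) : V := tnth (in_tuple s) i.

Lemma to_ordK : cancel to_ord of_ord.
Proof. by move=> u; rewrite /of_ord (tnth_nth u) /= nth_index. Qed.

Lemma of_ordK : cancel of_ord to_ord.
Proof.
move=> i; apply: ord_inj; rewrite /of_ord /= (tnth_nth (tnth (in_tuple s) i)) /=.
by rewrite index_uniq.
Qed.

Definition number_graph : graph 'I_(size s) := relabel to_ordK F.

Lemma wsat_number_graph : wsat number_graph K3 = wsat F K3.
Proof. exact: wsat_relabel to_ordK of_ordK (adj_relabel to_ordK F). Qed.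

Lemma encode_number_graph : encode_graph number_graph = [seq adj F u v | u <- s, v <- s].
Proof.
have sE : [seq of_ord i | i <- enum 'I_(size s)] = s by rewrite (map_tnth_enum (in_tuple s)).
rewrite -[in RHS]sE allpairs_mapl allpairs_mapr; congr flatten.
apply: eq_map => i; apply: eq_map => j.
by rewrite -(adj_relabel to_ordK) !of_ordK.
Qed.

End NumberGraph.

Lemma eq_map_allpairs (S T R : eqType) (F F' : S -> T -> R) s t :
  [seq F x y | x <- s, y <- t] = [seq F' x y | x <- s, y <- t] ->
  {in s & t, F =2 F'}.
Proof.
elim: s => //= x s IHs /eqP; rewrite eqseq_cat ?size_map // => /andP[/eqP/eq_in_map eqx /eqP/IHs eqs].
by move=> z y; rewrite inE => /predU1P[->|zs] yt; [exact: eqx | exact: eqs].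
Qed.

Lemma encode_graph_inj n (F F' : graph 'I_n) : encode_graph F = encode_graph F' -> F = F'.
Proof.
move/eq_map_allpairs=> eqF; apply: val_inj; apply/setP=> e.
have [/cards2P[i [j [_ ->]]]|ne2] := boolP (#|e| == 2); first by apply: eqF; rewrite mem_enum.
have notin (G : graph 'I_n) : (e \in edges G) = false.
  by apply: contraNF ne2 => eG; apply: (forall_inP (edgesP G)).
by rewrite !notin.
Qed.

Lemma size_encode_graph n (F : graph 'I_n) : size (encode_graph F) = n * n.
Proof. by rewrite size_allpairs size_enum_ord. Qed.

(** The length [n * n] of an adjacency matrix determines [n], so a word encodes at most one
    graph. *)
Lemma wsat_K3_minimal_encode n (F : graph 'I_n) :
  wsat_K3_minimal (encode_graph F) <-> (wsat F K3).+1 = n.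
Proof.
split=> [[n' [F' [eqF wsatF]]]|wsatF]; last by exists n, F.
have /eqP := congr1 size eqF; rewrite !size_encode_graph !mulnn eqn_sqr => /eqP eq_n.
by move: F' eqF wsatF; rewrite -eq_n => F' /encode_graph_inj->.
Qed.

Import GRing.Theory.

Lemma horner_nat_mono (p : {poly nat}) m n : m <= n -> (p.[m])%R <= (p.[n])%R.
Proof.
move=> le_mn; elim/poly_ind: p => [|p c IHp]; first by rewrite !horner0.
by rewrite !hornerMXaddC; apply: leq_add => //; apply: leq_mul.
Qed.

Lemma iter_step_halted (M : machine) (c : config M) t t' : t <= t' ->
  halting (iter t (@step M) c).1 -> iter t' (@step M) c = iter t (@step M) c.
Proof.
move=> /subnK<- halted; elim: (t' - t) => //= n ->.
by rewrite /step halted.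
Qed.

Import GRing.Theory.

Lemma hornerD_nat (p q : {poly nat}) n : ((p + q).[n])%R = (p.[n])%R + (q.[n])%R.
Proof. exact: hornerD. Qed.

Lemma hornerM_nat (p q : {poly nat}) n : ((p * q).[n])%R = (p.[n])%R * (q.[n])%R.
Proof. exact: hornerM. Qed.

Lemma horner1_nat n : ((1 : {poly nat}).[n])%R = 1.
Proof. exact: hornerC. Qed.

(** * The polynomials of the reduction and its correctness *)

Section Reduction.

Variables (M : machine) (p q : {poly nat}).

(** The first summand is the running time on an encoded pair of the greatest length 2N + 1 + P; the
    second one makes room for input and witness to the right of the center. *)
Definition time_poly : {poly nat} := (q \Po ('X + 'X + 1 + p) + ('X + 'X + p + 1))%R.
Definition center_poly : {poly nat} := (time_poly + 1)%R.
Definition side_poly : {poly nat} :=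
  ((num_codes M)%:P + (2 * stride M)%:P * (center_poly + center_poly + 1))%R.

Lemma time_polyE N :
  (time_poly.[N])%R = (q.[N.*2.+1 + (p.[N])%R])%R + (N.*2 + (p.[N])%R).+1.
Proof.
rewrite /time_poly hornerD_nat horner_comp !hornerD_nat !hornerX horner1_nat.
congr (_ + _); last by lia.
by congr (horner q _); lia.
Qed.

Lemma center_polyE N : (center_poly.[N])%R = (time_poly.[N])%R.+1.
Proof. by rewrite /center_poly hornerD_nat horner1_nat addn1. Qed.

Lemma side_polyE N :
  (side_poly.[N])%R = num_codes M + 2 * stride M * (center_poly.[N])%R.*2.+1.
Proof.
by rewrite /side_poly !(hornerD_nat, hornerM_nat, horner1_nat, hornerC) addn1 addnn.
Qed.

(** Registers 3, 4 and 5 hold the input length, the witness bound and the center, register 6 the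
    side of the cube, and 7 to 10 and 11 to 14 the names of two vertices. This makes 15 registers
    and eight loops bounded by register 6. *)
Lemma definable_adjacency : definable 15 (fun w f =>
  quad_arc M w (f 3) (f 4) (f 5) (quad_at f 7) (quad_at f 11) ||
  quad_arc M w (f 3) (f 4) (f 5) (quad_at f 11) (quad_at f 7)).
Proof. by apply: definable_or; apply: definable_quad_arc. Qed.

Definition reduction_polys := [:: p; center_poly; side_poly].

Lemma side_ge N n : n <= ((center_poly.[N])%R).*2.+1 -> n <= (side_poly.[N])%R.
Proof.
by move/leq_trans; apply; rewrite side_polyE (leq_trans _ (leq_addl _ _)) // leq_pmull.
Qed.

Lemma polytime_reduction phi : fm_ok 15 phi -> polytime (driver_out reduction_polys 8 6 phi).
Proof.
move=> phi_ok; apply: polytime_driver => //= [N|N i].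
  by apply: side_ge; rewrite center_polyE time_polyE; lia.
case: i => [|[|[|i]]] //=; last by rewrite nth_nil horner0.
  by apply: side_ge; rewrite center_polyE time_polyE; lia.
by apply: side_ge; lia.
Qed.

Section Instance.

Variables (x : seq bool) (phi : fm).
Hypothesis phiE : forall w f, feval w f phi =
  quad_arc M w (f 3) (f 4) (f 5) (quad_at f 7) (quad_at f 11) ||
  quad_arc M w (f 3) (f 4) (f 5) (quad_at f 11) (quad_at f 7).

Local Notation N := (size x).
Local Notation w := (dbl x).
Local Notation T := (time_poly.[N])%R.
Local Notation P := (p.[N])%R.
Local Notation B := (side_poly.[N])%R.

Lemma side_ok : num_codes M + 2 * stride M * T.+1.*2.+1 <= B.
Proof. by rewrite side_polyE center_polyE. Qed.

Definition reduced_graph :=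
  number_graph (tableau_graph M T P N w B) (mem_vertices side_ok).

Lemma driver_outE : driver_out reduction_polys 8 6 phi x = encode_graph reduced_graph.
Proof.
rewrite encode_number_graph ?vertices_uniq //.
apply: (etrans (outs_quads2 w phi B 7 (params reduction_polys N))).
apply: (etrans (allpairs_quads M T B _)); congr flatten; apply: eq_map => u; apply: eq_map => v.
rewrite phiE adj_tableau_graph /quad_at /upd_quad /upd /= /params /= center_polyE.
by case: (encode u) (encode v) => [[[a1 a2] a3] a4] [[[b1 b2] b3] b4].
Qed.

Lemma reduced_graphP : wsat_K3_minimal (driver_out reduction_polys 8 6 phi x) <->
  exists2 y, size y <= P & output (iter T (@step M) (init M (encode_pair x y))) = [:: true].
Proof.
rewrite driver_outE; apply: iff_trans (wsat_K3_minimal_encode _) _.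
rewrite wsat_number_graph ?vertices_uniq // size_vertices; last exact: side_ok.
apply: iff_trans (wsat_tableau_graph _ _ _ _ _ _) _.
apply: tableau_satP; first by rewrite time_polyE addnS.
  by rewrite size_dbl muln2.
by rewrite time_polyE addnS ltnS leq_addl.
Qed.

End Instance.

End Reduction.

Theorem theorem1 : NP_hard wsat_K3_minimal.
Proof.
move=> A [V [p [[M [q MP]] AP]]].
have [phi [phi_ok phiE]] := definable_adjacency M.
exists (driver_out (reduction_polys M p q) 8 6 phi); split; first exact: polytime_reduction.
move=> x; apply: iff_trans (AP x) _; apply: iff_sym.
apply: iff_trans (reduced_graphP p q x phiE) _.
(* The verifier halts within [q] at the length of the pair. Monotonicity of [q] and the fixed halted
   configurations carry this over to one time common to all witnesses. *)
have outE y : size y <= (p.[size x])%R ->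
    output (iter ((time_poly p q).[size x])%R (@step M) (init M (encode_pair x y))) =
    [:: V (encode_pair x y)].
  move=> le_y; have [halted <-] := MP (encode_pair x y); congr output.
  apply: iter_step_halted halted; rewrite time_polyE; apply: leq_trans (leq_addr _ _).
  apply: horner_nat_mono; rewrite size_cat /= [size (flatten _)](size_dbl x) muln2; lia.
split=> [[y le_y]|[y [le_y Vy]]]; first by rewrite outE // => -[Vy]; exists y.
by exists y; rewrite // outE // Vy.
Qed.
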